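(* Let $B=A^{coH}\subseteq A$ be a faithfully flat Hopf--Galois extension and let $\mathcal{C}(A,H)$ be the corresponding Ehresmann--Schauenburg bialgebroid. Then there is a group isomorphism $\alpha:\mathrm{Aut}_H(A)\to\mathcal{B}(\mathcal{C}(A,H))$ between the group of gauge transformations and the group of bisections.
   Context: All vector spaces, (unital associative) algebras and Hopf algebras are over $\mathbb{C}$, and $\otimes=\otimes_{\mathbb{C}}$. $H$ is a Hopf algebra and $A$ is a right $H$-comodule algebra, i.e. an algebra with a right coaction $\delta^A:A\to A\otimes H$, $\delta^A(a)=a_{(0)}\otimes a_{(1)}$, which is a unital algebra map. $B=A^{coH}=\{b\in A:\delta^A(b)=b\otimes 1_H\}$. The extension $B\subseteq A$ is $H$-Hopf--Galois if the canonical map $\chi:A\otimes_B A\to A\otimes H$, $a'\otimes_B a\mapsto a'a_{(0)}\otimes a_{(1)}$, is bijective; it is faithfully flat if $A$ is faithfully flat as a right $B$-module. The translation map is $\tau:H\to A\otimes_B A$, $\tau(h)=\chi^{-1}(1_A\otimes h)=h^{<1>}\otimes_B h^{<2>}$ (sum understood). Gauge group: $\mathrm{Aut}_H(A)$ is the set of unital algebra maps $A\to A$ which are right $H$-comodule maps and restrict to the identity on $B$; it is a group under map composition. Ehresmann--Schauenburg bialgebroid: $\mathcal{C}(A,H)=(A\otimes A)^{coH}=\{a\otimes\tilde a\in A\otimes A: a_{(0)}\otimes\tilde a_{(0)}\otimes a_{(1)}\tilde a_{(1)}=a\otimes\tilde a\otimes 1_H\}$ (elements are written $a\otimes\tilde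 a$ with sums understood). Its product is $(x\otimes\tilde x)(y\otimes\tilde y)=xy\otimes\tilde y\tilde x$ with unit $1_A\otimes 1_A$; source $s(b)=b\otimes 1_A$ and target $t(b)=1_A\otimes b$; $B$-bimodule structure $b\triangleright X\triangleleft\tilde b=s(b)t(\tilde b)X$; coproduct $\Delta(a\otimes\tilde a)=a_{(0)}\otimes\tau(a_{(1)})\otimes\tilde a\in\mathcal{C}(A,H)\otimes_B\mathcal{C}(A,H)$, written $\Delta(X)=X_{(1)}\otimes_B X_{(2)}$; counit $\varepsilon(a\otimes\tilde a)=a\tilde a\in B$. Bisections: a bisection is a linear map $\sigma:\mathcal{C}(A,H)\to B$ such that (1) $\sigma(1_A\otimes 1_A)=1_B$; (2) $\sigma(s(b)t(\tilde b)X)=b\,\sigma(X)\,\tilde b$; (3) $\sigma(X\,s(\sigma(Y)))=\sigma(XY)$, for all $b,\tilde b\in B$ and $X,Y\in\mathcal{C}(A,H)$. The set $\mathcal{B}(\mathcal{C}(A,H))$ of bisections is a group under the convolution product $\sigma_1\ast\sigma_2(X)=\sigma_1(X_{(1)})\,\sigma_2(X_{(2)})$, i.e. $\sigma_1\ast\sigma_2(x\otimes\tilde x)=\sigma_1(x_{(0)}\otimes x_{(1)}{}^{<1>})\,\sigma_2(x_{(1)}{}^{<2>}\otimes\tilde x)$, with unit $\varepsilon$. *)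

(* Defs.v *)
From HB Require Import structures.
From mathcomp Require Import all_boot all_algebra.
From mathcomp Require Import boolp classical_sets functions.

Set Implicit Arguments.
Unset Strict Implicit.
Unset Printing Implicit Defensive.

Import GRing.Theory.
Local Open Scope ring_scope.
Local Open Scope quotient_scope.

Reserved Notation "M ⊗ N" (at level 40, left associativity).

(* The tensor product of a right S-module M by a left S-module N, as an abelian
   group: formal sums of pairs modulo the congruence generated by biadditivity
   and balancing. Only the two actions of S are needed for the construction, so
   S is a mere type here. *)
Section BalancedTensor.
Variables (S : Type) (M N : zmodType) (ra : M -> S -> M) (la : S -> N -> N).

Inductive btens_rel : seq (M * N) -> seq (M * N) -> Prop :=
| btens_refl s : btens_rel s s
| btens_sym s t : btens_rel s t -> btens_rel t s
| btens_trans s t u : btens_rel s t -> btens_rel t u -> btens_rel s u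
| btens_cat s s' t t' :
    btens_rel s s' -> btens_rel t t' -> btens_rel (s ++ t) (s' ++ t')
| btens_catC s t : btens_rel (s ++ t) (t ++ s)
| btens_0l n : btens_rel [:: (0, n)] [::]
| btens_addl m m' n : btens_rel [:: (m + m', n)] [:: (m, n); (m', n)]
| btens_addr m n n' : btens_rel [:: (m, n + n')] [:: (m, n); (m, n')]
| btens_bal m x n : btens_rel [:: (ra m x, n)] [:: (m, la x n)].

Definition btens_eq (s t : seq (M * N)) : bool := `[< btens_rel s t >].

Fact btens_eq_refl : reflexive btens_eq.
Proof. by move=> s; apply/asboolP; apply: btens_refl. Qed.
Fact btens_eq_sym : symmetric btens_eq.
Proof. by move=> s t; apply/asboolP/asboolP; apply: btens_sym. Qed.
Fact btens_eq_trans : transitive btens_eq.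
Proof. by move=> t s u /asboolP st /asboolP/(btens_trans st) su; apply/asboolP. Qed.

Canonical btens_equiv := EquivRel btens_eq btens_eq_refl btens_eq_sym btens_eq_trans.

Definition btens : Type := {eq_quot btens_equiv}.
HB.instance Definition _ := Choice.on btens.
HB.instance Definition _ := EqQuotient.on btens.

Lemma btens_eqP (s t : seq (M * N)) :
  (\pi_btens s = \pi_btens t) <-> btens_rel s t.
Proof.
split=> [/eqmodP/asboolP //|st].
by apply/eqmodP/asboolP.
Qed.

Definition btens_zero : btens := \pi_btens [::].
Definition btens_add (t u : btens) : btens := \pi_btens (repr t ++ repr u).
Definition btens_opp (t : btens) : btens :=
  \pi_btens [seq (- p.1, p.2) | p <- repr t].

Lemma btens_repr s : btens_rel (repr (\pi_btens s)) s.
Proof. by apply/btens_eqP; rewrite reprK. Qed.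

Lemma btens_addE s t : btens_add (\pi_btens s) (\pi_btens t) = \pi_btens (s ++ t).
Proof. by apply/btens_eqP/btens_cat; apply: btens_repr. Qed.

Lemma btens_piP (P : btens -> Prop) : (forall s, P (\pi_btens s)) -> forall t, P t.
Proof. by move=> Ps t; rewrite -[t]reprK. Qed.

Fact btens_addA : associative btens_add.
Proof.
elim/btens_piP=> s; elim/btens_piP=> t; elim/btens_piP=> u.
by rewrite !btens_addE catA.
Qed.
Fact btens_addC : commutative btens_add.
Proof.
elim/btens_piP=> s; elim/btens_piP=> t.
by rewrite !btens_addE; apply/btens_eqP/btens_catC.
Qed.
Fact btens_add0 : left_id btens_zero btens_add.
Proof. by elim/btens_piP=> s; rewrite btens_addE. Qed.

Lemma btens_rel_oppr s : btens_rel (s ++ [seq (- p.1, p.2) | p <- s]) [::].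
Proof.
elim: s => [|[m n] s IHs] /=; first exact: btens_refl.
apply: (@btens_trans _ ([:: (m, n)] ++ ([:: (- m, n)] ++ [::]))).
  rewrite -[_ :: s ++ _]/([:: (m, n)] ++ _); apply: btens_cat (btens_refl _) _.
  apply: (@btens_trans _ ([:: (- m, n)] ++ (s ++ [seq (- p.1, p.2) | p <- s]))).
    rewrite -[_ :: map _ _]cat1s !catA.
    by apply: btens_cat (btens_refl _); apply: btens_catC.
  by apply: btens_cat (btens_refl _) IHs.
apply: btens_trans (btens_0l n).
by rewrite -(subrr m); apply/btens_sym/btens_addl.
Qed.

Fact btens_addN : left_inverse btens_zero btens_opp btens_add.
Proof.
move=> t; rewrite btens_addC -{1}[t]reprK btens_addE.
by apply/btens_eqP/btens_rel_oppr.
Qed.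

HB.instance Definition _ := GRing.isZmodule.Build btens
  btens_addA btens_addC btens_add0 btens_addN.

Definition bpure (m : M) (n : N) : btens := \pi_btens [:: (m, n)].

Definition biadditive (G : zmodType) (f : M -> N -> G) :=
  (forall m m' n, f (m + m') n = f m n + f m' n) /\
  (forall m n n', f m (n + n') = f m n + f m n').

Definition balanced (G : zmodType) (f : M -> N -> G) :=
  biadditive f /\ (forall m x n, f (ra m x) n = f m (la x n)).

(* The map induced by f on the tensor product; it is only meaningful when f is
   balanced, see bliftE. *)
Definition blift (G : zmodType) (f : M -> N -> G) (t : btens) : G :=
  \sum_(p <- repr t) f p.1 p.2.

Lemma blift_pi (G : zmodType) (f : M -> N -> G) : balanced f ->
  forall s, blift f (\pi_btens s) = \sum_(p <- s) f p.1 p.2.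
Proof.
move=> [[fDl fDr] fbal] s; have f0 n : f 0 n = 0.
  by apply: (addrI (f 0 n)); rewrite -fDl !addr0.
suff E u v : btens_rel u v -> \sum_(p <- u) f p.1 p.2 = \sum_(p <- v) f p.1 p.2.
  exact/E/btens_repr.
elim=> {u v s} //=.
- by move=> s t u _ -> _ ->.
- by move=> s s' t t' _ Es _ Et; rewrite !big_cat /= Es Et.
- by move=> s t; rewrite !big_cat /= addrC.
- by move=> n; rewrite big_seq1 big_nil f0.
- by move=> m m' n; rewrite !big_cons !big_nil /= fDl !addr0.
- by move=> m n n'; rewrite !big_cons !big_nil /= fDr !addr0.
- by move=> m x n; rewrite !big_seq1 /= fbal.
Qed.

Lemma bliftE (G : zmodType) (f : M -> N -> G) : balanced f ->
  forall m n, blift f (bpure m n) = f m n.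
Proof. by move=> fB m n; rewrite blift_pi // big_seq1. Qed.

Lemma bliftD (G : zmodType) (f : M -> N -> G) : balanced f ->
  {morph blift f : t u / t + u}.
Proof.
move=> fB t u; elim/btens_piP: t => s; elim/btens_piP: u => t.
by rewrite [_ + _]btens_addE !blift_pi // big_cat.
Qed.

Lemma bpure_balanced : balanced bpure.
Proof.
split; first split=> [m m' n|m n n'].
- by rewrite [RHS]btens_addE; apply/btens_eqP/btens_addl.
- by rewrite [RHS]btens_addE; apply/btens_eqP/btens_addr.
- by move=> m x n; apply/btens_eqP/btens_bal.
Qed.

Lemma btens_ind (P : btens -> Prop) : P 0 -> (forall m n, P (bpure m n)) ->
  (forall t u, P t -> P u -> P (t + u)) -> forall t, P t.
Proof.
move=> P0 Ppure PD; apply: btens_piP; elim=> [//|[m n] s IHs].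
by rewrite -cat1s -btens_addE; exact: (PD _ _ (Ppure m n) IHs).
Qed.

End BalancedTensor.

Section MapBalanced.
Variables (S : Type) (M N M' N' : zmodType).
Variables (ra : M -> S -> M) (la : S -> N -> N).
Variables (ra' : M' -> S -> M') (la' : S -> N' -> N').

Definition bmap (f : M -> M') (g : N -> N') : btens ra la -> btens ra' la' :=
  blift (fun m n => bpure ra' la' (f m) (g n)).

End MapBalanced.

Arguments bmap {S M N M' N' ra la ra' la'} f g.

Section Tensor.
Variables (K : fieldType).

Section Def.
Variables (M N : lmodType K).

Definition tensor : Type := btens (fun (m : M) (k : K) => k *: m) (fun k (n : N) => k *: n).
HB.instance Definition _ := GRing.Zmodule.on tensor.

Definition tpure (m : M) (n : N) : tensor := bpure _ _ m n.

Definition bilin (G : lmodType K) (f : M -> N -> G) :=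
  (forall n, linear (f^~ n)) /\ (forall m, linear (f m)).

(* As with blift, only meaningful when f is bilinear. *)
Definition tlift (G : zmodType) (f : M -> N -> G) (t : tensor) : G := blift f t.

Lemma bilin_balanced (G : lmodType K) (f : M -> N -> G) : bilin f ->
  balanced (fun (m : M) (k : K) => k *: m) (fun k (n : N) => k *: n) f.
Proof.
move=> [fl fr]; have f0l n : f 0 n = 0.
  by have := fl n (- 1) 0 0; rewrite /= scaler0 addr0 scaleN1r addNr.
have f0r m : f m 0 = 0.
  by have := fr m (- 1) 0 0; rewrite /= scaler0 addr0 scaleN1r addNr.
split; first split=> [m m' n|m n n'].
- by have := fl n 1 m m'; rewrite /= !scale1r.
- by have := fr m 1 n n'; rewrite /= !scale1r.
- move=> m k n; have := fl n k m 0; have := fr m k n 0.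
  by rewrite /= !addr0 f0l f0r !addr0 => -> ->.
Qed.

Definition tscale (k : K) : tensor -> tensor := tlift (fun m n => tpure (k *: m) n).

Lemma tscale_balanced k :
  balanced (fun (m : M) (k : K) => k *: m) (fun k (n : N) => k *: n)
    (fun m n => tpure (k *: m) n).
Proof.
have [[Dl Dr] bal] := bpure_balanced (fun (m : M) (k : K) => k *: m) (fun k (n : N) => k *: n).
split; first split=> [m m' n|m n n'].
- by rewrite scalerDr /tpure Dl.
- by rewrite /tpure Dr.
- by move=> m x n; rewrite scalerA mulrC -scalerA /tpure bal.
Qed.

Lemma tensor_ind (P : tensor -> Prop) : P 0 -> (forall m n, P (tpure m n)) ->
  (forall t u, P t -> P u -> P (t + u)) -> forall t, P t.
Proof. exact: btens_ind. Qed.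

Lemma tscaleE k m n : tscale k (tpure m n) = tpure (k *: m) n.
Proof. exact: (bliftE (tscale_balanced k)). Qed.

Fact tscaleDr k : {morph tscale k : t u / t + u}.
Proof. exact: (bliftD (tscale_balanced k)). Qed.

Fact tscale0 k : tscale k 0 = 0.
Proof. by apply: (addrI (tscale k 0)); rewrite -tscaleDr !addr0. Qed.

Fact tscaleA k l t : tscale k (tscale l t) = tscale (k * l) t.
Proof.
elim/tensor_ind: t => [|m n|t u Et Eu]; rewrite ?tscale0 //.
  by rewrite !tscaleE scalerA.
by rewrite !tscaleDr Et Eu.
Qed.

Fact tscale1 : left_id 1 tscale.
Proof.
elim/tensor_ind=> [|m n|t u Et Eu]; rewrite ?tscale0 ?tscaleE ?scale1r //.
by rewrite tscaleDr Et Eu.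
Qed.

Fact tscaleDl t : {morph tscale^~ t : k l / k + l}.
Proof.
move=> k l; elim/tensor_ind: t => [|m n|t u Et Eu] /=.
- by rewrite !tscale0 addr0.
- rewrite !tscaleE scalerDl.
  by have [[Dl _] _] := bpure_balanced (fun (m : M) (k : K) => k *: m)
    (fun k (n : N) => k *: n); apply: Dl.
- by rewrite !tscaleDr /= in Et Eu *; rewrite Et Eu addrACA.
Qed.

HB.instance Definition _ := GRing.Zmodule_isLmodule.Build K tensor
  tscaleA tscale1 tscaleDr tscaleDl.

Lemma tpure_bilin : bilin tpure.
Proof.
have [[Dl Dr] bal] := bpure_balanced (fun (m : M) (k : K) => k *: m) (fun k (n : N) => k *: n).
split=> [n k m m'|m k n n'].
- by rewrite [LHS]Dl; congr (_ + _); apply/esym/tscaleE.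
- by rewrite [LHS]Dr -bal; congr (_ + _); apply/esym/tscaleE.
Qed.

Lemma tliftE (G : lmodType K) (f : M -> N -> G) : bilin f ->
  forall m n, tlift f (tpure m n) = f m n.
Proof. by move/bilin_balanced; apply: bliftE. Qed.

Lemma tlift_linear (G : lmodType K) (f : M -> N -> G) : bilin f -> linear (tlift f).
Proof.
move=> fB; have fB' := bilin_balanced fB.
have D := bliftD fB'; have E := tliftE fB.
have f0 : tlift f 0 = 0 by apply: (addrI (tlift f 0)); rewrite -[LHS]D !addr0.
move=> k t u; rewrite [LHS]D; congr (_ + _).
elim/tensor_ind: t => [|m n|t t' Et Et'].
- by rewrite scaler0 [LHS]f0 f0 scaler0.
- rewrite [k *: _]tscaleE [LHS]E E; have := fB.1 n k m 0.
  have := fB.1 n (- 1) 0 0.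
  by rewrite /= scaler0 !addr0 scaleN1r addNr => ->; rewrite addr0.
- by rewrite scalerDr [LHS]D Et Et' -scalerDr; congr (_ *: _); rewrite [RHS]D.
Qed.

End Def.
End Tensor.

Arguments tensor {K} (M N)%_type_scope.

Notation "M ⊗ N" := (tensor M N) : type_scope.
Notation "m ⊗ n" := (tpure m n) : ring_scope.

Section TensorMaps.
Variables (K : fieldType).

Definition tmap (M N M' N' : lmodType K) (f : M -> M') (g : N -> N') :
  M ⊗ N -> M' ⊗ N' := tlift (fun m n => f m ⊗ g n).

Definition tassoc (M N P : lmodType K) : (M ⊗ N) ⊗ P -> M ⊗ (N ⊗ P) :=
  tlift (fun t p => tlift (fun m n => m ⊗ (n ⊗ p)) t).

(* (m ⊗ n, m' ⊗ n') |-> f m m' ⊗ g n n' *)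
Definition tmul2 (M N M' N' P Q : lmodType K)
  (f : M -> M' -> P) (g : N -> N' -> Q) (t : M ⊗ N) (u : M' ⊗ N') : P ⊗ Q :=
  tlift (fun m n => tlift (fun m' n' => f m m' ⊗ g n n') u) t.

Lemma linear_comp (M N P : lmodType K) (f : N -> P) (g : M -> N) :
  linear f -> linear g -> linear (f \o g).
Proof. by move=> lf lg a x y; rewrite /= lg lf. Qed.

Lemma lin0 (M N : lmodType K) (f : M -> N) : linear f -> f 0 = 0.
Proof.
by move=> lf; have := lf (- 1) 0 0; rewrite /= scaler0 addr0 scaleN1r addNr.
Qed.

Lemma linD (M N : lmodType K) (f : M -> N) : linear f -> {morph f : x y / x + y}.
Proof. by move=> lf x y; have := lf 1 x y; rewrite /= !scale1r. Qed.

Lemma tensor_ext (M N G : lmodType K) (f g : M ⊗ N -> G) :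
  linear f -> linear g -> (forall m n, f (m ⊗ n) = g (m ⊗ n)) -> f =1 g.
Proof.
move=> lf lg fg; elim/tensor_ind=> [|//|t u Et Eu]; first by rewrite !lin0.
by rewrite (linD lf) (linD lg) Et Eu.
Qed.

Lemma tlift_param (P M N G : lmodType K) (F : P -> M -> N -> G) (u : M ⊗ N) :
  (forall m n, linear (fun p => F p m n)) -> linear (fun p => tlift (F p) u).
Proof.
move=> lF a p q; rewrite /tlift /blift scaler_sumr -big_split /=.
by apply: eq_bigr => -[m n] _; apply: lF.
Qed.

Lemma tpurel (M N : lmodType K) (n : N) : linear (fun m : M => m ⊗ n).
Proof. exact: (tpure_bilin M N).1. Qed.

Lemma tpurer (M N : lmodType K) (m : M) : linear (fun n : N => m ⊗ n).
Proof. exact: (tpure_bilin M N).2. Qed.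

Lemma tmap_bilin (M N M' N' : lmodType K) (f : M -> M') (g : N -> N') :
  linear f -> linear g -> bilin (fun m n => f m ⊗ g n).
Proof.
move=> lf lg; split=> [n|m].
- exact: (linear_comp (tpurel _) lf).
- exact: (linear_comp (tpurer _) lg).
Qed.

Lemma tmapE (M N M' N' : lmodType K) (f : M -> M') (g : N -> N') :
  linear f -> linear g -> forall m n, tmap f g (m ⊗ n) = f m ⊗ g n.
Proof. by move=> lf lg; apply: (tliftE (tmap_bilin lf lg)). Qed.

Lemma tmap_linear (M N M' N' : lmodType K) (f : M -> M') (g : N -> N') :
  linear f -> linear g -> linear (tmap f g).
Proof. by move=> lf lg; apply: (tlift_linear (tmap_bilin lf lg)). Qed.

Lemma tassocE (M N P : lmodType K) (m : M) (n : N) (p : P) :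
  tassoc ((m ⊗ n) ⊗ p) = m ⊗ (n ⊗ p).
Proof.
have bp q : bilin (fun (m : M) (n : N) => m ⊗ (n ⊗ q : N ⊗ P)).
  split=> [n'|m']; first exact: tpurel.
  exact: (linear_comp (tpurer _) (tpurel _)).
rewrite /tassoc tliftE; first exact: (tliftE (bp p)).
split=> [q|t]; first exact: (tlift_linear (bp q)).
apply: (@tlift_param P M N _ (fun p m n => m ⊗ (n ⊗ p))) => m' n'.
exact: (linear_comp (tpurer _) (tpurer _)).
Qed.

Section Mul2.
Variables (M N M' N' P Q : lmodType K) (f : M -> M' -> P) (g : N -> N' -> Q).
Hypotheses (fB : bilin f) (gB : bilin g).

Let in_bilin m n : bilin (fun m' n' => f m m' ⊗ g n n').
Proof. by apply: tmap_bilin; [apply: fB.2|apply: gB.2]. Qed.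

Let out_bilin u : bilin (fun m n => tlift (fun m' n' => f m m' ⊗ g n n') u).
Proof.
split=> [n|m].
- apply: (@tlift_param M _ _ _ (fun m m' n' => f m m' ⊗ g n n')) => m' n'.
  exact: (linear_comp (tpurel _) (fB.1 m')).
- apply: (@tlift_param N _ _ _ (fun n m' n' => f m m' ⊗ g n n')) => m' n'.
  exact: (linear_comp (tpurer _) (gB.1 n')).
Qed.

Lemma tmul2E m n m' n' : tmul2 f g (m ⊗ n) (m' ⊗ n') = f m m' ⊗ g n n'.
Proof. by rewrite /tmul2 (tliftE (out_bilin _)) (tliftE (in_bilin _ _)). Qed.

Lemma tmul2_bilin : bilin (tmul2 f g).
Proof.
split=> [u|t]; first exact: (tlift_linear (out_bilin u)).
elim/tensor_ind: t => [|m n|t t' lt lt'] a u v.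
- by rewrite /tmul2 !(lin0 (tlift_linear (out_bilin _))) scaler0 addr0.
- rewrite /tmul2 !(tliftE (out_bilin _)).
  exact: (tlift_linear (in_bilin m n)).
- rewrite /tmul2 !(linD (tlift_linear (out_bilin _))).
  by rewrite -!/(tmul2 f g _ _) lt lt' scalerDr addrACA.
Qed.

End Mul2.

End TensorMaps.

Section HopfGalois.
Variables (K : fieldType).

Lemma mul_bilin (A : algType K) : bilin (fun a b : A => a * b).
Proof.
split=> [b|a] k x y; first by rewrite mulrDl scalerAl.
by rewrite mulrDr scalerAr.
Qed.

Lemma mulop_bilin (A : algType K) : bilin (fun a b : A => b * a).
Proof. by split=> x; [apply: (mul_bilin A).2|apply: (mul_bilin A).1]. Qed.

(* The product of the algebra A ⊗ H. *)
Definition talg_mul (A H : algType K) : A ⊗ H -> A ⊗ H -> A ⊗ H :=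
  tmul2 (fun a b => a * b) (fun h k => h * k).

Definition is_algmap_tensor (X A H : algType K) (f : X -> A ⊗ H) :=
  [/\ linear f, f 1 = 1 ⊗ 1 & forall x y, f (x * y) = talg_mul (f x) (f y)].

Record hopf_algebra (H : algType K) := HopfAlgebra {
  hcop : H -> H ⊗ H;
  hcou : H -> K;
  hant : H -> H;
  hcop_alg : is_algmap_tensor hcop;
  hcou_lin : linear (hcou : H -> K^o);
  hcou_mul : monoid_morphism hcou;
  hcopA : forall h, tassoc (tmap hcop id (hcop h)) = tmap id hcop (hcop h);
  hcoul : forall h, tlift (fun x y => hcou x *: y) (hcop h) = h;
  hcour : forall h, tlift (fun x y => hcou y *: x) (hcop h) = h;
  hant_lin : linear hant;
  hantl : forall h, tlift (fun x y => hant x * y) (hcop h) = (hcou h)%:A;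
  hantr : forall h, tlift (fun x y => x * hant y) (hcop h) = (hcou h)%:A
}.

Record comodule_algebra (H : algType K) (hH : hopf_algebra H) (A : algType K) :=
  ComoduleAlgebra {
  coact : A -> A ⊗ H;
  coact_alg : is_algmap_tensor coact;
  coactA : forall a, tassoc (tmap coact id (coact a)) = tmap id (hcop hH) (coact a);
  coact_counit : forall a, tlift (fun x h => hcou hH h *: x) (coact a) = a
}.

Variables (H : algType K) (hH : hopf_algebra H) (A : algType K).
Variable dA : comodule_algebra hH A.

Local Notation delta := (coact dA).

Lemma coactE a b : delta (a * b) = talg_mul (delta a) (delta b).
Proof. by have [_ _ ->] := coact_alg dA. Qed.

Lemma coact_linear : linear delta. Proof. by have [] := coact_alg dA. Qed.

Definition coinv_pred : {pred A} := fun b => `[< delta b = b ⊗ 1 >].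

Lemma coinv_predP b : reflect (delta b = b ⊗ 1) (b \in coinv_pred).
Proof. exact: asboolP. Qed.

Lemma coinv_subalg : GRing.subalg_closed coinv_pred.
Proof.
split.
- by apply/coinv_predP; have [_ ->] := coact_alg dA.
- move=> k x y /coinv_predP dx /coinv_predP dy; apply/coinv_predP.
  by rewrite coact_linear dx dy tpurel.
- move=> x y /coinv_predP dx /coinv_predP dy; apply/coinv_predP.
  rewrite coactE dx dy /talg_mul tmul2E ?mulr1 //; exact: mul_bilin.
Qed.

HB.instance Definition _ := GRing.isSubalgClosed.Build K A coinv_pred coinv_subalg.

(* The algebra B = A^{coH}. *)
Record coinv := Coinv { coinv_val :> A ; coinv_valP : coinv_val \in coinv_pred }.

HB.instance Definition _ := [isSub for coinv_val].
HB.instance Definition _ := [Choice of coinv by <:].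
HB.instance Definition _ := [SubChoice_isSubAlgebra of coinv by <:].

Local Notation B := coinv.

Definition actr (a : A) (b : B) : A := a * val b.
Definition actl (b : B) (a : A) : A := val b * a.

Definition AtensBA : Type := btens actr actl.
HB.instance Definition _ := GRing.Zmodule.on AtensBA.

(* a' ⊗_B a |-> a' a_(0) ⊗ a_(1) *)
Definition canonical_map : AtensBA -> A ⊗ H :=
  blift (fun a' a => tmap (fun x => a' * x) id (delta a)).

Lemma canonical_mapE a' a :
  canonical_map (bpure actr actl a' a) = tmap (fun x => a' * x) id (delta a).
Proof.
have lm x : linear (fun y : A => x * y) by apply: (mul_bilin A).2.
have li : linear (id : H -> H) by [].
apply: bliftE; split; first split=> [x y z|x y z].
- rewrite -(linD (f := fun x => tmap (fun y => x * y) id (delta z))) //.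
  apply: (@tlift_param K A _ _ _ (fun x y h => x * y ⊗ h)) => p h.
  exact: (linear_comp (tpurel _) ((mul_bilin A).1 p)).
- by rewrite (linD coact_linear) (linD (tmap_linear (lm x) li)).
- move=> x b y; rewrite /actr /actl coactE (coinv_predP _ (valP b)).
  apply: (@tensor_ext K A H _
    (fun t => tmap (fun z => x * val b * z) id t)
    (fun t => tmap (fun z => x * z) id (talg_mul (val b ⊗ 1) t))).
  + exact: tmap_linear.
  + apply: (linear_comp (tmap_linear (lm x) li)).
    exact: (tmul2_bilin (mul_bilin A) (mul_bilin H)).2.
  + move=> m n; rewrite /talg_mul tmul2E ?tmapE ?mul1r ?mulrA //; exact: mul_bilin.
Qed.

Definition hopf_galois : Prop := bijective canonical_map.

Definition exact_seq (L M N : zmodType) (f : L -> M) (g : M -> N) : Prop :=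
  forall y, g y = 0 <-> exists x, f x = y.

(* A ⊗_B M for a left B-module M. *)
Definition AtensB (M : lmodType B) : Type :=
  btens actr (fun (b : B) (m : M) => b *: m).
HB.instance Definition _ (M : lmodType B) := GRing.Zmodule.on (AtensB M).

Definition AtensB_map (M N : lmodType B) (f : M -> N) : AtensB M -> AtensB N :=
  bmap id f.

Lemma AtensB_mapE (M N : lmodType B) (f : {linear M -> N}) a m :
  AtensB_map f (bpure _ _ a m) = bpure _ _ a (f m).
Proof.
have [[Dl Dr] bal] := bpure_balanced actr (fun (b : B) (n : N) => b *: n).
apply: bliftE; split; first split=> [x y z|x y z]; rewrite ?Dl //.
  by rewrite raddfD Dr.
by move=> x b y; rewrite /= bal linearZ.
Qed.

(* A is faithfully flat as a right B-module: A ⊗_B - preserves and reflects the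
   exactness of sequences of left B-modules. *)
Definition faithfully_flat : Prop :=
  forall (L M N : lmodType B) (f : {linear L -> M}) (g : {linear M -> N}),
    exact_seq f g <-> exact_seq (AtensB_map f) (AtensB_map g).

(* The value at h of the translation map: the preimage of 1 ⊗ h, which is unique
   when B ⊆ A is Hopf-Galois. *)
Definition translation (h : H) : AtensBA :=
  xget 0 [set t | canonical_map t = 1 ⊗ h]%classic.

(* a ⊗ a' |-> (a_(0) ⊗ a'_(0)) ⊗ a_(1) a'_(1) *)
Definition codiag_pair : A ⊗ H -> A ⊗ H -> (A ⊗ A) ⊗ H :=
  tmul2 (@tpure K A A) (fun h k => h * k).
Definition codiag : A ⊗ A -> (A ⊗ A) ⊗ H :=
  tlift (fun a a' => codiag_pair (delta a) (delta a')).

(* The product of A ⊗ A^op. *)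
Definition env_mul : A ⊗ A -> A ⊗ A -> A ⊗ A :=
  tmul2 (fun x y => x * y) (fun x y => y * x).

Lemma env_mul_bilin : bilin env_mul.
Proof. exact: (tmul2_bilin (mul_bilin A) (mulop_bilin A)). Qed.

Lemma env_mulE x x' y y' : env_mul (x ⊗ x') (y ⊗ y') = (x * y) ⊗ (y' * x').
Proof. by rewrite /env_mul tmul2E //; [apply: mul_bilin|apply: mulop_bilin]. Qed.

Lemma codiag_pair_bilin : bilin codiag_pair.
Proof. exact: (tmul2_bilin (tpure_bilin A A) (mul_bilin H)). Qed.

Lemma codiag_pairE a h a' h' :
  codiag_pair (a ⊗ h) (a' ⊗ h') = (a ⊗ a') ⊗ (h * h').
Proof. by rewrite /codiag_pair tmul2E //; [apply: tpure_bilin|apply: mul_bilin]. Qed.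

Lemma codiag_bilin : bilin (fun a a' => codiag_pair (delta a) (delta a')).
Proof.
split=> [a'|a].
- exact: (linear_comp (codiag_pair_bilin.1 _) coact_linear).
- exact: (linear_comp (codiag_pair_bilin.2 _) coact_linear).
Qed.

Lemma codiag_linear : linear codiag.
Proof. exact: tlift_linear codiag_bilin. Qed.

Lemma codiagE a a' : codiag (a ⊗ a') = codiag_pair (delta a) (delta a').
Proof. exact: tliftE codiag_bilin _ _. Qed.

Definition es_pred : {pred (A ⊗ A)%type} := fun X => `[< codiag X = X ⊗ 1 >].

Lemma es_predP X : reflect (codiag X = X ⊗ 1) (X \in es_pred).
Proof. exact: asboolP. Qed.

Lemma es_subsemimod : GRing.subsemimod_closed es_pred.
Proof.
split; first split.
- by apply/es_predP; rewrite (lin0 codiag_linear) (lin0 (tpurel _)).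
- move=> X Y /es_predP dX /es_predP dY; apply/es_predP.
  by rewrite (linD codiag_linear) dX dY (linD (tpurel _)).
- move=> k X /es_predP dX; apply/es_predP.
  have := codiag_linear k X 0; rewrite /= (lin0 codiag_linear) !addr0 dX => ->.
  by have := tpurel (1 : H) k X 0; rewrite /= (lin0 (tpurel _)) !addr0.
Qed.

HB.instance Definition _ := GRing.isSubmodClosed.Build K (A ⊗ A)%type es_pred es_subsemimod.

(* The Ehresmann-Schauenburg bialgebroid C(A, H). *)
Record es := ES { es_val :> (A ⊗ A)%type ; es_valP : es_val \in es_pred }.

HB.instance Definition _ := [isSub for es_val].
HB.instance Definition _ := [Choice of es by <:].
HB.instance Definition _ := [SubChoice_isSubLmodule of es by <:].

Local Notation C := es.

(* (a ⊗ h, a' ⊗ h', (y ⊗ y') ⊗ g) |-> (a y ⊗ y' a') ⊗ h g h', which computes the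
   codiagonal coaction of a product, see codiag_mul. *)
Definition sandwich (u u' : A ⊗ H) (w : (A ⊗ A) ⊗ H) : (A ⊗ A) ⊗ H :=
  tlift (fun a h => tlift (fun a' h' =>
    tmap (env_mul (a ⊗ a')) (fun g => h * g * h') w) u') u.

Lemma conj_linear (h h' : H) : linear (fun g : H => h * g * h').
Proof. exact: (linear_comp ((mul_bilin H).1 h') ((mul_bilin H).2 h)). Qed.

Lemma sandwich_in w a h :
  bilin (fun (a' : A) (h' : H) => tmap (env_mul (a ⊗ a')) (fun g => h * g * h') w).
Proof.
split=> [h'|a'].
- apply: (@tlift_param K A _ _ _ (fun a' X g => env_mul (a ⊗ a') X ⊗ (h * g * h'))).
  move=> X g; apply: (linear_comp (tpurel _)).
  exact: (linear_comp (env_mul_bilin.1 X) (tpurer _)).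
- apply: (@tlift_param K H _ _ _ (fun h' X g => env_mul (a ⊗ a') X ⊗ (h * g * h'))).
  move=> X g; exact: (linear_comp (tpurer _) ((mul_bilin H).2 _)).
Qed.

Lemma sandwich_out w u' : bilin (fun (a : A) (h : H) => tlift (fun a' h' =>
    tmap (env_mul (a ⊗ a')) (fun g => h * g * h') w) u').
Proof.
split=> [h|a].
- apply: (@tlift_param K A A H _
    (fun a a' h' => tmap (env_mul (a ⊗ a')) (fun g => h * g * h') w)) => a' h'.
  apply: (@tlift_param K A _ _ _ (fun a X g => env_mul (a ⊗ a') X ⊗ (h * g * h'))).
  move=> X g; apply: (linear_comp (tpurel _)).
  exact: (linear_comp (env_mul_bilin.1 X) (tpurel _)).
- apply: (@tlift_param K H A H _
    (fun h a' h' => tmap (env_mul (a ⊗ a')) (fun g => h * g * h') w)) => a' h'.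
  apply: (@tlift_param K H _ _ _ (fun h X g => env_mul (a ⊗ a') X ⊗ (h * g * h'))).
  move=> X g; apply: (linear_comp (tpurer _)).
  exact: (linear_comp ((mul_bilin H).1 _) ((mul_bilin H).1 _)).
Qed.

Lemma sandwichE a h a' h' w : sandwich (a ⊗ h) (a' ⊗ h') w =
  tmap (env_mul (a ⊗ a')) (fun g => h * g * h') w.
Proof. by rewrite /sandwich (tliftE (sandwich_out _ _)) (tliftE (sandwich_in _ _ _)). Qed.

Lemma sandwich_linl u' w : linear (fun u => sandwich u u' w).
Proof. exact: (tlift_linear (sandwich_out w u')). Qed.

Lemma sandwich_linm u w : linear (fun u' => sandwich u u' w).
Proof.
apply: (@tlift_param K _ A H _ (fun u' a h => tlift (fun a' h' =>
    tmap (env_mul (a ⊗ a')) (fun g => h * g * h') w) u')) => a h.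
exact: (tlift_linear (sandwich_in w a h)).
Qed.

Lemma sandwich_linr u u' : linear (fun w => sandwich u u' w).
Proof.
apply: (@tlift_param K _ A H _ (fun w a h => tlift (fun a' h' =>
    tmap (env_mul (a ⊗ a')) (fun g => h * g * h') w) u')) => a h.
apply: (@tlift_param K _ A H _ (fun w a' h' =>
    tmap (env_mul (a ⊗ a')) (fun g => h * g * h') w)) => a' h'.
exact: (tmap_linear (env_mul_bilin.2 _) (conj_linear h h')).
Qed.

Lemma codiag_mul x x' Y : codiag (env_mul (x ⊗ x') Y) =
  sandwich (delta x) (delta x') (codiag Y).
Proof.
have env2 X := env_mul_bilin.2 X.
apply: (tensor_ext (linear_comp codiag_linear (env2 _))
                   (linear_comp (sandwich_linr _ _) codiag_linear)) => y y' /=.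
rewrite env_mulE !codiagE !coactE /talg_mul.
have mB := tmul2_bilin (mul_bilin A) (mul_bilin H).
move: (delta x) (delta x') (delta y) (delta y') => u u' v v'.
pose F u u' v v' := codiag_pair (talg_mul u v) (talg_mul v' u').
pose G u u' v v' := sandwich u u' (codiag_pair v v').
rewrite -[LHS]/(F u u' v v') -[RHS]/(G u u' v v').
apply: (@tensor_ext K A H _ (F^~ u' ^~ v ^~ v') (G^~ u' ^~ v ^~ v')).
- exact: (linear_comp (codiag_pair_bilin.1 _) (mB.1 _)).
- exact: sandwich_linl.
move=> {u} a h; apply: (@tensor_ext K A H _ (F _ ^~ v ^~ v') (G _ ^~ v ^~ v')).
- exact: (linear_comp (codiag_pair_bilin.2 _) (mB.2 _)).
- exact: sandwich_linm.
move=> {u'} a' h'; apply: (@tensor_ext K A H _ (F _ _ ^~ v') (G _ _ ^~ v')).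
- exact: (linear_comp (codiag_pair_bilin.1 _) (mB.2 _)).
- exact: (linear_comp (sandwich_linr _ _) (codiag_pair_bilin.1 _)).
move=> {v} b k; apply: (@tensor_ext K A H _ (F _ _ _) (G _ _ _)).
- exact: (linear_comp (codiag_pair_bilin.2 _) (mB.1 _)).
- exact: (linear_comp (sandwich_linr _ _) (codiag_pair_bilin.2 _)).
move=> b' k'; rewrite /F /G /talg_mul.
rewrite !(tmul2E (mul_bilin A) (mul_bilin H)) !codiag_pairE sandwichE.
by rewrite (tmapE (env2 _) (conj_linear _ _)) env_mulE !mulrA.
Qed.

Lemma es_mul_subproof (X Y : C) : env_mul (val X) (val Y) \in es_pred.
Proof.
have /es_predP dX := valP X; have /es_predP dY := valP Y.
have idH : linear (id : H -> H) by [].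
have envl := env_mul_bilin.1.
suff E T : codiag (env_mul T (val Y)) = tmap (env_mul^~ (val Y)) id (codiag T).
  by apply/es_predP; rewrite E dX tmapE.
apply: (tensor_ext (linear_comp codiag_linear (envl _))
  (linear_comp (tmap_linear (envl (val Y)) idH) codiag_linear)) => x x' /=.
rewrite codiag_mul dY codiagE.
move: (delta x) (delta x') => u u'.
apply: (tensor_ext (sandwich_linl _ _)
  (linear_comp (tmap_linear (envl (val Y)) idH) (codiag_pair_bilin.1 u')))
  => a h /=.
apply: (tensor_ext (sandwich_linm (a ⊗ h) _)
  (linear_comp (tmap_linear (envl (val Y)) idH) (codiag_pair_bilin.2 _)))
  => a' h' /=.
rewrite sandwichE codiag_pairE (tmapE (env_mul_bilin.2 _) (conj_linear _ _)).
by rewrite (tmapE (envl _) idH) mulr1.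
Qed.

Definition es_mul (X Y : C) : C := ES (es_mul_subproof X Y).

Lemma codiag_pure1 a a' : codiag_pair (a ⊗ 1) (a' ⊗ 1) = (a ⊗ a') ⊗ 1.
Proof. by rewrite codiag_pairE mulr1. Qed.

Lemma es_pure_subproof (b b' : B) : val b ⊗ val b' \in es_pred.
Proof.
apply/es_predP; rewrite codiagE.
by rewrite (coinv_predP _ (valP b)) (coinv_predP _ (valP b')) codiag_pure1.
Qed.

Definition es_pure (b b' : B) : C := ES (es_pure_subproof b b').
Definition es_one : C := es_pure 1 1.
Definition es_source (b : B) : C := es_pure b 1.
Definition es_target (b : B) : C := es_pure 1 b.

(* The B-bimodule structure b ▷ X ◁ b' = s(b) t(b') X. *)
Definition es_actl (b : B) (X : C) : C := es_mul (es_source b) X.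
Definition es_actr (X : C) (b : B) : C := es_mul (es_target b) X.

Definition env_prod : A ⊗ A -> A := tlift (fun x y => x * y).

Lemma es_counit_subproof (X : C) : env_prod (val X) \in coinv_pred.
Proof.
have /es_predP dX := valP X.
have pl : linear env_prod by apply: (tlift_linear (mul_bilin A)).
have idH : linear (id : H -> H) by [].
suff E T : delta (env_prod T) = tmap env_prod id (codiag T).
  by apply/coinv_predP; rewrite E dX tmapE.
apply: (tensor_ext (linear_comp coact_linear pl)
  (linear_comp (tmap_linear pl idH) codiag_linear)) => x x' /=.
rewrite codiagE /env_prod (tliftE (mul_bilin A)) -/env_prod coactE.
have mB := tmul2_bilin (mul_bilin A) (mul_bilin H).
move: (delta x) (delta x') => u u'.
apply: (tensor_ext (mB.1 u')
  (linear_comp (tmap_linear pl idH) (codiag_pair_bilin.1 u'))) => a h /=.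
apply: (tensor_ext (mB.2 _)
  (linear_comp (tmap_linear pl idH) (codiag_pair_bilin.2 _))) => a' h' /=.
rewrite (tmul2E (mul_bilin A) (mul_bilin H)) codiag_pairE tmapE //.
by rewrite /env_prod (tliftE (mul_bilin A)).
Qed.

Definition es_counit (X : C) : B := Coinv (es_counit_subproof X).

Definition CtensBC : Type := btens es_actr es_actl.
HB.instance Definition _ := GRing.Zmodule.on CtensBC.

(* The same B-bimodule structure on the whole of A ⊗ A. *)
Definition env_actl (b : B) (X : A ⊗ A) : A ⊗ A := env_mul (val (es_source b)) X.
Definition env_actr (X : A ⊗ A) (b : B) : A ⊗ A := env_mul (val (es_target b)) X.

Definition AAtensBAA : Type := btens env_actr env_actl.
HB.instance Definition _ := GRing.Zmodule.on AAtensBAA.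

(* The map C ⊗_B C -> A ⊗ A ⊗_B A ⊗ A induced by the inclusion of C. *)
Definition CtensBC_incl : CtensBC -> AAtensBAA := bmap (@es_val) (@es_val).

(* a ⊗ a' |-> a_(0) ⊗ τ(a_(1)) ⊗ a' in A ⊗ A ⊗_B A ⊗ A *)
Definition env_coproduct : A ⊗ A -> AAtensBAA :=
  tlift (fun a a' => tlift (fun x h =>
    blift (fun u v => bpure env_actr env_actl (x ⊗ u) (v ⊗ a')) (translation h))
    (delta a)).

(* For a faithfully flat Hopf-Galois extension CtensBC_incl is injective and its
   image contains env_coproduct X for X in C, so this is the unique element of
   C ⊗_B C given by the formula for the coproduct. *)
Definition es_coproduct (X : C) : CtensBC :=
  xget 0 [set Z | CtensBC_incl Z = env_coproduct (val X)]%classic.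

Definition bisection (sigma : C -> B) : Prop :=
  [/\ linear sigma,
      sigma es_one = 1,
      forall b b' X, sigma (es_mul (es_mul (es_source b) (es_target b')) X)
                     = b * sigma X * b'
    & forall X Y, sigma (es_mul X (es_source (sigma Y))) = sigma (es_mul X Y)].

(* sigma1(X_(1)) sigma2(X_(2)) *)
Definition convolution (sigma1 sigma2 : C -> B) (X : C) : B :=
  blift (fun Y Z => sigma1 Y * sigma2 Z) (es_coproduct X).

Definition gauge (F : A -> A) : Prop :=
  [/\ linear F, monoid_morphism F,
      forall a, delta (F a) = tmap F id (delta a)
    & forall b : B, F (val b) = val b].

End HopfGalois.

Arguments gauge {K H hH A} dA.
Arguments bisection {K H hH A} dA.
Arguments convolution {K H hH A} dA.
Arguments es_counit {K H hH A} dA.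

Definition is_group (T : Type) (G : set T) (op : T -> T -> T) (e : T) : Prop :=
  [/\ G e,
      forall x y, G x -> G y -> G (op x y),
      forall x y z, G x -> G y -> G z -> op x (op y z) = op (op x y) z,
      forall x, G x -> op e x = x /\ op x e = x
    & forall x, G x -> exists2 y, G y & op x y = e /\ op y x = e].

Definition group_isomorphism (T T' : Type) (G : set T) (op : T -> T -> T)
    (G' : set T') (op' : T' -> T' -> T') (alpha : T -> T') : Prop :=
  set_bij G G' alpha /\
  (forall x y, G x -> G y -> alpha (op x y) = op' (alpha x) (alpha y)).

(* Main.v *)
(* Write C for C(A, H) and X·c for x ⊗ x'c, where X = x ⊗ x' is in C and c in A.
   Everything rests on the bijectivity of C ⊗_B A -> A ⊗ A, X ⊗ c |-> X·c. Through it a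
   bisection s extends to the map X·c |-> s(X)c on A ⊗ A, whose restriction to A ⊗ 1 is a
   gauge transformation F with s(x ⊗ x') = F(x)x'; conversely F(x)G(x') is a bisection for
   all gauge transformations F and G. Applied to the bisection xF(x'), this yields F^-1,
   characterised by xF(x') = F^-1(x)x'. As F |-> F(x)x' reverses products, the isomorphism
   is F |-> xF(x').
   A is only known to be flat on the right, and the antipode need not be bijective, so C is
   studied through its inner action b(x ⊗ x') = x ⊗ bx', which is not used in C ⊗_B -. The
   Galois map identifies A ⊗_B (A ⊗ A), with its codiagonal coaction, with A ⊗ A ⊗ H coacted
   on by the coproduct of H; taking coinvariants, A ⊗_B C ≅ A ⊗ A by a ⊗ X |-> x ⊗ ax'. Hence
   A ⊗_B (C ⊗_B N) ≅ A ⊗_B (A ⊗ N) naturally in N, and faithful flatness gives both the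
   bijection above and the flatness of C as a right B-module, by which the coproduct
   lies in C ⊗_B C. *)
From HB Require Import structures.
Require Import Defs.
From mathcomp Require Import all_boot all_order all_algebra.
From mathcomp Require Import boolp classical_sets reals complex.

Set Implicit Arguments.
Unset Strict Implicit.
Unset Printing Implicit Defensive.

Import GRing.Theory.
Local Open Scope ring_scope.

(** Identities are checked on generators. Each isomorphism of the overview supplies its own
    generating family and, with it, an extension principle: the x ⊗ can(u ⊗ c) by surjectivity of
    the canonical map ([galois_ext]), the X·c by surjectivity of C ⊗_B A -> A ⊗ A ([es_span_ext]).
    Elements such as a ⊗ 1, for which a formula is wanted, are usually not of this form, so a
    formula is first extended to an additive identity on the whole module, proved on generators, and
    only then specialised. Tensor products over B are bare abelian groups here, so maps out of them
    are only shown to be additive; scalars are moved across ⊗_B as the coinvariants k·1. The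
    inverses [cani], [inner_evali] and [es_spani] are section variables, supplied one after the
    other in [gauge_bisection]. *)

(** * Additive maps and balanced tensor products *)

Definition madd (M N : zmodType) (f : M -> N) := {morph f : x y / x + y}.

Lemma madd0 (M N : zmodType) (f : M -> N) : madd f -> f 0 = 0.
Proof. by move=> fD; apply: (addrI (f 0)); rewrite -fD !addr0. Qed.

Lemma maddN (M N : zmodType) (f : M -> N) : madd f -> {morph f : x / - x}.
Proof. by move=> fD x; apply: (addrI (f x)); rewrite -fD !subrr madd0. Qed.

Lemma maddB (M N : zmodType) (f : M -> N) : madd f -> {morph f : x y / x - y}.
Proof. by move=> fD x y; rewrite fD maddN. Qed.

Lemma madd_comp (M N P : zmodType) (f : N -> P) (g : M -> N) :
  madd f -> madd g -> madd (f \o g).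
Proof. by move=> fD gD x y; rewrite /= gD fD. Qed.

Lemma madd_inj (M N : zmodType) (f : M -> N) :
  madd f -> (forall x, f x = 0 -> x = 0) -> injective f.
Proof.
move=> fD f0 x y fxy; apply/eqP; rewrite -subr_eq0; apply/eqP/f0.
by rewrite maddB // fxy subrr.
Qed.

Lemma madd_sum (M N : zmodType) (f : M -> N) : madd f ->
  forall (I : Type) (r : seq I) (P : pred I) F,
  f (\sum_(i <- r | P i) F i) = \sum_(i <- r | P i) f (F i).
Proof. by move=> fD I r P F; rewrite (big_morph f fD (madd0 fD)). Qed.

Section BalancedMaps.
Variables (S : Type) (M N : zmodType) (ra : M -> S -> M) (la : S -> N -> N).

Lemma bpure_addl n : madd (fun m => bpure ra la m n).
Proof. by have [[D _] _] := bpure_balanced ra la; move=> x y; apply: D. Qed.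

Lemma bpure_addr m : madd (bpure ra la m).
Proof. by have [[_ D] _] := bpure_balanced ra la; move=> x y; apply: D. Qed.

Lemma bpure_bal m x n : bpure ra la (ra m x) n = bpure ra la m (la x n).
Proof. by have [_] := bpure_balanced ra la; apply. Qed.

Lemma btens_ext (G : zmodType) (f g : btens ra la -> G) : madd f -> madd g ->
  (forall m n, f (bpure ra la m n) = g (bpure ra la m n)) -> f =1 g.
Proof.
move=> fD gD fg; elim/btens_ind=> [|//|t u Et Eu]; first by rewrite !madd0.
by rewrite fD gD Et Eu.
Qed.

Lemma balancedI (G : zmodType) (f : M -> N -> G) :
  (forall n, madd (f^~ n)) -> (forall m, madd (f m)) ->
  (forall m x n, f (ra m x) n = f m (la x n)) -> balanced ra la f.
Proof. by move=> Dl Dr bal; split; first split=> *; rewrite ?bal //; [apply: Dl|apply: Dr]. Qed.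

End BalancedMaps.

Section BalancedFunctor.
Variable S : Type.

Definition rhom (M M' : zmodType) (ra : M -> S -> M) (ra' : M' -> S -> M') f :=
  madd f /\ forall m x, f (ra m x) = ra' (f m) x.
Definition lhom (N N' : zmodType) (la : S -> N -> N) (la' : S -> N' -> N') g :=
  madd g /\ forall x n, g (la x n) = la' x (g n).

Lemma rhom_id (M : zmodType) (ra : M -> S -> M) : rhom ra ra id.
Proof. by []. Qed.
Lemma lhom_id (N : zmodType) (la : S -> N -> N) : lhom la la id.
Proof. by []. Qed.

Variables (M N M' N' : zmodType) (ra : M -> S -> M) (la : S -> N -> N).
Variables (ra' : M' -> S -> M') (la' : S -> N' -> N').
Variables (f : M -> M') (g : N -> N').
Hypotheses (fH : rhom ra ra' f) (gH : lhom la la' g).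

Lemma bmap_balanced : balanced ra la (fun m n => bpure ra' la' (f m) (g n)).
Proof.
have [fD fR] := fH; have [gD gL] := gH; apply: balancedI=> [n x y|m x y|m x n].
- by rewrite fD bpure_addl.
- by rewrite gD bpure_addr.
- by rewrite fR gL bpure_bal.
Qed.

Lemma bmapE m n : bmap f g (bpure ra la m n) = bpure ra' la' (f m) (g n).
Proof. exact: (bliftE bmap_balanced). Qed.

Lemma bmapD : madd (bmap f g : btens ra la -> btens ra' la').
Proof. exact: (bliftD bmap_balanced). Qed.

End BalancedFunctor.

(** * Flatness over a field *)

Section TensorOverField.
Variable K : fieldType.

Lemma tensor_ext_add (M N : lmodType K) (G : zmodType) (f g : M ⊗ N -> G) :
  madd f -> madd g -> (forall m n, f (m ⊗ n) = g (m ⊗ n)) -> f =1 g.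
Proof. exact: btens_ext. Qed.

Lemma lin_add (M N : lmodType K) (f : M -> N) : linear f -> madd f.
Proof. exact: linD. Qed.

Lemma linZ (M N : lmodType K) (f : M -> N) : linear f -> forall k x, f (k *: x) = k *: f x.
Proof. by move=> fl k x; have := fl k x 0; rewrite !addr0 (lin0 fl) addr0. Qed.

(** A subspace maximal among those that contain [U] and avoid [v] is a complement of the line
    through [v], and [phi] is the coordinate along that line. This replaces the choice of a basis in
    [tensor_exact]. *)
Lemma functional_off_subspace (V : lmodType K) (U : set V) (v : V) :
  U 0 -> (forall k x y, U x -> U y -> U (k *: x + y)) -> ~ U v ->
  exists phi : V -> K^o, [/\ linear phi, forall u, U u -> phi u = 0 & phi v = 1].
Proof.
move=> U0 Ul Uv.
pose F (W : set V) := W = set0 \/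
  [/\ (U `<=` W)%classic, forall k x y, W x -> W y -> W (k *: x + y) & ~ W v].
have [W [FW Wmax]] : exists W, F W /\ forall W', (W `<` W')%classic -> ~ F W'.
  apply: Zorn_bigcup => Ch ChF Cht.
  have [[W0 [CW0 W0n]]|Ch0] := pselect (exists W, Ch W /\ W <> set0).
  - right; split.
    + move=> u Uu; exists W0 => //.
      by have [/W0n //|[UW0 _ _]] := ChF _ CW0; apply: UW0.
    + move=> k x y [W1 C1 W1x] [W2 C2 W2y].
      have [] := Cht _ _ C1 C2 => s12.
      * exists W2 => //; have [W20|[_ + _]] := ChF _ C2; first by rewrite W20 in W2y.
        by apply=> //; apply: s12.
      * exists W1 => //; have [W10|[_ + _]] := ChF _ C1; first by rewrite W10 in W1x.
        by apply=> //; apply: s12.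
    + move=> [W1 C1 W1v]; have [W10|[_ _ +]] := ChF _ C1; last exact.
      by rewrite W10 in W1v.
  - left; rewrite -subset0 => x [W1 C1 W1x]; apply: Ch0; exists W1; split=> // W10.
    by rewrite W10 in W1x.
have {FW} [UW Wl Wv] : [/\ (U `<=` W)%classic,
    forall k x y, W x -> W y -> W (k *: x + y) & ~ W v].
  case: FW => // W0; exfalso; apply: (Wmax U); last by right; split.
  rewrite W0; split=> // /(_ 0 U0) [].
have W0 : W 0 by apply: UW.
have WZ k x : W x -> W (k *: x) by move=> Wx; rewrite -[k *: x]addr0; apply: Wl.
have WD x y : W x -> W y -> W (x + y) by move=> Wx; rewrite -[x]scale1r; apply: Wl.
have WN x : W x -> W (- x) by rewrite -scaleN1r; apply: WZ.
have ex x : exists k : K^o, W (x - k *: v).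
  apply: contrapT => nx.
  (* If x had no coordinate along v, then W + Kx would contradict maximality: it is larger than W,
     and if it contained v, a relation v - lx in W would have l nonzero and could be solved for
     x. *)
  apply: (Wmax [set y | exists l : K, W (y - l *: x)]%classic).
    split=> [y Wy|sub]; first by exists 0; rewrite scale0r subr0.
    apply: nx; exists 0; rewrite scale0r subr0; apply: sub.
    by exists 1; rewrite scale1r subrr.
  right; split=> [u /UW Wu|k y z [l1 W1] [l2 W2]|[l Wl']].
  - by exists 0; rewrite scale0r subr0.
  - exists (k * l1 + l2).
    suff -> : k *: y + z - (k * l1 + l2) *: x = k *: (y - l1 *: x) + (z - l2 *: x).
      exact: Wl.
    by rewrite scalerDl scalerBr scalerA opprD addrACA.
  - have [l0|l0] := eqVneq l 0; first by apply: Wv; rewrite l0 scale0r subr0 in Wl'.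
    apply: nx; exists l^-1.
    suff -> : x - l^-1 *: v = - (l^-1 *: (v - l *: x)) by apply/WN/WZ.
    by rewrite scalerBr scalerA mulVf // scale1r opprB.
have uniq (x : V) (k l : K^o) : W (x - k *: v) -> W (x - l *: v) -> k = l.
  move=> Wk Wl'; apply/eqP; rewrite -subr_eq0; apply/negP => /negP kl.
  apply: Wv; rewrite -[v]scale1r -(mulVf kl) -scalerA; apply: WZ.
  suff -> : (k - l) *: v = (x - l *: v) - (x - k *: v) by apply: WD => //; apply: WN.
  by rewrite opprB [RHS]addrC addrA subrK scalerBl.
have [phi phiP] := choice ex; exists phi; split.
- move=> k x y; apply: (uniq (k *: x + y)); first exact: phiP.
  suff -> : k *: x + y - (k *: phi x + phi y) *: v
    = k *: (x - phi x *: v) + (y - phi y *: v) by apply: Wl.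
  by rewrite scalerDl scalerBr scalerA opprD addrACA.
- by move=> u /UW Wu; apply: (uniq u); rewrite // scale0r subr0.
- by apply: (uniq v); rewrite // scale1r subrr.
Qed.

(** Induction on the number of terms of t, written as a sum of v_i ⊗ n_i. Either the first v_i
    depends linearly on the others and the sum can be shortened, or a functional separates it from
    them; this forces its n_i into the kernel of g, hence into the image of f, and its term can be
    removed. *)
Lemma tensor_exact (V M N P : lmodType K) (f : M -> N) (g : N -> P) :
  linear f -> linear g -> (forall y, g y = 0 -> exists x, f x = y) ->
  forall t : V ⊗ N, tmap id g t = 0 -> exists s : V ⊗ M, tmap id f s = t.
Proof.
move=> fl gl fg.
have idl (X : lmodType K) : linear (id : X -> X) by [].
have mf := lin_add (tmap_linear (idl V) fl); have mg := lin_add (tmap_linear (idl V) gl).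
have [tl tr] : (forall n : N, madd (fun v : V => v ⊗ n)) /\ (forall v : V, madd (fun n : N => v ⊗ n)).
  by split=> x; apply: lin_add; [apply: tpurel|apply: tpurer].
move=> t; have [s ->] : exists s : seq (V * N), t = \sum_(p <- s) p.1 ⊗ p.2.
  elim/tensor_ind: t => [|v n|t u [s ->] [s' ->]].
  - by exists [::]; rewrite big_nil.
  - by exists [:: (v, n)]; rewrite big_seq1.
  - by exists (s ++ s'); rewrite big_cat.
elim: {t s}(size s) {-2}s (leqnn (size s)) => [|n IHn] [|[e m] s] //=.
- by exists 0; rewrite (madd0 mf) big_nil.
- by exists 0; rewrite (madd0 mf) big_nil.
rewrite ltnS => les.
pose U := [set x : V | exists c : nat -> K, x = \sum_(i < size s) c i *: (nth 0 s i).1]%classic.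
have [[c ce]|Ue] := pselect (U e).
  pose s' := mkseq (fun i => ((nth 0 s i).1, (nth 0 s i).2 + c i *: m)) (size s).
  suff -> : \sum_(p <- (e, m) :: s) p.1 ⊗ p.2 = \sum_(p <- s') p.1 ⊗ p.2.
    by apply: IHn; rewrite size_mkseq.
  rewrite big_cons /= ce (madd_sum (tl m)) /s' /mkseq big_map.
  have -> : iota 0 (size s) = index_iota 0 (size s) by rewrite /index_iota subn0.
  rewrite (big_nth 0) !big_mkord -big_split /=; apply: eq_bigr => i _.
  rewrite tr addrC; congr (_ + _).
  by rewrite (linZ (tpurel _)) (linZ (tpurer _)).
have [|k x y [c ->] [d ->]|phi [phil phiU phie]] := @functional_off_subspace V U e _ _ Ue.
- by exists (fun=> 0); rewrite big1 // => i _; rewrite scale0r.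
- exists (fun i => k * c i + d i); rewrite scaler_sumr -big_split; apply: eq_bigr => i _.
  by rewrite scalerDl scalerA.
move=> /[dup] t0; rewrite big_cons mg => t0'.
(* Contraction of the first leg with [phi]. Applied to the vanishing image of t it kills every term
   but the first and leaves g m = 0. *)
pose ev := tlift (fun (v : V) (p : P) => phi v *: p).
have evB : bilin (fun (v : V) (p : P) => phi v *: p).
  split=> [p|v] k x y; first by rewrite phil scalerDl scalerA.
  by rewrite scalerDr !scalerA mulrC.
have evD : madd ev by apply: lin_add; apply: tlift_linear.
have evE v p : ev (v ⊗ p) = phi v *: p by apply: tliftE.
have gm0 : g m = 0.
  have := congr1 ev t0'; rewrite (madd0 evD) evD (tmapE (idl V) gl) evE phie scale1r.
  rewrite (madd_sum mg) (madd_sum evD) => E0.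
  rewrite -E0 (big_nth 0) big_mkord big1 ?addr0 // => i _.
  rewrite (tmapE (idl V) gl) evE phiU ?scale0r //.
  exists (fun j => (j == i :> nat)%:R).
  rewrite (bigD1 i) //= eqxx scale1r big1 ?addr0 // => j /negPf ji.
  by rewrite -val_eqE /= in ji; rewrite ji scale0r.
have [s' s'E] : exists s', tmap id f s' = \sum_(p <- s) p.1 ⊗ p.2 :> V ⊗ N.
  apply: IHn => //; have := t0'.
  by rewrite (tmapE (idl V) gl) gm0 (lin0 (tpurer _)) add0r.
have [m' fm'] := fg m gm0.
by exists (e ⊗ m' + s'); rewrite mf s'E (tmapE (idl V) fl) fm'.
Qed.

End TensorOverField.

(** * Faithful flatness for explicit actions *)

Section Actions.
Variables (K : fieldType) (H : algType K) (hH : hopf_algebra H) (A : algType K).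
Variable dA : comodule_algebra hH A.
Local Notation B := (coinv dA).

(** The module axioms are spelled out because one abelian group carries several left actions of B: A
    ⊗ A has the outer action on its first leg and the inner action on its second. The action
    therefore has to be an argument, not a structure attached to the type. *)
Definition is_action (M : zmodType) (act : B -> M -> M) : Prop :=
  [/\ forall m, act 1 m = m, forall b c m, act b (act c m) = act (b * c) m,
      forall b, madd (act b) & forall m, madd (act^~ m)].

Section Pack.
Variables (M : zmodType) (act : B -> M -> M) (actP : is_action act).

(* Packing an explicit action as an lmodType B allows [faithfully_flat] to be applied to it. *)
Definition action_carrier : Type := let _ := actP in M.
HB.instance Definition _ := GRing.Zmodule.on action_carrier.

Fact action_mulA a b (v : action_carrier) : act a (act b v) = act (a * b) v.
Proof. by have [_ ? _ _] := actP. Qed.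
Fact action_1 : left_id 1 (act : B -> action_carrier -> action_carrier).
Proof. by have [? _ _ _] := actP. Qed.
Fact action_Dr : right_distributive (act : B -> action_carrier -> action_carrier) +%R.
Proof. by have [_ _ D _] := actP; move=> a x y; apply: D. Qed.
Fact action_Dl (v : action_carrier) : {morph act^~ v : a b / a + b}.
Proof. by have [_ _ _ D] := actP; move=> a x; apply: D. Qed.

HB.instance Definition _ := GRing.Zmodule_isLmodule.Build B action_carrier
  action_mulA action_1 action_Dr action_Dl.
End Pack.

Local Notation AB act := (btens (@actr _ _ _ _ dA) act).

Lemma ff_exact (L M N : zmodType) (aL : B -> L -> L) (aM : B -> M -> M)
    (aN : B -> N -> N) (f : L -> M) (g : M -> N) :
  faithfully_flat dA -> is_action aL -> is_action aM -> is_action aN ->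
  lhom aL aM f -> lhom aM aN g ->
  exact_seq f g <-> exact_seq (bmap id f : AB aL -> AB aM) (bmap id g : AB aM -> AB aN).
Proof.
(* Once L, M and N are destructed, their copies under action_carrier are convertible to them. *)
case: L M N aL aM aN f g => TL cL [TM cM] [TN cN] aL aM aN f g.
move=> ff PL PM PN [fD fL] [gD gL].
have fl : linear (f : action_carrier PL -> action_carrier PM).
  by move=> b x y; rewrite [LHS]fD; congr (_ + _); apply: fL.
have gl : linear (g : action_carrier PM -> action_carrier PN).
  by move=> b x y; rewrite [LHS]gD; congr (_ + _); apply: gL.
pose f' : {linear action_carrier PL -> action_carrier PM} :=
  HB.pack (f : action_carrier PL -> action_carrier PM) (GRing.isLinear.Build _ _ _ _ _ fl).
pose g' : {linear action_carrier PM -> action_carrier PN} :=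
  HB.pack (g : action_carrier PM -> action_carrier PN) (GRing.isLinear.Build _ _ _ _ _ gl).
exact: (ff _ _ _ f' g').
Qed.

Section Reflect.
Hypothesis ff : faithfully_flat dA.
Variables (M N : zmodType) (aM : B -> M -> M) (aN : B -> N -> N) (f : M -> N).
Hypotheses (PM : is_action aM) (PN : is_action aN) (fH : lhom aM aN f).
Local Notation Af := (bmap id f : AB aM -> AB aN).

(** Row vectors of length 0 serve as the zero module: injectivity and surjectivity of f are the
    exactness of 0 -> M -> N and M -> N -> 0, to which [ff_exact] applies. *)
Let Z : zmodType := 'rV[A]_0.
Let aZ : B -> Z -> Z := fun _ z => z.

Let Z0 (z z' : Z) : z = z'.
Proof. by apply/rowP; case. Qed.

Let PZ : is_action aZ.
Proof. by split=> [m|b c m|b x y|m x y]; apply: Z0. Qed.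

Let AZ0 (z z' : AB aZ) : z = z'.
Proof.
suff H0 t : t = 0 :> AB aZ by rewrite (H0 z) (H0 z').
have D : madd (fun t : AB aZ => 0 : AB aZ) by move=> x y; rewrite addr0.
apply: (btens_ext (f := id) (g := fun=> 0)) => // a n.
by rewrite (Z0 n 0) (madd0 (bpure_addr _ _ _)).
Qed.

Let AfD : madd Af. Proof. exact: (bmapD (rhom_id (@actr _ _ _ _ dA)) fH). Qed.

Let zH (P : zmodType) (aP : B -> P -> P) : is_action aP -> lhom aZ aP (fun=> 0).
Proof.
by move=> [_ _ D _]; split=> [x y|b n]; rewrite ?addr0 // (madd0 (D b)).
Qed.

Lemma exact_inj (Z' P Q : zmodType) (z : Z' -> P) (g : P -> Q) :
  madd g -> (forall x, z x = 0) -> inhabited Z' -> exact_seq z g <-> injective g.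
Proof.
move=> gD z0 [x0]; split=> [ex|inj y].
  by apply: madd_inj => // y /ex [x <-].
split=> [gy|[x <-]]; last by rewrite z0 madd0.
by exists x0; rewrite z0; apply: inj; rewrite gy madd0.
Qed.

Lemma exact_surj (Z' P Q : zmodType) (g : P -> Q) (z : Q -> Z') :
  (forall x, z x = 0) -> exact_seq g z <-> forall y, exists x, g x = y.
Proof.
move=> z0; split=> [ex y|surj y]; first exact/ex/z0.
by split=> [_|_]; [apply: surj|apply: z0].
Qed.

Lemma ff_injective : injective Af <-> injective f.
Proof.
have E := ff_exact ff PZ PM PN (zH PM) fH.
rewrite -(exact_inj (z := fun _ : Z => 0)) //; last 2 first.
- exact: fH.1.
- by constructor; apply: 0.
rewrite E exact_inj //; last by constructor; apply: 0.
elim/btens_ind=> [|a z|t u Et Eu].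
- by rewrite (madd0 (bmapD (rhom_id _) (zH PM))).
- by rewrite (bmapE (rhom_id _) (zH PM)) (madd0 (bpure_addr _ _ _)).
- by rewrite (bmapD (rhom_id _) (zH PM)) Et Eu addr0.
Qed.

Lemma ff_surjective : (forall y, exists x, Af x = y) <-> (forall y, exists x, f x = y).
Proof.
have H0 : lhom aN aZ (fun=> 0) by split=> [x y|b n]; apply: Z0.
have E := ff_exact ff PM PN PZ fH H0.
by rewrite -(exact_surj _ (z := fun _ => 0 : Z)) // E exact_surj // => x; apply: AZ0.
Qed.
End Reflect.
End Actions.

(** * Multilinear maps on tensor products over the field *)

Section TensorFacts.
Variable K : fieldType.

Lemma lin_id (M : lmodType K) : linear (id : M -> M).
Proof. by []. Qed.

Lemma lin_mull (A : algType K) (a : A) : linear (fun x => a * x).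
Proof. exact: (mul_bilin A).2. Qed.

Lemma lin_mulr (A : algType K) (a : A) : linear (fun x => x * a).
Proof. exact: (mul_bilin A).1. Qed.

Lemma tpurel_comp (P M N : lmodType K) (f : P -> M) (n : N) :
  linear f -> linear (fun p => f p ⊗ n).
Proof. exact: (linear_comp (tpurel n)). Qed.

Lemma tpurer_comp (P M N : lmodType K) (m : M) (f : P -> N) :
  linear f -> linear (fun p => m ⊗ f p).
Proof. exact: (linear_comp (tpurer m)). Qed.

Lemma mull_comp (P : lmodType K) (A : algType K) (a : A) (f : P -> A) :
  linear f -> linear (fun p => a * f p).
Proof. exact: (linear_comp (lin_mull a)). Qed.

Lemma mulr_comp (P : lmodType K) (A : algType K) (a : A) (f : P -> A) :
  linear f -> linear (fun p => f p * a).
Proof. exact: (linear_comp (lin_mulr a)). Qed.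

Lemma linearI (M N : lmodType K) (f : M -> N) :
  madd f -> (forall k x, f (k *: x) = k *: f x) -> linear f.
Proof. by move=> D Z k x y; rewrite D Z. Qed.

Lemma tpureDl (M N : lmodType K) (n : N) : madd (fun m : M => m ⊗ n).
Proof. exact/lin_add/tpurel. Qed.
Lemma tpureDr (M N : lmodType K) (m : M) : madd (fun n : N => m ⊗ n).
Proof. exact/lin_add/tpurer. Qed.
Lemma tpureZl (M N : lmodType K) k (m : M) (n : N) : (k *: m) ⊗ n = k *: (m ⊗ n).
Proof. exact: (linZ (tpurel n)). Qed.
Lemma tpureZr (M N : lmodType K) k (m : M) (n : N) : m ⊗ (k *: n) = k *: (m ⊗ n).
Proof. exact: (linZ (tpurer m)). Qed.

Lemma tmapD (M N M' N' : lmodType K) (f : M -> M') (g : N -> N') :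
  linear f -> linear g -> madd (tmap f g).
Proof. by move=> fl gl; apply/lin_add/tmap_linear. Qed.

Lemma tmap_comp (M N M' N' M'' N'' : lmodType K) (f : M -> M') (g : N -> N')
    (f' : M' -> M'') (g' : N' -> N'') :
  linear f -> linear g -> linear f' -> linear g' ->
  forall t, tmap f' g' (tmap f g t) = tmap (fun x => f' (f x)) (fun x => g' (g x)) t.
Proof.
move=> fl gl fl' gl'.
have fl2 := linear_comp fl' fl; have gl2 := linear_comp gl' gl.
apply: (@tensor_ext K M N _ (tmap f' g' \o tmap f g)).
- by apply: linear_comp; apply: tmap_linear.
- exact: tmap_linear.
- by move=> m n /=; rewrite !tmapE.
Qed.

Lemma tmap_id (M N : lmodType K) (t : M ⊗ N) : tmap id id t = t.
Proof.
apply: (@tensor_ext K M N _ (tmap id id) id) => // [|m n].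
- by apply: tmap_linear; apply: lin_id.
- by rewrite tmapE.
Qed.

Lemma tlift_comp (M N G G' : lmodType K) (f : M -> N -> G) (g : G -> G') :
  bilin f -> linear g -> forall t, g (tlift f t) = tlift (fun m n => g (f m n)) t.
Proof.
move=> fB gl.
have gfB : bilin (fun m n => g (f m n)).
  by split=> [n|m]; [apply: (linear_comp gl (fB.1 n))|apply: (linear_comp gl (fB.2 m))].
apply: (@tensor_ext K M N _ (g \o tlift f)).
- by apply: linear_comp => //; apply: tlift_linear.
- exact: tlift_linear.
- by move=> m n /=; rewrite !tliftE.
Qed.

Lemma tlift_tmap (M N M' N' G : lmodType K) (f : M -> M') (g : N -> N') (h : M' -> N' -> G) :
  linear f -> linear g -> bilin h ->
  forall t, tlift h (tmap f g t) = tlift (fun m n => h (f m) (g n)) t.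
Proof.
move=> fl gl hB.
have hB' : bilin (fun m n => h (f m) (g n)).
  by split=> [n|m]; [apply: (linear_comp (hB.1 _) fl)|apply: (linear_comp (hB.2 _) gl)].
apply: (@tensor_ext K M N _ (tlift h \o tmap f g)).
- by apply: linear_comp; [apply: tlift_linear|apply: tmap_linear].
- exact: tlift_linear.
- by move=> m n /=; rewrite tmapE // !tliftE.
Qed.

Definition trilin (M N P G : lmodType K) (f : M -> N -> P -> G) :=
  [/\ forall n p, linear (fun m => f m n p), forall m p, linear (fun n => f m n p)
    & forall m n, linear (f m n)].

Lemma tassoc_linear (M N P : lmodType K) : linear (@tassoc K M N P).
Proof.
apply: tlift_linear; split=> [q|t].
  apply: tlift_linear; split=> [n|m]; first exact: tpurel.
  (apply: tpurer_comp; exact: tpurel).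
apply: (@tlift_param K P M N _ (fun p m n => m ⊗ (n ⊗ p))) => m' n'.
exact: (linear_comp (tpurer _) (tpurer _)).
Qed.

(** Replaces Sweedler notation: it turns a coassociativity law, stated with [tassoc], into an
    equality of iterated sums for any trilinear summand. *)
Lemma tlift_tassoc (M N P G : lmodType K) (f : M -> N -> P -> G) : trilin f ->
  forall t, tlift (fun m t' => tlift (f m) t') (tassoc t)
          = tlift (fun t' p => tlift (fun m n => f m n p) t') t.
Proof.
move=> [f1 f2 f3].
have fB12 p : bilin (fun m n => f m n p) by split=> [n|m]; [apply: f1|apply: f2].
have fB23 m : bilin (f m) by split=> [p|n]; [apply: f2|apply: f3].
have B1 : bilin (fun m t' => tlift (f m) t').
  by split=> [t|m]; [apply: tlift_param => n p; apply: f1|apply: tlift_linear].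
have B2 : bilin (fun t' p => tlift (fun m n => f m n p) t').
  split=> [p|t]; first exact: tlift_linear.
  by apply: (@tlift_param K P M N G (fun p m n => f m n p)) => m n; apply: f3.
have Al := @tassoc_linear M N P.
move=> t; elim/tensor_ind: t => [|t p|t u Et Eu].
- by rewrite (lin0 Al) !(lin0 (tlift_linear _)).
- rewrite (tliftE B2).
  elim/tensor_ind: t => [|m n|t u Et Eu].
  + by rewrite (lin0 (tpurel _)) (lin0 Al) (lin0 (tlift_linear B1)) (lin0 (tlift_linear (fB12 p))).
  + by rewrite tassocE (tliftE B1) (tliftE (fB23 m)) (tliftE (fB12 p)).
  + by rewrite (linD (tpurel _)) (linD Al) (linD (tlift_linear B1))
      (linD (tlift_linear (fB12 p))) Et Eu.
- by rewrite (linD Al) (linD (tlift_linear B1)) (linD (tlift_linear B2)) Et Eu.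
Qed.

End TensorFacts.

(** * Iterated coactions and the antipode *)

Section Coaction.
Variables (K : fieldType) (H : algType K) (hH : hopf_algebra H) (A : algType K).
Variable dA : comodule_algebra hH A.
Local Notation delta := (coact dA).
Local Notation S := (hant hH).
Local Notation Delta := (hcop hH).
Local Notation eps := (hcou hH).

Lemma hcop_linear : linear Delta. Proof. by have [] := hcop_alg hH. Qed.

(** Coassociativity in usable form: the sums of f(x_(0)(0), x_(0)(1), x_(1)) and of f(x_(0),
    x_(1)(1), x_(1)(2)) agree. *)
Lemma coact_sweedler (G : lmodType K) (f : A -> H -> H -> G) : trilin f -> forall x,
  tlift (fun y k => tlift (fun z g => f z g k) (delta y)) (delta x)
  = tlift (fun z h => tlift (f z) (Delta h)) (delta x).
Proof.
move=> fT; have [f1 f2 f3] := fT => x.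
have fB12 p : bilin (fun m n => f m n p) by split=> [n|m]; [apply: f1|apply: f2].
have B2 : bilin (fun t' p => tlift (fun m n => f m n p) t').
  split=> [p|t]; first exact: tlift_linear.
  by apply: (@tlift_param K H A H G (fun p m n => f m n p)) => m n; apply: f3.
have fB23 m : bilin (f m) by split=> [p|n]; [apply: f2|apply: f3].
have B1 : bilin (fun m t' => tlift (f m) t').
  by split=> [t|m]; [apply: tlift_param => n p; apply: f1|apply: tlift_linear].
rewrite -(tlift_tmap (@coact_linear _ _ _ _ dA) (@lin_id _ _) B2) -(tlift_tassoc fT) coactA.
by rewrite (tlift_tmap (@lin_id _ _) hcop_linear B1).
Qed.

Lemma eq_tlift (M N : lmodType K) (G : zmodType) (f g : M -> N -> G) (t : M ⊗ N) :
  (forall m n, f m n = g m n) -> tlift f t = tlift g t.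
Proof. by move=> fg; rewrite (_ : f = g) //; apply/funext=> m; apply/funext=> n. Qed.

Lemma coact_counit_lift (G : lmodType K) (f : A -> G) : linear f ->
  forall x, tlift (fun z h => eps h *: f z) (delta x) = f x.
Proof.
move=> fl x; rewrite -{2}(coact_counit dA x) (tlift_comp _ fl).
  by apply: eq_tlift => m n; rewrite (linZ fl).
split=> [h|a] k y z; first by rewrite scalerDr !scalerA mulrC.
by rewrite (hcou_lin hH) scalerDl scalerA.
Qed.

Local Notation T := ((A ⊗ A) ⊗ H)%type.
Local Notation T' := (A ⊗ (A ⊗ H))%type.

(** x ⊗ (a ⊗ h) |-> (x_(0) ⊗ a) ⊗ x_(1)h, which untwists the codiagonal coaction in its first leg.
    As x_(1) stands to the left of h, the inverse is (x ⊗ a) ⊗ h |-> x_(0) ⊗ (a ⊗ S(x_(1))h), with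
    the antipode itself and not its inverse. *)
Definition coact_left : T' -> T := tlift (fun x t => codiag_pair (delta x) t).

Lemma coact_left_bilin : bilin (fun x (t : A ⊗ H) => codiag_pair (delta x) t).
Proof.
split=> [t|x]; last exact: (codiag_pair_bilin _ _).2.
exact: (linear_comp ((codiag_pair_bilin _ _).1 _) (@coact_linear _ _ _ _ dA)).
Qed.

Lemma coact_left_linear : linear coact_left.
Proof. exact: (tlift_linear coact_left_bilin). Qed.

Lemma coact_leftE x t : coact_left (x ⊗ t) = codiag_pair (delta x) t.
Proof. exact: (tliftE coact_left_bilin). Qed.

Lemma codiag_pair_tlift (u : A ⊗ H) a h :
  codiag_pair u (a ⊗ h) = tlift (fun x g => (x ⊗ a) ⊗ (g * h)) u.
Proof.
have B1 : bilin (fun (x : A) (g : H) => (x ⊗ a) ⊗ (g * h)).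
  split=> [g|x]; first (apply: tpurel_comp; exact: tpurel).
  (apply: tpurer_comp; exact: lin_mulr).
apply: (@tensor_ext K A H _ (fun u => codiag_pair u (a ⊗ h))).
- exact: (codiag_pair_bilin _ _).1.
- exact: tlift_linear.
- by move=> x g; rewrite codiag_pairE tliftE.
Qed.

Let qx (x a : A) (h : H) : T' := tlift (fun y g => y ⊗ (a ⊗ (S g * h))) (delta x).

Let qB (a : A) (h : H) : bilin (fun (y : A) (g : H) => y ⊗ (a ⊗ (S g * h))).
Proof.
split=> [g|y]; first exact: tpurel.
apply: tpurer_comp; apply: tpurer_comp.
(apply: mulr_comp; exact: hant_lin).
Qed.

Let qT : trilin qx.
Proof.
split=> [a h|x h|x a].
- exact: (linear_comp (tlift_linear (qB _ _)) (@coact_linear _ _ _ _ dA)).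
- apply: (@tlift_param K A A H _ (fun a y g => y ⊗ (a ⊗ (S g * h)))) => y g.
  (apply: tpurer_comp; exact: tpurel).
- apply: (@tlift_param K H A H _ (fun h y g => y ⊗ (a ⊗ (S g * h)))) => y g.
  apply: tpurer_comp; apply: tpurer_comp; exact: lin_mull.
Qed.

Definition coact_left_inv : T -> T' := tlift (fun z h => tlift (fun x a => qx x a h) z).

Let qB1 h : bilin (fun x a => qx x a h).
Proof. by have [q1 q2 q3] := qT; split=> [a|x]; [apply: q1|apply: q2]. Qed.

Let qB2 : bilin (fun z h => tlift (fun x a => qx x a h) z).
Proof.
split=> [h|z]; first exact: tlift_linear.
by apply: (@tlift_param K H A A _ (fun h x a => qx x a h)) => x a; have [_ _] := qT.
Qed.

Lemma coact_left_inv_linear : linear coact_left_inv.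
Proof. exact: tlift_linear. Qed.

Lemma coact_left_invE x a h : coact_left_inv ((x ⊗ a) ⊗ h) =
  tlift (fun y g => y ⊗ (a ⊗ (S g * h))) (delta x).
Proof. by rewrite /coact_left_inv (tliftE qB2) (tliftE (qB1 h)). Qed.

(** After coassociativity the H-leg is S(x_(1))x_(2)h, which the left antipode axiom and the counit
    reduce to h. The other composite has x_(1)S(x_(2))h and uses the right axiom. *)
Lemma coact_leftK : cancel coact_left coact_left_inv.
Proof.
have cl := linear_comp coact_left_inv_linear coact_left_linear.
apply: (@tensor_ext K A _ _ (coact_left_inv \o coact_left) id) => // x.
apply: (@tensor_ext K A H _ (fun t => (coact_left_inv \o coact_left) (x ⊗ t))).
- exact: (linear_comp cl (tpurer x)).
- exact: tpurer.
move=> a h /=; rewrite coact_leftE codiag_pair_tlift.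
rewrite (tlift_comp _ coact_left_inv_linear); last first.
  split=> [g|y]; first (apply: tpurel_comp; exact: tpurel).
  (apply: tpurer_comp; exact: lin_mulr).
under eq_tlift do rewrite coact_left_invE.
rewrite (@coact_sweedler _ (fun y g k => y ⊗ (a ⊗ (S g * (k * h))))).
  have E z g : tlift (fun g k => z ⊗ (a ⊗ (S g * (k * h)))) (Delta g) = eps g *: (z ⊗ (a ⊗ h)).
    have := hantl hH g; move/(congr1 (fun m => z ⊗ (a ⊗ (m * h)))).
    rewrite -scalerAl mul1r !tpureZr => <-; rewrite -/(_ \o _).
    have l : linear (fun m => z ⊗ (a ⊗ (m * h))).
      apply: tpurer_comp; apply: tpurer_comp; exact: lin_mulr.
    rewrite (tlift_comp _ l); first by apply: eq_tlift => *; rewrite mulrA.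
    split=> [k|k]; last exact: lin_mull.
    (apply: mulr_comp; exact: hant_lin).
  under eq_tlift do rewrite E.
  exact: (coact_counit_lift (@tpurel _ _ _ (a ⊗ h))).
split=> *; first exact: tpurel.
- apply: tpurer_comp; apply: tpurer_comp.
  (apply: mulr_comp; exact: hant_lin).
- apply: tpurer_comp; apply: tpurer_comp.
  (apply: mull_comp; exact: lin_mulr).
Qed.

Lemma coact_left_invK : cancel coact_left_inv coact_left.
Proof.
have cl := linear_comp coact_left_linear coact_left_inv_linear.
move=> t; elim/tensor_ind: t => [|z h|t u Et Eu]; first exact: (lin0 cl).
  move: z; apply: (@tensor_ext K A A _ (fun z => (coact_left \o coact_left_inv) (z ⊗ h))).
  - exact: (linear_comp cl (tpurel h)).
  - exact: tpurel.
  move=> x a /=; rewrite coact_left_invE (tlift_comp (qB a h) coact_left_linear).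
  under eq_tlift do rewrite coact_leftE codiag_pair_tlift.
  rewrite (@coact_sweedler _ (fun y g k => (y ⊗ a) ⊗ (g * (S k * h)))).
    have E z g : tlift (fun g k => (z ⊗ a) ⊗ (g * (S k * h))) (Delta g)
        = eps g *: ((z ⊗ a) ⊗ h).
      have := hantr hH g; move/(congr1 (fun m => (z ⊗ a) ⊗ (m * h))).
      rewrite -scalerAl mul1r !tpureZr => <-.
      have l : linear (fun m => (z ⊗ a) ⊗ (m * h)).
        apply: tpurer_comp; exact: lin_mulr.
      rewrite (tlift_comp _ l); first by apply: eq_tlift => *; rewrite mulrA.
      split=> [k|k]; first exact: lin_mulr.
      (apply: mull_comp; exact: hant_lin).
    under eq_tlift do rewrite E.
    apply: (coact_counit_lift (f := fun z => (z ⊗ a) ⊗ h)).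
    (apply: tpurel_comp; exact: tpurel).
  split=> *; first (apply: tpurel_comp; exact: tpurel).
  - by apply: tpurer_comp; apply: lin_mulr.
  - apply: tpurer_comp; apply: mull_comp.
    (apply: mulr_comp; exact: hant_lin).
by have := linD cl t u => /= ->; rewrite Et Eu.
Qed.

End Coaction.

(** * The Galois isomorphism *)

Section Galois.
Variables (K : fieldType) (H : algType K) (hH : hopf_algebra H) (A : algType K).
Variable dA : comodule_algebra hH A.
Local Notation B := (coinv dA).
Local Notation C := (es dA).
Local Notation delta := (coact dA).
Local Notation T := ((A ⊗ A) ⊗ H)%type.
Local Notation T' := (A ⊗ (A ⊗ H))%type.
Local Notation AB act := (btens (@actr _ _ _ _ dA) act).
Local Notation actr := (@actr _ _ _ _ dA).
Local Notation actl := (@actl _ _ _ _ dA).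

Lemma delta_linear : linear delta. Proof. exact: coact_linear. Qed.

Definition can_at (a c : A) : A ⊗ H := tmap (fun x => a * x) id (delta c).

Lemma can_at_bilin : bilin can_at.
Proof.
split=> [c|a].
- apply: (@tlift_param K A A H _ (fun a x h => (a * x) ⊗ h)) => x h.
  by apply: tpurel_comp; apply: lin_mulr.
- exact: (linear_comp (tmap_linear (lin_mull a) (@lin_id _ _)) delta_linear).
Qed.

Lemma canE a c : canonical_map (bpure actr actl a c) = can_at a c.
Proof. exact: canonical_mapE. Qed.

Lemma can_at_bal a (b : B) c : can_at (a * val b) c = can_at a (val b * c).
Proof. by rewrite -!canE -/(Defs.actr a b) bpure_bal. Qed.

Lemma canD : madd (@canonical_map _ _ _ _ dA).
Proof.
apply: bliftD; apply: balancedI => [c|a|a b c].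
- exact: lin_add (can_at_bilin.1 c).
- exact: lin_add (can_at_bilin.2 a).
- exact: can_at_bal.
Qed.

Definition mulr_leg (c : A) (Z : A ⊗ A) : A ⊗ A := tmap id (fun x => x * c) Z.

Lemma mulr_leg_linear c : linear (mulr_leg c).
Proof. by apply: tmap_linear; [apply: lin_id|apply: lin_mulr]. Qed.

Lemma mulr_legE c x x' : mulr_leg c (x ⊗ x') = x ⊗ (x' * c).
Proof. by rewrite /mulr_leg tmapE //; apply: lin_mulr. Qed.

Lemma mulr_leg_linearl Z : linear (fun c => mulr_leg c Z).
Proof.
apply: (@tlift_param K A A A _ (fun c x x' => x ⊗ (x' * c))) => x x'.
by apply: tpurer_comp; apply: lin_mull.
Qed.

Lemma mulr_legM c c' Z : mulr_leg c (mulr_leg c' Z) = mulr_leg (c' * c) Z.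
Proof.
rewrite /mulr_leg tmap_comp; try exact: lin_mulr; try exact: lin_id.
by congr (tmap _ _ _); apply/funext=> x; rewrite mulrA.
Qed.

Lemma mulr_leg1 Z : mulr_leg 1 Z = Z.
Proof.
rewrite -{2}[Z]tmap_id /mulr_leg; congr (tmap _ _ _); apply/funext=> x; exact: mulr1.
Qed.

Definition mulr_coact (Z : A ⊗ A) (c : A) : T := tmap (fun c0 => mulr_leg c0 Z) id (delta c).

Lemma mulr_coact_bilin : bilin mulr_coact.
Proof.
split=> [c|Z].
- apply: (@tlift_param K _ A H _ (fun Z c h => mulr_leg c Z ⊗ h)) => x h.
  by apply: tpurel_comp; apply: mulr_leg_linear.
- exact: (linear_comp (tmap_linear (mulr_leg_linearl Z) (@lin_id _ _)) delta_linear).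
Qed.

Lemma tassoc_mulr_coact x u c : tassoc (mulr_coact (x ⊗ u) c) = x ⊗ can_at u c.
Proof.
rewrite /mulr_coact /can_at; move: (delta c).
have l1 := tmap_linear (lin_mull u) (@lin_id K H).
have l2 := tmap_linear (mulr_leg_linearl (x ⊗ u)) (@lin_id K H).
apply: (@tensor_ext K A H _ (@tassoc K A A H \o tmap (fun c0 => mulr_leg c0 (x ⊗ u)) id)
  (fun t => x ⊗ tmap (fun y => u * y) id t)).
- exact: (linear_comp (@tassoc_linear _ _ _ _) l2).
- exact: tpurer_comp.
- move=> a h /=; rewrite !tmapE ?mulr_legE ?tassocE //; [exact: lin_mull|exact: mulr_leg_linearl].
Qed.

(** The coaction of X·c is that of X multiplied by δ(c), and a coinvariant X contributes only the
    factor 1 in H. This formula for the generators X·c lets colinearity be tested on them. *)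
Lemma codiag_mulr_leg (X : C) c : codiag dA (mulr_leg c (val X)) = mulr_coact (val X) c.
Proof.
pose RM := tmul2 (fun (Z : A ⊗ A) c => mulr_leg c Z) (fun h k : H => h * k) : T -> A ⊗ H -> T.
have rB : bilin (fun Z c => mulr_leg c Z) by split=> [x|Z]; [apply: mulr_leg_linear|apply: mulr_leg_linearl].
have RMB : bilin RM := tmul2_bilin rB (mul_bilin H).
have RME Z a h k : RM (Z ⊗ h) (a ⊗ k) = mulr_leg a Z ⊗ (h * k).
  by rewrite /RM (tmul2E rB (mul_bilin H)).
have mB : bilin (@talg_mul K A H) := tmul2_bilin (mul_bilin A) (mul_bilin H).
have E Z : codiag dA (mulr_leg c Z) = RM (codiag dA Z) (delta c).
  move: Z; apply: (@tensor_ext K A A _ (codiag dA \o mulr_leg c) (fun Z => RM (codiag dA Z) (delta c))).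
  - exact: (linear_comp (codiag_linear _) (mulr_leg_linear c)).
  - exact: (linear_comp (RMB.1 _) (codiag_linear _)).
  move=> x x' /=; rewrite mulr_legE !codiagE coactE.
  move: (delta x) (delta x') (delta c) => u v w.
  move: u; apply: (@tensor_ext K A H _ (fun u => codiag_pair u (talg_mul v w))
     (fun u => RM (codiag_pair u v) w)).
  - exact: (codiag_pair_bilin _ _).1.
  - exact: (linear_comp (RMB.1 _) ((codiag_pair_bilin _ _).1 _)).
  move=> a h; move: v; apply: (@tensor_ext K A H _ (fun v => codiag_pair _ (talg_mul v w))
     (fun v => RM (codiag_pair _ v) w)).
  - exact: (linear_comp ((codiag_pair_bilin _ _).2 _) (mB.1 _)).
  - exact: (linear_comp (RMB.1 _) ((codiag_pair_bilin _ _).2 _)).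
  move=> a' h'; move: w; apply: (@tensor_ext K A H _ (fun w => codiag_pair _ (talg_mul _ w))
     (fun w => RM _ w)).
  - exact: (linear_comp ((codiag_pair_bilin _ _).2 _) (mB.2 _)).
  - exact: (RMB.2 _).
  move=> a'' h''; rewrite /talg_mul (tmul2E (mul_bilin A) (mul_bilin H)).
  by rewrite !codiag_pairE RME mulr_legE mulrA.
rewrite E (elimT (es_predP _ _) (valP X)) /mulr_coact; move: (delta c).
apply: (@tensor_ext K A H _ (RM (val X ⊗ 1))).
- exact: (RMB.2 _).
- by apply: tmap_linear; [apply: mulr_leg_linearl|apply: lin_id].
- by move=> a h; rewrite RME mul1r tmapE //; apply: mulr_leg_linearl.
Qed.

Variable cani : A ⊗ H -> AtensBA dA.
Hypothesis canK : cancel (@canonical_map _ _ _ _ dA) cani.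
Hypothesis caniK : cancel cani (@canonical_map _ _ _ _ dA).

Lemma caniD : madd cani.
Proof. by move=> t u; apply: (can_inj canK); rewrite canD !caniK. Qed.

Lemma cani_can_at a c : cani (can_at a c) = bpure actr actl a c.
Proof. by rewrite -canE canK. Qed.

Lemma can_at_ext (G : zmodType) (f g : A ⊗ H -> G) : madd f -> madd g ->
  (forall a c, f (can_at a c) = g (can_at a c)) -> f =1 g.
Proof.
move=> fD gD fg t; rewrite -[t]caniK; move: (cani t).
apply: (btens_ext (f := f \o @canonical_map _ _ _ _ dA)
                  (g := g \o @canonical_map _ _ _ _ dA)).
- exact: madd_comp canD.
- exact: madd_comp canD.
- by move=> a c; rewrite /= canE.
Qed.

Lemma galois_ext (G : zmodType) (f g : T' -> G) : madd f -> madd g ->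
  (forall x u c, f (x ⊗ can_at u c) = g (x ⊗ can_at u c)) -> f =1 g.
Proof.
move=> fD gD fg; apply: tensor_ext_add => // x.
apply: (@can_at_ext _ (fun t => f (x ⊗ t)) (fun t => g (x ⊗ t))) => //.
- exact: madd_comp (tpureDr _).
- exact: madd_comp (tpureDr _).
Qed.

(* The Galois condition makes A ⊗ (A ⊗ H) a model of A ⊗ (A ⊗_B A): it has the
   corresponding universal property. *)
Definition galois_tri (G : zmodType) (f : A -> A -> A -> G) : Prop :=
  [/\ forall u c, madd (fun x => f x u c), forall x, balanced actr actl (f x)
    & forall k x u c, f (k *: x) u c = f x (k *: u) c].

Section GaloisLift.
Variables (G : zmodType) (f : A -> A -> A -> G).
Hypothesis fT : galois_tri f.

Definition galois_lift : T' -> G := tlift (fun x t => blift (f x) (cani t)).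

Lemma galois_lift_bal : balanced (fun (x : A) (k : K) => k *: x) (fun k (t : A ⊗ H) => k *: t)
  (fun x t => blift (f x) (cani t)).
Proof.
have [f1 f2 fK] := fT; apply: balancedI => [t x y|x t u|x k t].
- move: (cani t); apply: btens_ext => [|t' u|u c].
  + exact: bliftD.
  + by rewrite !(bliftD (f2 _)) addrACA.
  + by rewrite !bliftE // f1.
- by rewrite caniD (bliftD (f2 _)).
- move: t; apply: (@can_at_ext _ (fun t => blift (f (k *: x)) (cani t))
    (fun t => blift (f x) (cani (k *: t)))).
  + exact: madd_comp (bliftD (f2 _)) caniD.
  + by move=> t u; rewrite scalerDr caniD (bliftD (f2 _)).
  + move=> u c; rewrite -(linZ (can_at_bilin.1 c)) !cani_can_at !bliftE //.
Qed.

Lemma galois_liftD : madd galois_lift. Proof. exact: (bliftD galois_lift_bal). Qed.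

Lemma galois_lift_pure x t : galois_lift (x ⊗ t) = blift (f x) (cani t).
Proof. exact: (bliftE galois_lift_bal). Qed.

Lemma galois_liftE x u c : galois_lift (x ⊗ can_at u c) = f x u c.
Proof. by have [_ f2 _] := fT; rewrite galois_lift_pure cani_can_at bliftE. Qed.
End GaloisLift.

(* The inner action b (x ⊗ x') = x ⊗ bx' commutes with both actions of B which define
   C ⊗_B -, hence it survives on C ⊗_B N. *)
Definition env_inner (b : B) : A ⊗ A -> A ⊗ A := tmap id (actl b).
Definition es_inner (b : B) (X : C) : C := es_mul X (es_target b).

Lemma actl_linear b : linear (actl b). Proof. exact: lin_mull. Qed.

Lemma env_inner_linear b : linear (env_inner b).
Proof. by apply: tmap_linear; [apply: lin_id|apply: actl_linear]. Qed.

Lemma env_innerE b x x' : env_inner b (x ⊗ x') = x ⊗ (val b * x').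
Proof. by rewrite /env_inner tmapE //; apply: actl_linear. Qed.

Lemma env_mul_targetr (b : B) Z : env_mul Z (1 ⊗ val b) = env_inner b Z.
Proof.
move: Z; apply: tensor_ext; first exact: (env_mul_bilin _).1.
  exact: env_inner_linear.
by move=> x x'; rewrite env_mulE mulr1 env_innerE.
Qed.

Lemma valesD : madd (val : C -> A ⊗ A). Proof. exact: raddfD. Qed.

Lemma val_es_inner b X : val (es_inner b X) = env_inner b (val X).
Proof. exact: env_mul_targetr. Qed.

Definition mull_leg (a : A) : A ⊗ A -> A ⊗ A := tmap id (fun x => a * x).
Lemma mull_leg_linear a : linear (mull_leg a).
Proof. by apply: tmap_linear; [apply: lin_id|apply: lin_mull]. Qed.
Lemma mull_legE a x x' : mull_leg a (x ⊗ x') = x ⊗ (a * x').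
Proof. by rewrite /mull_leg tmapE //; apply: lin_mull. Qed.
Lemma mull_leg_linearl Z : linear (fun a => mull_leg a Z).
Proof.
apply: (@tlift_param K A A A _ (fun c x x' => x ⊗ (c * x'))) => x x'.
by apply: tpurer_comp; apply: lin_mulr.
Qed.
Lemma mull_legM a a' Z : mull_leg a (mull_leg a' Z) = mull_leg (a * a') Z.
Proof.
rewrite /mull_leg tmap_comp; try exact: lin_mull; try exact: lin_id.
by congr (tmap _ _ _); apply/funext=> x; rewrite mulrA.
Qed.
Lemma mull_leg1 Z : mull_leg 1 Z = Z.
Proof.
rewrite -{2}[Z]tmap_id /mull_leg; congr (tmap _ _ _); apply/funext=> x; exact: mul1r.
Qed.

Lemma env_inner_action : is_action env_inner.
Proof.
split=> [Z|b c Z|b|Z].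
- exact: mull_leg1.
- by rewrite [LHS]mull_legM.
- exact: lin_add (env_inner_linear b).
- by move=> b c; apply: (lin_add (mull_leg_linearl Z)).
Qed.

Lemma es_inner_action : is_action es_inner.
Proof.
have [a1 aM aD aDl] := env_inner_action.
split=> [X|b c X|b X Y|X b c]; apply: val_inj; rewrite ?valesD !val_es_inner //.
- by rewrite (valesD X Y) aD.
- exact: aDl.
Qed.

Definition cod_inner (b : B) : T -> T := tmap (env_inner b) id.

Lemma cod_inner_linear b : linear (cod_inner b).
Proof. by apply: tmap_linear; [apply: env_inner_linear|apply: lin_id]. Qed.

Lemma cod_innerE b Z h : cod_inner b (Z ⊗ h) = env_inner b Z ⊗ h.
Proof. by rewrite /cod_inner tmapE //; apply: env_inner_linear. Qed.

Lemma cod_inner_action : is_action cod_inner.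
Proof.
have [a1 aM aD aDl] := env_inner_action.
split=> [t|b c t|b|t].
- rewrite -{2}[t]tmap_id /cod_inner; congr (tmap _ _ _); exact/funext.
- rewrite /cod_inner tmap_comp; try exact: env_inner_linear; try exact: lin_id.
  by congr (tmap _ _ _); apply/funext=> Z; apply: aM.
- exact: lin_add (cod_inner_linear b).
- move=> b c; move: t; apply: tensor_ext_add.
  + exact: lin_add (cod_inner_linear _).
  + by move=> t u; rewrite !(lin_add (cod_inner_linear _)) addrACA.
  + by move=> Z h; rewrite !cod_innerE aDl tpureDl.
Qed.

(** As B acts on the second leg only, A ⊗_B (A ⊗ A) is A ⊗ (A ⊗_B A) with the legs permuted; the map
    is the canonical map with the first leg x carried along: a ⊗ (x ⊗ x') |-> x ⊗ can(a ⊗ x'). *)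
Definition inner_can : AB env_inner -> T' := blift (fun a Z => tmap id (can_at a) Z).

Lemma inner_can_bal : balanced actr env_inner (fun a Z => tmap id (can_at a) Z).
Proof.
have l a : linear (tmap id (can_at a) : A ⊗ A -> T').
  by apply: tmap_linear; [apply: lin_id|apply: (can_at_bilin.2 a)].
apply: balancedI=> [Z a a'|a|a b Z].
- move: Z; apply: tensor_ext_add; first exact: lin_add.
    by move=> t u; rewrite !(lin_add (l _)) addrACA.
  move=> x x'; rewrite !tmapE; try exact: lin_id; try exact: (can_at_bilin.2).
  by rewrite (lin_add (can_at_bilin.1 _)) tpureDr.
- exact: lin_add.
- rewrite /env_inner tmap_comp; try exact: lin_id; try exact: (can_at_bilin.2); try exact: actl_linear.
  by congr (tmap _ _ _); apply/funext=> x; apply: can_at_bal.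
Qed.

Lemma inner_canE a Z : inner_can (bpure actr env_inner a Z) = tmap id (can_at a) Z.
Proof. exact: (bliftE inner_can_bal). Qed.

Lemma inner_canEp a x x' : inner_can (bpure actr env_inner a (x ⊗ x')) = x ⊗ can_at a x'.
Proof. by rewrite inner_canE tmapE //; apply: can_at_bilin.2. Qed.

Lemma inner_canD : madd inner_can.
Proof. exact: (bliftD inner_can_bal). Qed.

Definition inner_cani : T' -> AB env_inner := galois_lift (fun x u v => bpure actr env_inner u (x ⊗ v)).

Lemma inner_cani_tri : galois_tri (fun x u v => bpure actr env_inner u (x ⊗ v)).
Proof.
have Z := bpure_bal.
split=> [u c x y|x|k x u c].
- by rewrite tpureDl bpure_addr.
- apply: balancedI => [c|u|u b c].
  + exact: bpure_addl.
  + exact: madd_comp (bpure_addr _ _ _) (tpureDr _).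
  + by rewrite bpure_bal env_innerE.
(* The scalar changes sides as the coinvariant k·1, the only way to move it across ⊗_B. *)
- have kB : k%:A \in coinv_pred dA.
    apply/coinv_predP; rewrite (linZ delta_linear) [RHS]tpureZl; congr (_ *: _).
    by have [_ -> _] := coact_alg dA.
  have := bpure_bal actr env_inner u (Coinv kB) (x ⊗ c).
  rewrite env_innerE /Defs.actr /= -scalerAr mulr1 -scalerAl mul1r => ->.
  by rewrite tpureZl tpureZr.
Qed.

Lemma inner_canK : cancel inner_can inner_cani.
Proof.
apply: (btens_ext (f := inner_cani \o inner_can) (g := id)) => [||a Z] //=.
  exact: madd_comp (galois_liftD inner_cani_tri) inner_canD.
move: Z; apply: (tensor_ext_add (f := fun Z => inner_cani (inner_can (bpure actr env_inner a Z)))).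
- exact: madd_comp (madd_comp (galois_liftD inner_cani_tri) inner_canD) (bpure_addr _ _ _).
- exact: bpure_addr.
- by move=> x x'; rewrite inner_canEp /inner_cani (galois_liftE inner_cani_tri).
Qed.

Lemma inner_caniK : cancel inner_cani inner_can.
Proof.
apply: (galois_ext (f := inner_can \o inner_cani) (g := id)) => [||x u c] //=.
  exact: madd_comp inner_canD (galois_liftD inner_cani_tri).
by rewrite /inner_cani (galois_liftE inner_cani_tri) inner_canEp.
Qed.

(** The Galois map of A ⊗ A with its codiagonal coaction, a ⊗ Z |-> a Z_(0) ⊗ Z_(1) with a
    multiplying the second leg from the left ([codiag_canE]). Bijectivity is visible from the
    factorisation: the canonical map on the second leg, then the untwisting of the first. *)
Definition codiag_can (w : AB env_inner) : T := coact_left dA (inner_can w).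
Definition codiag_cani (t : T) : AB env_inner := inner_cani (coact_left_inv dA t).

Lemma codiag_canK : cancel codiag_can codiag_cani.
Proof. by move=> w; rewrite /codiag_cani coact_leftK inner_canK. Qed.
Lemma codiag_caniK : cancel codiag_cani codiag_can.
Proof. by move=> w; rewrite /codiag_can inner_caniK coact_left_invK. Qed.
Lemma codiag_canD : madd codiag_can.
Proof. exact: madd_comp (lin_add (coact_left_linear _)) inner_canD. Qed.
Lemma codiag_caniD : madd codiag_cani.
Proof. exact: madd_comp (galois_liftD inner_cani_tri) (lin_add (coact_left_inv_linear _)). Qed.

Definition cod_mull (a : A) : T -> T := tmap (mull_leg a) id.
Lemma cod_mull_linear a : linear (cod_mull a).
Proof. by apply: tmap_linear; [apply: mull_leg_linear|apply: lin_id]. Qed.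
Lemma cod_mullE a Z h : cod_mull a (Z ⊗ h) = mull_leg a Z ⊗ h.
Proof. by rewrite /cod_mull tmapE //; apply: mull_leg_linear. Qed.

Lemma codiag_canE a Z : codiag_can (bpure actr env_inner a Z) = cod_mull a (codiag dA Z).
Proof.
move: Z; apply: (tensor_ext_add (f := fun Z => codiag_can (bpure actr env_inner a Z))).
- exact: madd_comp codiag_canD (bpure_addr _ _ _).
- exact: lin_add (linear_comp (cod_mull_linear a) (codiag_linear dA)).
move=> x x'; rewrite /codiag_can inner_canEp coact_leftE codiagE /can_at.
move: (delta x) (delta x') => u v.
have l2 : linear (tmap (fun x => a * x) id : A ⊗ H -> A ⊗ H).
  by apply: tmap_linear; [apply: lin_mull|apply: lin_id].
move: u; apply: (@tensor_ext K A H _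
   (fun u => codiag_pair u (tmap (fun x => a * x) id v)) (fun u => cod_mull a (codiag_pair u v))).
- exact: (codiag_pair_bilin _ _).1.
- exact: (linear_comp (cod_mull_linear a) ((codiag_pair_bilin _ _).1 _)).
move=> y h; move: v; apply: (@tensor_ext K A H _
   (fun v => codiag_pair _ (tmap (fun x => a * x) id v)) (fun v => cod_mull a (codiag_pair _ v))).
- exact: (linear_comp ((codiag_pair_bilin _ _).2 _) l2).
- exact: (linear_comp (cod_mull_linear a) ((codiag_pair_bilin _ _).2 _)).
move=> y' h'; rewrite tmapE ?codiag_pairE ?cod_mullE ?mull_legE //; exact: lin_mull.
Qed.

(** Read off from the balancing of ⊗_B: [codiag_can] takes the same value on 1·b ⊗ Z and on 1 ⊗
    bZ. *)
Lemma codiag_env_inner b Z : codiag dA (env_inner b Z) = cod_inner b (codiag dA Z).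
Proof.
have l1 t : cod_mull 1 t = t.
  rewrite -{2}[t]tmap_id /cod_mull; congr (tmap _ _ _); apply/funext; exact: mull_leg1.
rewrite -[LHS]l1 -codiag_canE -bpure_bal codiag_canE; congr (cod_mull _ _); exact: mul1r.
Qed.

End Galois.

(** * The bialgebroid along its inner action *)

Section InnerFlatness.
Variables (K : fieldType) (H : algType K) (hH : hopf_algebra H) (A : algType K).
Variable dA : comodule_algebra hH A.
Local Notation C := (es dA).
Local Notation delta := (coact dA).
Local Notation Delta := (hcop hH).
Local Notation T := ((A ⊗ A) ⊗ H)%type.
Local Notation AB act := (btens (@actr _ _ _ _ dA) act).
Local Notation actr := (@actr _ _ _ _ dA).
Local Notation env_inner := (@env_inner _ _ _ _ dA).
Local Notation cod_inner := (@cod_inner _ _ _ _ dA).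
Local Notation es_inner := (@es_inner _ _ _ _ dA).

Definition codiag_cop : T -> T ⊗ H :=
  tlift (fun Z h => tlift (fun h1 h2 => (Z ⊗ h1) ⊗ h2) (Delta h)).

Let cB (M : lmodType K) (Z : M) : bilin (fun h1 h2 : H => (Z ⊗ h1) ⊗ h2).
Proof. by split=> h; [apply: tpurel_comp; apply: tpurer|apply: tpurer]. Qed.

Let cB2 (M : lmodType K) :
  bilin (fun (Z : M) h => tlift (fun h1 h2 => (Z ⊗ h1) ⊗ h2) (Delta h)).
Proof.
split=> [h|Z].
- apply: (@tlift_param K M H H _ (fun Z h1 h2 => (Z ⊗ h1) ⊗ h2)) => h1 h2.
  by apply: tpurel_comp; apply: tpurel.
- exact: (linear_comp (tlift_linear (cB Z)) (hcop_linear hH)).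
Qed.

Lemma codiag_cop_linear : linear codiag_cop. Proof. exact: tlift_linear (@cB2 _). Qed.

Lemma codiag_copE Z h : codiag_cop (Z ⊗ h) = tlift (fun h1 h2 => (Z ⊗ h1) ⊗ h2) (Delta h).
Proof. exact: (tliftE (@cB2 _)). Qed.

Definition coact_cop : A ⊗ H -> (A ⊗ H) ⊗ H :=
  tlift (fun Z h => tlift (fun h1 h2 => (Z ⊗ h1) ⊗ h2) (Delta h)).

Lemma coact_cop_linear : linear coact_cop. Proof. exact: tlift_linear (@cB2 _). Qed.

Lemma coact_cop_delta x : tmap delta id (delta x) = coact_cop (delta x).
Proof.
rewrite /coact_cop -(@coact_sweedler _ _ _ _ dA _ (fun z g k => (z ⊗ g) ⊗ k)).
  apply: eq_tlift => y k; move: (delta y).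
  have B1 : bilin (fun (z : A) (g : H) => (z ⊗ g) ⊗ k).
    by split=> h; [apply: tpurel_comp; apply: tpurel|apply: tpurel_comp; apply: tpurer].
  apply: (@tensor_ext K A H _ (fun t => t ⊗ k)); [exact: tpurel|exact: tlift_linear|].
  by move=> z g; rewrite tliftE.
by split=> *; [apply: tpurel_comp; apply: tpurel|apply: tpurel_comp; apply: tpurer|apply: tpurer].
Qed.

(** Both sides are products, for the multiplication [M], of the corresponding expressions in δ(x)
    and δ(x'); on the right-hand side this uses that the coproduct of H is multiplicative.
    Coassociativity of δ then settles each factor. *)
Lemma codiag_coassoc Z : tmap (codiag dA) id (codiag dA Z) = codiag_cop (codiag dA Z).
Proof.
have cl := codiag_linear dA.
have pB := codiag_pair_bilin H A.
have tcl : linear (tmap (codiag dA) id : T -> T ⊗ H) by apply: tmap_linear.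
have tdl : linear (tmap delta id : A ⊗ H -> (A ⊗ H) ⊗ H).
  by apply: tmap_linear; [apply: delta_linear|apply: lin_id].
pose M := tmul2 (@codiag_pair K H A) (fun h k : H => h * k).
have MB : bilin M := tmul2_bilin pB (mul_bilin H).
have ME u h v k : M (u ⊗ h) (v ⊗ k) = codiag_pair u v ⊗ (h * k).
  by rewrite /M (tmul2E pB (mul_bilin H)).
move: Z; apply: (@tensor_ext K A A _ (tmap (codiag dA) id \o codiag dA) (codiag_cop \o codiag dA)).
- exact: linear_comp tcl cl.
- exact: linear_comp codiag_cop_linear cl.
move=> x x' /=; rewrite codiagE.
have E1 u v : tmap (codiag dA) id (codiag_pair u v) = M (tmap delta id u) (tmap delta id v).
  move: u; apply: (@tensor_ext K A H _ (fun u => tmap (codiag dA) id (codiag_pair u v))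
    (fun u => M (tmap delta id u) (tmap delta id v))).
  - exact: (linear_comp tcl (pB.1 _)).
  - exact: (linear_comp (MB.1 _) tdl).
  move=> y h; move: v; apply: (@tensor_ext K A H _
    (fun v => tmap (codiag dA) id (codiag_pair _ v)) (fun v => M _ (tmap delta id v))).
  - exact: (linear_comp tcl (pB.2 _)).
  - exact: (linear_comp (MB.2 _) tdl).
  move=> y' h'; rewrite codiag_pairE !tmapE ?ME ?codiagE //; exact: delta_linear.
have E2 u v : codiag_cop (codiag_pair u v) = M (coact_cop u) (coact_cop v).
  move: u; apply: (@tensor_ext K A H _ (fun u => codiag_cop (codiag_pair u v))
    (fun u => M (coact_cop u) (coact_cop v))).
  - exact: (linear_comp codiag_cop_linear (pB.1 _)).
  - exact: (linear_comp (MB.1 _) coact_cop_linear).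
  move=> y h; move: v; apply: (@tensor_ext K A H _
    (fun v => codiag_cop (codiag_pair _ v)) (fun v => M _ (coact_cop v))).
  - exact: (linear_comp codiag_cop_linear (pB.2 _)).
  - exact: (linear_comp (MB.2 _) coact_cop_linear).
  move=> y' h'; rewrite codiag_pairE codiag_copE /coact_cop !(tliftE (@cB2 _)).
  have [_ _ ->] := hcop_alg hH.
  move: (Delta h) (Delta h') => m n.
  have HB := tmul2_bilin (mul_bilin H) (mul_bilin H).
  move: m; apply: (@tensor_ext K H H _
    (fun m => tlift (fun h1 h2 => ((y ⊗ y') ⊗ h1) ⊗ h2) (talg_mul m n))
    (fun m => M (tlift (fun h1 h2 => (y ⊗ h1) ⊗ h2) m) (tlift (fun h1 h2 => (y' ⊗ h1) ⊗ h2) n))).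
  - exact: (linear_comp (tlift_linear (cB _)) (HB.1 _)).
  - exact: (linear_comp (MB.1 _) (tlift_linear (cB _))).
  move=> g k; move: n; apply: (@tensor_ext K H H _
    (fun n => tlift (fun h1 h2 => ((y ⊗ y') ⊗ h1) ⊗ h2) (talg_mul _ n))
    (fun n => M _ (tlift (fun h1 h2 => (y' ⊗ h1) ⊗ h2) n))).
  - exact: (linear_comp (tlift_linear (cB _)) (HB.2 _)).
  - exact: (linear_comp (MB.2 _) (tlift_linear (cB _))).
  move=> g' k'; rewrite /talg_mul (tmul2E (mul_bilin H) (mul_bilin H)).
  by rewrite !(tliftE (cB _)) ME codiag_pairE.
by rewrite E1 E2 !coact_cop_delta.
Qed.

(** Presents C as the kernel of a map that is linear for the inner and for the outer action of B, so
    that flatness can be applied to it. *)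
Definition es_defect (Z : A ⊗ A) : T := codiag dA Z - Z ⊗ 1.

Lemma es_defectD : madd es_defect.
Proof.
move=> x y; rewrite /es_defect (lin_add (codiag_linear dA)) (tpureDl (1 : H)).
by rewrite opprD addrACA.
Qed.

Lemma es_exact : exact_seq (val : C -> A ⊗ A) es_defect.
Proof.
move=> Z; split=> [/eqP|[X <-]].
  by rewrite subr_eq0 => /eqP /es_predP ZC; exists (ES ZC).
by apply/eqP; rewrite subr_eq0; apply/eqP/es_predP/valP.
Qed.

Lemma val_lhom : lhom es_inner env_inner (val : C -> A ⊗ A).
Proof. by split=> [|b X]; [apply: valesD|apply: val_es_inner]. Qed.

Variable cani : A ⊗ H -> AtensBA dA.
Hypothesis canK : cancel (@canonical_map _ _ _ _ dA) cani.
Hypothesis caniK : cancel cani (@canonical_map _ _ _ _ dA).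
Hypothesis ff : faithfully_flat dA.

Local Notation codiag_can := (@codiag_can _ _ _ _ dA).
Local Notation codiag_cani := (codiag_cani cani).

Lemma codiag_lhom : lhom env_inner cod_inner (codiag dA).
Proof. by split=> [|b Z]; [apply/lin_add/codiag_linear|apply: codiag_env_inner]. Qed.

Lemma tpure_lhom (h : H) : lhom env_inner cod_inner (fun Z : A ⊗ A => Z ⊗ h).
Proof. by split=> [|b Z]; [apply: tpureDl|rewrite cod_innerE]. Qed.

Lemma es_defect_lhom : lhom env_inner cod_inner es_defect.
Proof.
split=> [|b Z]; first exact: es_defectD.
by rewrite /es_defect codiag_lhom.2 -cod_innerE -(maddB (lin_add (cod_inner_linear b))).
Qed.

(* a ⊗ (x ⊗ x') |-> x ⊗ ax'. *)
Definition inner_eval : AB es_inner -> A ⊗ A := blift (fun a (X : C) => mull_leg a (val X)).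

Lemma inner_eval_bal : balanced actr es_inner (fun a (X : C) => mull_leg a (val X)).
Proof.
apply: balancedI => [X|a X Y|a b X].
- exact: lin_add (mull_leg_linearl _).
- by rewrite valesD (lin_add (mull_leg_linear a)).
- by rewrite val_es_inner [RHS]mull_legM.
Qed.

Lemma inner_evalE a X : inner_eval (bpure actr es_inner a X) = mull_leg a (val X).
Proof. exact: (bliftE inner_eval_bal). Qed.

Lemma inner_evalD : madd inner_eval. Proof. exact: (bliftD inner_eval_bal). Qed.

Local Notation iota := (bmap id (val : C -> A ⊗ A) : AB es_inner -> AB env_inner).

Let iotaD : madd iota := bmapD (rhom_id actr) val_lhom.

(** Coinvariance of X makes the H-leg trivial. Hence [inner_eval] is the Galois map of A ⊗ A
    restricted along the inclusion of C, and its injectivity follows because A ⊗_B - keeps that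
    inclusion injective. *)
Lemma codiag_can_iota y : codiag_can (iota y) = inner_eval y ⊗ 1.
Proof.
move: y; apply: (btens_ext (f := codiag_can \o iota) (g := fun y => inner_eval y ⊗ 1)).
- exact: madd_comp (@codiag_canD _ _ _ _ _) iotaD.
- exact: madd_comp (tpureDl _) inner_evalD.
move=> a X; rewrite /= (bmapE (rhom_id actr) val_lhom) codiag_canE inner_evalE.
by rewrite (elimT (es_predP _ _) (valP X)) cod_mullE.
Qed.

Lemma iota_inj : injective iota.
Proof.
apply: (ff_injective ff (@es_inner_action _ _ _ _ dA) (@env_inner_action _ _ _ _ dA) val_lhom).2.
exact: val_inj.
Qed.

Lemma inner_eval_inj : injective inner_eval.
Proof.
apply: madd_inj inner_evalD _ => y y0; apply: iota_inj; apply: (can_inj (codiag_canK canK caniK)).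
by rewrite codiag_can_iota y0 (madd0 iotaD) (madd0 (@codiag_canD _ _ _ _ _)) (madd0 (tpureDl _)).
Qed.

(** The inverse of [codiag_can] tensored with H, the extra H-leg being pulled inside A ⊗_B -. *)
Definition cod_transport : T ⊗ H -> AB cod_inner :=
  tlift (fun t h => bmap id (fun Z : A ⊗ A => Z ⊗ h) (codiag_cani t)).

Let bD h : madd (bmap id (fun Z : A ⊗ A => Z ⊗ h) : AB env_inner -> AB cod_inner) :=
  bmapD (rhom_id actr) (tpure_lhom h).
Let bE h a Z : bmap id (fun Z : A ⊗ A => Z ⊗ h) (bpure actr env_inner a Z) = bpure actr cod_inner a (Z ⊗ h)
  := bmapE (rhom_id actr) (tpure_lhom h) a Z.

Lemma cod_transport_bal : balanced (fun (t : T) (k : K) => k *: t) (fun k (h : H) => k *: h)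
  (fun t h => bmap id (fun Z : A ⊗ A => Z ⊗ h) (codiag_cani t) : AB cod_inner).
Proof.
apply: balancedI => [h|t|t k h].
- exact: madd_comp (bD h) (codiag_caniD canK caniK).
- move=> h h'; move: (codiag_cani t); apply: btens_ext => [|x y|a Z].
  + exact: bD.
  + by rewrite !bD addrACA.
  + by rewrite !bE tpureDr bpure_addr.
- rewrite -[in LHS](codiag_caniK canK caniK t); move: (codiag_cani t).
  have sD : madd (fun x : AB env_inner => codiag_cani (k *: codiag_can x)).
    by move=> x y; rewrite codiag_canD scalerDr (codiag_caniD canK caniK).
  apply: (btens_ext (f := fun x => bmap id (fun Z : A ⊗ A => Z ⊗ h) (codiag_cani (k *: codiag_can x)))
     (g := fun x => bmap id (fun Z : A ⊗ A => Z ⊗ (k *: h)) x)).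
  + exact: madd_comp (bD h) sD.
  + exact: bD.
  move=> a Z; have -> : k *: codiag_can (bpure actr env_inner a Z) = codiag_can (bpure actr env_inner a (k *: Z)).
    by rewrite !codiag_canE (linZ (codiag_linear _)) (linZ (cod_mull_linear _)).
  by rewrite (codiag_canK canK caniK) !bE tpureZl tpureZr.
Qed.

Lemma cod_transportE t h : cod_transport (t ⊗ h) = bmap id (fun Z : A ⊗ A => Z ⊗ h) (codiag_cani t).
Proof. exact: (bliftE cod_transport_bal). Qed.

Lemma cod_transportD : madd cod_transport. Proof. exact: (bliftD cod_transport_bal). Qed.

(* Under codiag_can the codiagonal coaction becomes the coproduct of H. *)
Lemma codiag_cod_transport w : bmap id (codiag dA) w = cod_transport (codiag_cop (codiag_can w)).
Proof.
move: w; apply: (btens_ext (f := bmap id (codiag dA)) (g := cod_transport \o codiag_cop \o codiag_can)).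
- exact: (bmapD (rhom_id actr) codiag_lhom).
- exact: madd_comp (madd_comp cod_transportD (lin_add codiag_cop_linear)) (@codiag_canD _ _ _ _ _).
move=> a Z; rewrite /= (bmapE (rhom_id actr) codiag_lhom) codiag_canE.
have -> t : codiag_cop (cod_mull a t) = tmap (cod_mull a) id (codiag_cop t).
  have tl : linear (tmap (cod_mull a) id : T ⊗ H -> T ⊗ H).
    by apply: tmap_linear; [apply: cod_mull_linear|apply: lin_id].
  move: t; apply: (@tensor_ext K _ H _ (codiag_cop \o cod_mull a) (tmap (cod_mull a) id \o codiag_cop)).
  - exact: linear_comp codiag_cop_linear (cod_mull_linear a).
  - exact: linear_comp tl codiag_cop_linear.
  move=> Z' h /=; rewrite cod_mullE !codiag_copE (tlift_comp (cB _) tl); apply: eq_tlift => g k.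
  by rewrite tmapE ?cod_mullE //; apply: cod_mull_linear.
rewrite -codiag_coassoc; move: (codiag dA Z) => t.
rewrite tmap_comp; try exact: cod_mull_linear; try exact: codiag_linear; try exact: lin_id.
have ll : linear (fun Z => cod_mull a (codiag dA Z)) := linear_comp (cod_mull_linear a) (codiag_linear dA).
move: t; apply: (tensor_ext_add (f := bpure actr cod_inner a) (g := fun t => cod_transport (tmap _ _ t))).
- exact: bpure_addr.
- by apply: madd_comp cod_transportD _; apply: tmapD.
move=> Z' h; rewrite tmapE // cod_transportE -codiag_canE (codiag_canK canK caniK) bE //.
Qed.

(** The candidate is the preimage w of z ⊗ 1 under the Galois map of A ⊗ A. Flatness keeps C -> A ⊗
    A -> (A ⊗ A) ⊗ H exact, so w comes from A ⊗_B C as soon as the defect of coinvariance kills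
    it. *)
Lemma inner_eval_surj z : exists y, inner_eval y = z.
Proof.
pose w := codiag_cani (z ⊗ 1).
have /(_ w)[E _] := ((ff_exact ff (@es_inner_action _ _ _ _ dA)
  (@env_inner_action _ _ _ _ dA) (@cod_inner_action _ _ _ _ dA) val_lhom es_defect_lhom).1 es_exact).
have [|y yw] := E.
  have -> : bmap id es_defect w =
      bmap id (codiag dA) w - bmap id (fun Z : A ⊗ A => Z ⊗ (1 : H)) w :> AB cod_inner.
    move: w {E}; apply: btens_ext => [|t u|a Z].
    - exact: (bmapD (rhom_id actr) es_defect_lhom).
    - by rewrite (bmapD (rhom_id actr) codiag_lhom) bD opprD addrACA.
    rewrite (bmapE (rhom_id actr) es_defect_lhom) (bmapE (rhom_id actr) codiag_lhom) bE.
    by rewrite -(maddB (bpure_addr _ _ _)).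
  (* On the side of (A ⊗ A) ⊗ H the coaction is the coproduct of H, and Δ(1) = 1 ⊗ 1 makes z ⊗ 1
     coinvariant. *)
  rewrite codiag_cod_transport /w (codiag_caniK canK caniK) codiag_copE.
  have [_ -> _] := hcop_alg hH.
  by rewrite (tliftE (cB _)) cod_transportE subrr.
exists y; have := codiag_can_iota y; rewrite yw /w (codiag_caniK canK caniK).
(* The equation reached is [inner_eval] y ⊗ 1 = z ⊗ 1; the counit of H, with ε(1) = 1, removes the
   last leg. *)
have eB : bilin (fun (Z : A ⊗ A) (h : H) => hcou hH h *: Z).
  split=> [h|a] k u v; first by rewrite scalerDr !scalerA mulrC.
  by rewrite (hcou_lin hH) scalerDl scalerA.
move/(congr1 (tlift (fun Z h => hcou hH h *: Z))); rewrite !(tliftE eB).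
by have [-> _] := hcou_mul hH; rewrite !scale1r.
Qed.

End InnerFlatness.

(** * Tensoring C ⊗_B N with A along the inner action *)

Section Flatness.
Variables (K : fieldType) (H : algType K) (hH : hopf_algebra H) (A : algType K).
Variable dA : comodule_algebra hH A.
Local Notation B := (coinv dA).
Local Notation C := (es dA).
Local Notation AB act := (btens (@actr _ _ _ _ dA) act).
Local Notation CB la := (btens (@es_actr _ _ _ _ dA) la).
Local Notation actr := (@actr _ _ _ _ dA).
Local Notation actl := (@actl _ _ _ _ dA).
Local Notation es_actr := (@es_actr _ _ _ _ dA).
Local Notation es_inner := (@es_inner _ _ _ _ dA).

Lemma env_mul_targetl (b : A) Z : env_mul (1 ⊗ b) Z = mulr_leg b Z.
Proof.
move: Z; apply: tensor_ext; first exact: (env_mul_bilin _).2.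
  exact: mulr_leg_linear.
by move=> x x'; rewrite env_mulE mul1r mulr_legE.
Qed.

Lemma val_es_actr (X : C) b : val (es_actr X b) = mulr_leg (val b) (val X).
Proof. exact: env_mul_targetl. Qed.

Lemma mulr_leg_mull_leg a c (Z : A ⊗ A) : mulr_leg c (mull_leg a Z) = mull_leg a (mulr_leg c Z).
Proof.
rewrite /mulr_leg /mull_leg !tmap_comp; try exact: lin_mull; try exact: lin_mulr; try exact: lin_id.
by congr (tmap _ _ _); apply/funext=> x; rewrite mulrA.
Qed.

Lemma es_actrD b : madd (es_actr^~ b).
Proof.
move=> X Y; apply: val_inj; rewrite val_es_actr !valesD !val_es_actr.
exact: (lin_add (mulr_leg_linear _)).
Qed.

Lemma es_actr_es_inner b c X : es_actr (es_inner b X) c = es_inner b (es_actr X c).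
Proof. by apply: val_inj; rewrite val_es_actr !val_es_inner val_es_actr; apply: mulr_leg_mull_leg. Qed.

Lemma es_inner_rhom b : rhom es_actr es_actr (es_inner b).
Proof.
by split=> [|X c]; [have [_ _ + _] := es_inner_action dA; apply|rewrite es_actr_es_inner].
Qed.

Lemma es_actr_lhom b : lhom es_inner es_inner (es_actr^~ b).
Proof. by split=> [|c X]; [apply: es_actrD|rewrite es_actr_es_inner]. Qed.

(** N is tensored with A over K and with C over B; the last condition says that both see the same
    scalars, which is what makes the comparison maps below balanced over K. *)
Definition kaction (N : lmodType K) (la : B -> N -> N) : Prop :=
  [/\ is_action la, forall b, linear (la b) & forall k n, la k%:A n = k *: n].

Lemma actl_kaction : kaction actl.
Proof.
split=> [|b|k n]; last 2 first.
- exact: actl_linear.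
- by rewrite /Defs.actl /= -scalerAl mul1r.
split=> [n|b c n|b|n].
- exact: mul1r.
- by rewrite /Defs.actl mulrA.
- exact/lin_add/actl_linear.
- by move=> b c; rewrite /Defs.actl /= mulrDl.
Qed.

Definition tens_inner (N : zmodType) (la : B -> N -> N) b : CB la -> CB la := bmap (es_inner b) id.
Definition leg_act (N : lmodType K) (la : B -> N -> N) b : A ⊗ N -> A ⊗ N := tmap id (la b).

Section OneModule.
Variables (N : lmodType K) (la : B -> N -> N) (laK : kaction la).
Local Notation tens_inner := (@tens_inner N la).
Local Notation leg_act := (@leg_act N la).

Lemma tens_innerE b X n : tens_inner b (bpure es_actr la X n) = bpure es_actr la (es_inner b X) n.
Proof. exact: (bmapE (es_inner_rhom b) (lhom_id la)). Qed.

Lemma tens_innerD b : madd (tens_inner b).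
Proof. exact: (bmapD (es_inner_rhom b) (lhom_id la)). Qed.

Lemma tens_inner_action : is_action tens_inner.
Proof.
have [c1 cM cD cDl] := es_inner_action dA.
split=> [|b c|b|].
- by apply: btens_ext => [||X n] //; [apply: tens_innerD|rewrite tens_innerE c1].
- apply: (btens_ext (f := fun m => tens_inner b (tens_inner c m))).
  + by move=> x y; rewrite !tens_innerD.
  + exact: tens_innerD.
  + by move=> X n; rewrite !tens_innerE cM.
- exact: tens_innerD.
- move=> m b c; move: m; apply: btens_ext => [|x y|X n].
  + exact: tens_innerD.
  + by rewrite !tens_innerD addrACA.
  + by rewrite !tens_innerE cDl bpure_addl.
Qed.

Lemma leg_actE b x n : leg_act b (x ⊗ n) = x ⊗ la b n.
Proof. have [_ l _] := laK; exact: (tmapE (@lin_id _ _) (l b)). Qed.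

Lemma leg_act_linear b : linear (leg_act b).
Proof. by have [_ l _] := laK; apply: tmap_linear. Qed.

Lemma leg_act_action : is_action leg_act.
Proof.
have [[l1 lM lD lDl] ll _] := laK.
have D b := lin_add (leg_act_linear b).
split=> [|b c|b|].
- by apply: (tensor_ext_add (g := id)) => // x n; rewrite leg_actE l1.
- apply: (tensor_ext_add (f := fun m => leg_act b (leg_act c m))).
  + by move=> x y; rewrite !D.
  + exact: D.
  + by move=> x n; rewrite !leg_actE lM.
- exact: D.
- move=> m b c; move: m; apply: tensor_ext_add => [|x y|x n].
  + exact: D.
  + by rewrite !D addrACA.
  + by rewrite !leg_actE lDl tpureDr.
Qed.

Lemma tens_inner_ext (G : zmodType) (f g : AB tens_inner -> G) : madd f -> madd g ->
  (forall a X n, f (bpure actr tens_inner a (bpure es_actr la X n))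
               = g (bpure actr tens_inner a (bpure es_actr la X n))) -> f =1 g.
Proof.
move=> fD gD fg; apply: btens_ext => // a.
apply: (btens_ext (f := fun m => f (bpure actr tens_inner a m))
  (g := fun m => g (bpure actr tens_inner a m))) => //.
- exact: madd_comp fD (bpure_addr _ _ _).
- exact: madd_comp gD (bpure_addr _ _ _).
Qed.

Lemma leg_act_ext (G : zmodType) (f g : AB leg_act -> G) : madd f -> madd g ->
  (forall a x n, f (bpure actr leg_act a (x ⊗ n)) = g (bpure actr leg_act a (x ⊗ n))) -> f =1 g.
Proof.
move=> fD gD fg; apply: btens_ext => // a.
apply: (tensor_ext_add (f := fun m => f (bpure actr leg_act a m))
  (g := fun m => g (bpure actr leg_act a m))) => //.
- exact: madd_comp fD (bpure_addr _ _ _).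
- exact: madd_comp gD (bpure_addr _ _ _).
Qed.

Definition flip_at (n : N) : A ⊗ A -> AB leg_act :=
  tlift (fun x a => bpure actr leg_act a (x ⊗ n)).

Lemma flip_at_bal n : balanced (fun (x : A) (k : K) => k *: x) (fun k (a : A) => k *: a)
  (fun x a => bpure actr leg_act a (x ⊗ n)).
Proof.
have [_ _ lK] := laK; apply: balancedI => [a x y|x a b|x k a].
- by rewrite tpureDl bpure_addr.
- by rewrite bpure_addl.
- have -> : k *: a = actr a k%:A by rewrite /Defs.actr /= -scalerAr mulr1.
  by rewrite bpure_bal leg_actE lK tpureZl tpureZr.
Qed.

Lemma flip_atD n : madd (flip_at n). Proof. exact: (bliftD (flip_at_bal n)). Qed.
Lemma flip_atE n x a : flip_at n (x ⊗ a) = bpure actr leg_act a (x ⊗ n).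
Proof. exact: (bliftE (flip_at_bal n)). Qed.

Lemma flip_atDn Z : madd (fun n => flip_at n Z).
Proof.
move=> n n'; move: Z; apply: tensor_ext_add => [|x y|x a].
- exact: flip_atD.
- by rewrite !flip_atD addrACA.
- by rewrite !flip_atE tpureDr bpure_addr.
Qed.

(** The factor b ends up at the right of the A-leg and crosses ⊗_B to act on n. This is the
    balancing condition that lets the flip descend to C ⊗_B N. *)
Lemma flip_at_mulr_leg n (b : B) Z : flip_at n (mulr_leg (val b) Z) = flip_at (la b n) Z.
Proof.
move: Z; apply: (tensor_ext_add (f := fun Z => flip_at n (mulr_leg (val b) Z))).
- exact: madd_comp (flip_atD n) (lin_add (mulr_leg_linear _)).
- exact: flip_atD.
- by move=> x a; rewrite mulr_legE !flip_atE -leg_actE -bpure_bal.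
Qed.

Definition outer_flip_at (a : A) : CB la -> AB leg_act :=
  blift (fun X n => flip_at n (mull_leg a (val X))).

Lemma outer_flip_at_bal a : balanced es_actr la (fun X n => flip_at n (mull_leg a (val X))).
Proof.
apply: balancedI => [n X Y|X|X b n].
- by rewrite valesD (lin_add (mull_leg_linear a)) flip_atD.
- exact: flip_atDn.
- by rewrite val_es_actr -mulr_leg_mull_leg flip_at_mulr_leg.
Qed.

Lemma outer_flip_atE a X n : outer_flip_at a (bpure es_actr la X n) = flip_at n (mull_leg a (val X)).
Proof. exact: (bliftE (outer_flip_at_bal a)). Qed.
Lemma outer_flip_atD a : madd (outer_flip_at a). Proof. exact: (bliftD (outer_flip_at_bal a)). Qed.

(* a ⊗ ((x ⊗ x') ⊗ n) |-> ax' ⊗ (x ⊗ n). *)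
Definition outer_flip : AB tens_inner -> AB leg_act := blift outer_flip_at.

Lemma outer_flip_bal : balanced actr tens_inner outer_flip_at.
Proof.
apply: balancedI => [m a a'|a|a b m].
- move: m; apply: btens_ext => [|x y|X n]; first exact: outer_flip_atD.
    by rewrite !outer_flip_atD addrACA.
  by rewrite !outer_flip_atE (lin_add (mull_leg_linearl _)) flip_atD.
- exact: outer_flip_atD.
- move: m; apply: (btens_ext (g := fun m => outer_flip_at a (tens_inner b m))).
  + exact: outer_flip_atD.
  + exact: madd_comp (outer_flip_atD a) (tens_innerD b).
  + by move=> X n; rewrite tens_innerE !outer_flip_atE val_es_inner [in RHS]mull_legM.
Qed.

Lemma outer_flipD : madd outer_flip. Proof. exact: (bliftD outer_flip_bal). Qed.
Lemma outer_flipE a X n : outer_flip (bpure actr tens_inner a (bpure es_actr la X n)) = flip_at n (mull_leg a (val X)).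
Proof. by rewrite /outer_flip (bliftE outer_flip_bal) outer_flip_atE. Qed.

Lemma bpure_lhom n : lhom es_inner tens_inner (fun X => bpure es_actr la X n).
Proof. by split=> [|b X]; [apply: bpure_addl|rewrite tens_innerE]. Qed.

Definition tens_at (n : N) : AB es_inner -> AB tens_inner := bmap id (fun X => bpure es_actr la X n).
Lemma tens_atD n : madd (tens_at n). Proof. exact: (bmapD (rhom_id actr) (bpure_lhom n)). Qed.
Lemma tens_atE n a X :
  tens_at n (bpure actr es_inner a X) = bpure actr tens_inner a (bpure es_actr la X n).
Proof. exact: (bmapE (rhom_id actr) (bpure_lhom n)). Qed.

Lemma tens_atDn y : madd (fun n => tens_at n y).
Proof.
move=> n n'; move: y; apply: btens_ext => [|x y|a X].
- exact: tens_atD.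
- by rewrite !tens_atD addrACA.
- by rewrite !tens_atE !bpure_addr.
Qed.

Lemma outer_flip_tens_at n y : outer_flip (tens_at n y) = flip_at n (inner_eval y).
Proof.
move: y; apply: (btens_ext (f := outer_flip \o tens_at n) (g := flip_at n \o @inner_eval _ _ _ _ dA)).
- exact: madd_comp outer_flipD (tens_atD n).
- exact: madd_comp (flip_atD n) (@inner_evalD _ _ _ _ _).
- by move=> a X; rewrite /= tens_atE outer_flipE inner_evalE.
Qed.

Variable inner_evali : A ⊗ A -> AB es_inner.
Hypothesis inner_evalK : cancel (@inner_eval _ _ _ _ dA) inner_evali.
Hypothesis inner_evaliK : cancel inner_evali (@inner_eval _ _ _ _ dA).

Lemma inner_evaliD : madd inner_evali.
Proof. by move=> x y; apply: (can_inj inner_evalK); rewrite inner_evalD !inner_evaliK. Qed.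

(** Left multiplication by a and right multiplication by b on the second leg commute, so
    [inner_eval] respects the right action of B; its inverse inherits this. *)
Lemma inner_evali_mulr_leg (b : B) Z : inner_evali (mulr_leg (val b) Z) = bmap id (es_actr^~ b) (inner_evali Z).
Proof.
apply: (can_inj inner_evalK); rewrite inner_evaliK -{1}[Z]inner_evaliK; move: (inner_evali Z).
have mD := bmapD (rhom_id actr) (es_actr_lhom b).
apply: (btens_ext (f := mulr_leg (val b) \o @inner_eval _ _ _ _ dA)
  (g := @inner_eval _ _ _ _ dA \o bmap id (es_actr^~ b))).
- exact: madd_comp (lin_add (mulr_leg_linear _)) (@inner_evalD _ _ _ _ _).
- exact: madd_comp (@inner_evalD _ _ _ _ _) mD.
- by move=> a X; rewrite /= (bmapE (rhom_id actr) (es_actr_lhom b)) !inner_evalE val_es_actr mulr_leg_mull_leg.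
Qed.

Lemma tens_at_inner_evali_mulr_leg (b : B) n Z : tens_at n (inner_evali (mulr_leg (val b) Z)) = tens_at (la b n) (inner_evali Z).
Proof.
rewrite inner_evali_mulr_leg; move: (inner_evali Z).
have mD := bmapD (rhom_id actr) (es_actr_lhom b).
apply: (btens_ext (f := tens_at n \o bmap id (es_actr^~ b))).
- exact: madd_comp (tens_atD n) mD.
- exact: tens_atD.
- by move=> a X; rewrite /= (bmapE (rhom_id actr) (es_actr_lhom b)) !tens_atE bpure_bal.
Qed.

Definition outer_unflip_at (a : A) : A ⊗ N -> AB tens_inner := tlift (fun x n => tens_at n (inner_evali (x ⊗ a))).

Lemma outer_unflip_at_bal a : balanced (fun (x : A) (k : K) => k *: x) (fun k (n : N) => k *: n)
  (fun x n => tens_at n (inner_evali (x ⊗ a))).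
Proof.
have [_ _ lK] := laK; apply: balancedI => [n x y|x|x k n].
- by rewrite tpureDl inner_evaliD tens_atD.
- exact: tens_atDn.
- rewrite -lK -tens_at_inner_evali_mulr_leg mulr_legE tpureZl -tpureZr; congr (tens_at n (inner_evali (x ⊗ _))).
  by rewrite /= -scalerAr mulr1.
Qed.

Lemma outer_unflip_atD a : madd (outer_unflip_at a). Proof. exact: (bliftD (outer_unflip_at_bal a)). Qed.
Lemma outer_unflip_atE a x n : outer_unflip_at a (x ⊗ n) = tens_at n (inner_evali (x ⊗ a)).
Proof. exact: (bliftE (outer_unflip_at_bal a)). Qed.

(** Inverse of [outer_flip]: for a ⊗ (x ⊗ n), the element x ⊗ a of A ⊗ A is decomposed through A ⊗_B
    C ≅ A ⊗ A into a sum of a_i ⊗ X_i, and the result is the sum of a_i ⊗ (X_i ⊗ n). *)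
Definition outer_unflip : AB leg_act -> AB tens_inner := blift outer_unflip_at.

Lemma outer_unflip_bal : balanced actr leg_act outer_unflip_at.
Proof.
apply: balancedI => [m a a'|a|a b m].
- move: m; apply: tensor_ext_add => [|x y|x n]; first exact: outer_unflip_atD.
    by rewrite !outer_unflip_atD addrACA.
  by rewrite !outer_unflip_atE tpureDr inner_evaliD tens_atD.
- exact: outer_unflip_atD.
- move: m; apply: (tensor_ext_add (g := fun m => outer_unflip_at a (leg_act b m))).
  + exact: outer_unflip_atD.
  + exact: madd_comp (outer_unflip_atD a) (lin_add (leg_act_linear b)).
  + by move=> x n; rewrite leg_actE !outer_unflip_atE -tens_at_inner_evali_mulr_leg mulr_legE.
Qed.

Lemma outer_unflipD : madd outer_unflip. Proof. exact: (bliftD outer_unflip_bal). Qed.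
Lemma outer_unflipE a x n : outer_unflip (bpure actr leg_act a (x ⊗ n)) = tens_at n (inner_evali (x ⊗ a)).
Proof. by rewrite /outer_unflip (bliftE outer_unflip_bal) outer_unflip_atE. Qed.

Lemma outer_unflip_flip_at n Z : outer_unflip (flip_at n Z) = tens_at n (inner_evali Z).
Proof.
move: Z; apply: (tensor_ext_add (f := outer_unflip \o flip_at n) (g := tens_at n \o inner_evali)).
- exact: madd_comp outer_unflipD (flip_atD n).
- exact: madd_comp (tens_atD n) inner_evaliD.
- by move=> x a; rewrite /= flip_atE outer_unflipE.
Qed.

Lemma outer_flipK : cancel outer_flip outer_unflip.
Proof.
apply: (tens_inner_ext (f := outer_unflip \o outer_flip) (g := id)) => //= [|a X n].
  exact: madd_comp outer_unflipD outer_flipD.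
by rewrite outer_flipE outer_unflip_flip_at -inner_evalE inner_evalK tens_atE.
Qed.

Lemma outer_unflipK : cancel outer_unflip outer_flip.
Proof.
apply: (leg_act_ext (f := outer_flip \o outer_unflip) (g := id)) => //= [|a x n].
  exact: madd_comp outer_flipD outer_unflipD.
by rewrite outer_unflipE outer_flip_tens_at inner_evaliK flip_atE.
Qed.

End OneModule.
End Flatness.

Lemma tassoc_inj (K : fieldType) (M N P : lmodType K) : injective (@tassoc K M N P).
Proof.
have fT : trilin (fun (m : M) (n : N) (p : P) => (m ⊗ n) ⊗ p).
  by split=> *; [apply: tpurel_comp; apply: tpurel|apply: tpurel_comp; apply: tpurer|apply: tpurer].
apply: (can_inj (g := tlift (fun m t => tlift (fun n p => (m ⊗ n) ⊗ p) t))) => t.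
rewrite (tlift_tassoc fT).
have B1 p : bilin (fun (m : M) (n : N) => (m ⊗ n) ⊗ p).
  by split=> *; apply: tpurel_comp; [apply: tpurel|apply: tpurer].
have E (s : M ⊗ N) p : tlift (fun (m : M) (n : N) => (m ⊗ n) ⊗ p) s = s ⊗ p.
  move: s; apply: (@tensor_ext K M N _ _ (fun s => s ⊗ p)); last by move=> *; rewrite tliftE.
    exact: tlift_linear.
  exact: tpurel.
under eq_tlift do rewrite E.
exact: (@tmap_id K).
Qed.

(** * Flatness of the bialgebroid and C ⊗_B A ≅ A ⊗ A *)

Section Span.
Variables (K : fieldType) (H : algType K) (hH : hopf_algebra H) (A : algType K).
Variable dA : comodule_algebra hH A.
Local Notation B := (coinv dA).
Local Notation C := (es dA).
Local Notation AB act := (btens (@actr _ _ _ _ dA) act).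
Local Notation CB la := (btens (@es_actr _ _ _ _ dA) la).
Local Notation actr := (@actr _ _ _ _ dA).
Local Notation actl := (@actl _ _ _ _ dA).
Local Notation es_actr := (@es_actr _ _ _ _ dA).
Local Notation env_inner := (@env_inner _ _ _ _ dA).
Local Notation es_inner := (@es_inner _ _ _ _ dA).
Local Notation codiag_can := (@codiag_can _ _ _ _ dA).
Local Notation inner_can := (@inner_can _ _ _ _ dA).
Local Notation tens_inner la := (@tens_inner _ _ _ _ dA _ la).
Local Notation leg_act la := (@leg_act _ _ _ _ dA _ la).
Local Notation inner_eval := (@inner_eval _ _ _ _ dA).

(* X ⊗ c |-> X·c, where (x ⊗ x')·c = x ⊗ x'c. *)
Definition es_span : CB actl -> A ⊗ A := blift (fun (X : C) c => mulr_leg c (val X)).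

Lemma es_span_bal : balanced es_actr actl (fun (X : C) c => mulr_leg c (val X)).
Proof.
apply: balancedI => [c X Y|X|X b c].
- by rewrite valesD (lin_add (mulr_leg_linear c)).
- exact: lin_add (mulr_leg_linearl _).
- by rewrite val_es_actr mulr_legM.
Qed.

Lemma es_spanD : madd es_span. Proof. exact: (bliftD es_span_bal). Qed.
Lemma es_spanE X c : es_span (bpure es_actr actl X c) = mulr_leg c (val X).
Proof. exact: (bliftE es_span_bal). Qed.

Lemma es_span_lhom : lhom (tens_inner actl) env_inner es_span.
Proof.
split=> [|b]; first exact: es_spanD.
apply: (btens_ext (f := fun m => es_span (tens_inner actl b m)) (g := fun m => env_inner b (es_span m))).
- exact: madd_comp es_spanD (@tens_innerD K H hH A dA A actl b).
- exact: madd_comp (lin_add (env_inner_linear b)) es_spanD.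
- by move=> X c; rewrite tens_innerE !es_spanE val_es_inner [LHS]mulr_leg_mull_leg.
Qed.

Lemma cod_mull_mulr_coact a x x' c : cod_mull a (mulr_coact dA (x ⊗ x') c) = mulr_coact dA (x ⊗ (a * x')) c.
Proof.
rewrite /cod_mull /mulr_coact tmap_comp; try exact: mulr_leg_linearl; try exact: lin_id; try exact: mull_leg_linear.
by congr (tmap _ _ _); apply/funext=> y; rewrite !mulr_legE mull_legE mulrA.
Qed.

Let AtD : madd (bmap id es_span : AB (tens_inner actl) -> AB env_inner) :=
  bmapD (rhom_id actr) es_span_lhom.

(** The comparison square behind [es_span_bij]: both ways send a ⊗ ((x ⊗ x') ⊗ c) to x ⊗ can(ax' ⊗
    c). It typechecks because [leg_act] for the action on A is convertible to [env_inner]. All maps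
    other than id ⊗ [es_span] are bijective, hence so is that one. *)
Lemma codiag_can_es_span (y : AB (tens_inner actl)) :
  tassoc (codiag_can (bmap id es_span y)) = inner_can (outer_flip y).
Proof.
move: y; apply: (tens_inner_ext (f := fun y => tassoc (codiag_can (bmap id es_span y)))
  (g := fun y => inner_can (outer_flip y))).
- exact: madd_comp (lin_add (@tassoc_linear _ _ _ _)) (madd_comp (@codiag_canD _ _ _ _ _) AtD).
- exact: madd_comp (@inner_canD _ _ _ _ _) (outer_flipD (actl_kaction dA)).
move=> a X c; rewrite (bmapE (rhom_id actr) es_span_lhom) es_spanE codiag_canE codiag_mulr_leg.
rewrite (outer_flipE (actl_kaction dA)); move: (val X).
have flD := flip_atD (actl_kaction dA) c.
apply: (tensor_ext_add (f := fun Z => tassoc (cod_mull a (mulr_coact dA Z c)))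
  (g := fun Z => inner_can (flip_at _ c (mull_leg a Z)))).
- apply: lin_add; apply: (linear_comp (@tassoc_linear _ _ _ _)).
  exact: (linear_comp (cod_mull_linear a) ((mulr_coact_bilin dA).1 c)).
- exact: madd_comp (@inner_canD _ _ _ _ _) (madd_comp flD (lin_add (mull_leg_linear a))).
- move=> x x'; rewrite cod_mull_mulr_coact tassoc_mulr_coact mull_legE (flip_atE (actl_kaction dA)).
  by rewrite inner_canEp.
Qed.

Variable cani : A ⊗ H -> AtensBA dA.
Hypothesis canK : cancel (@canonical_map _ _ _ _ dA) cani.
Hypothesis caniK : cancel cani (@canonical_map _ _ _ _ dA).
Variable inner_evali : A ⊗ A -> AB es_inner.
Hypothesis inner_evalK : cancel inner_eval inner_evali.
Hypothesis inner_evaliK : cancel inner_evali inner_eval.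
Hypothesis ff : faithfully_flat dA.

(** The square shows bijectivity after A ⊗_B -, and faithful flatness reflects injectivity and
    surjectivity separately. *)
Lemma es_span_bij : bijective es_span.
Proof.
have lK := actl_kaction dA.
have inj : injective es_span.
  pose iH := ff_injective ff (@tens_inner_action K H hH A dA A actl) (@env_inner_action _ _ _ _ dA) es_span_lhom.
  apply: iH.1.
  move=> y y' E; apply: (can_inj (outer_flipK lK inner_evalK inner_evaliK)); apply: (can_inj (inner_canK canK caniK)).
  by rewrite -!codiag_can_es_span E.
have surj : forall z, exists y, es_span y = z.
  apply: (ff_surjective ff (@tens_inner_action K H hH A dA A actl) (@env_inner_action _ _ _ _ dA) es_span_lhom).1.
  move=> w; exists (outer_unflip inner_evali (inner_cani cani (tassoc (codiag_can w)))).
  apply: (can_inj (codiag_canK canK caniK)); apply: tassoc_inj.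
  by rewrite codiag_can_es_span (outer_unflipK lK inner_evalK inner_evaliK) (inner_caniK canK caniK).
have [f fP] := choice surj; exists f => // y; exact: inj.
Qed.

Section Natural.
Variables (N N' : lmodType K) (la : B -> N -> N) (la' : B -> N' -> N').
Hypotheses (laK : kaction la) (laK' : kaction la').
Variable f : N -> N'.
Hypotheses (fl : linear f) (fH : lhom la la' f).

Lemma bmapC_lhom : lhom (tens_inner la) (tens_inner la') (bmap id f : CB la -> CB la').
Proof.
have mD := bmapD (rhom_id es_actr) fH; have mE := bmapE (rhom_id es_actr) fH.
split=> // b.
apply: (btens_ext (f := fun m => bmap id f (tens_inner la b m)) (g := fun m => tens_inner la' b (bmap id f m))).
- exact: madd_comp mD (@tens_innerD _ _ _ _ _ _ _ _).
- exact: madd_comp (@tens_innerD _ _ _ _ _ _ _ _) mD.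
- by move=> X c; rewrite tens_innerE !mE tens_innerE.
Qed.

Lemma tmap_lhom : lhom (leg_act la) (leg_act la') (tmap id f : A ⊗ N -> A ⊗ N').
Proof.
have tl : linear (tmap id f : A ⊗ N -> A ⊗ N') by apply: tmap_linear.
split=> [|b]; first exact: lin_add.
apply: (tensor_ext_add (f := fun m => tmap id f (leg_act la b m)) (g := fun m => leg_act la' b (tmap id f m))).
- exact: madd_comp (lin_add tl) (lin_add (leg_act_linear laK b)).
- exact: madd_comp (lin_add (leg_act_linear laK' b)) (lin_add tl).
- by move=> X c; rewrite (leg_actE laK) !tmapE // (leg_actE laK') fH.2.
Qed.

Lemma outer_flip_natural (y : AB (tens_inner la)) :
  outer_flip (bmap id (bmap id f) y : AB (tens_inner la')) = bmap id (tmap id f) (outer_flip y).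
Proof.
have mE := bmapE (rhom_id es_actr) fH.
have tH := tmap_lhom; have cH := bmapC_lhom.
move: y; apply: (tens_inner_ext (f := fun y => outer_flip (bmap id (bmap id f) y : AB (tens_inner la')))
   (g := fun y => bmap id (tmap id f) (outer_flip y))).
- exact: madd_comp (outer_flipD laK') (bmapD (rhom_id actr) cH).
- exact: madd_comp (bmapD (rhom_id actr) tH) (outer_flipD laK).
move=> a X n; rewrite (bmapE (rhom_id actr) cH) mE (outer_flipE laK) (outer_flipE laK').
move: (mull_leg a _); apply: (tensor_ext_add (g := fun Z => bmap id (tmap id f) (flip_at la n Z))).
- exact: (flip_atD laK').
- exact: madd_comp (bmapD (rhom_id actr) tH) (flip_atD laK n).
move=> x x'; rewrite !flip_atE // (bmapE (rhom_id actr) tH) tmapE //.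
Qed.
End Natural.

(** Faithful flatness acts in both directions. A ⊗ - is exact over the field, and A ⊗_B - preserves
    the resulting exactness for the modules A ⊗ N_i; the natural isomorphism [outer_flip] carries it
    to A ⊗_B (C ⊗_B N_i), from where it is reflected to C ⊗_B N_i. *)
Lemma es_flat (N1 N2 N3 : lmodType K) (l1 : B -> N1 -> N1) (l2 : B -> N2 -> N2)
    (l3 : B -> N3 -> N3) (f : N1 -> N2) (g : N2 -> N3) :
  kaction l1 -> kaction l2 -> kaction l3 -> linear f -> linear g ->
  lhom l1 l2 f -> lhom l2 l3 g -> exact_seq f g ->
  exact_seq (bmap id f : CB l1 -> CB l2) (bmap id g : CB l2 -> CB l3).
Proof.
move=> k1 k2 k3 fl gl fH gH fg.
have tfg : exact_seq (tmap id f : A ⊗ N1 -> A ⊗ N2) (tmap id g).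
  move=> y; split=> [|[x <-]].
    by apply: tensor_exact => // z gz; apply/fg.
  have z2 (n : N1) : g (f n) = 0 by apply/fg; exists n.
  rewrite tmap_comp //; move: x; apply: tensor_ext.
  - apply: tmap_linear => //; exact: (linear_comp gl fl).
  - by move=> k u v; rewrite scaler0 addr0.
  - move=> a n; rewrite tmapE //; last exact: (linear_comp gl fl).
    by rewrite z2 (lin0 (tpurer _)).
have Efg := (ff_exact ff (leg_act_action k1) (leg_act_action k2) (leg_act_action k3)
  (tmap_lhom k1 k2 fl fH) (tmap_lhom k2 k3 gl gH)).1 tfg.
apply: (ff_exact ff (@tens_inner_action K H hH A dA _ _) (@tens_inner_action K H hH A dA _ _) (@tens_inner_action K H hH A dA _ _)
  (bmapC_lhom fH) (bmapC_lhom gH)).2.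
have phi0 := madd0 (outer_flipD k3).
move=> y; split=> [gy|[x <-]].
- have [|x xy] := (Efg (outer_flip y)).1.
    by rewrite -(outer_flip_natural k2 k3 gl gH) gy phi0.
  exists (outer_unflip inner_evali x); apply: (can_inj (outer_flipK k2 inner_evalK inner_evaliK)).
  by rewrite (outer_flip_natural k1 k2 fl fH) (outer_unflipK k1 inner_evalK inner_evaliK).
- apply: (can_inj (outer_flipK k3 inner_evalK inner_evaliK)); rewrite phi0.
  rewrite (outer_flip_natural k2 k3 gl gH); apply/Efg; exists (outer_flip x).
  by rewrite (outer_flip_natural k1 k2 fl fH).
Qed.
End Span.

(** * Existence of the coproduct *)

Section Coproduct.
Variables (K : fieldType) (H : algType K) (hH : hopf_algebra H) (A : algType K).
Variable dA : comodule_algebra hH A.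
Local Notation B := (coinv dA).
Local Notation C := (es dA).
Local Notation delta := (coact dA).
Local Notation T := ((A ⊗ A) ⊗ H)%type.
Local Notation AB act := (btens (@actr _ _ _ _ dA) act).
Local Notation CB la := (btens (@es_actr _ _ _ _ dA) la).
Local Notation actl := (@actl _ _ _ _ dA).
Local Notation es_actr := (@es_actr _ _ _ _ dA).
Local Notation es_actl := (@es_actl _ _ _ _ dA).
Local Notation env_actr := (@env_actr _ _ _ _ dA).
Local Notation env_actl := (@env_actl _ _ _ _ dA).
Local Notation es_span := (@es_span _ _ _ _ dA).
Local Notation inner_eval := (@inner_eval _ _ _ _ dA).
Local Notation es_inner := (@es_inner _ _ _ _ dA).

Lemma tmap_kaction (N P : lmodType K) (la : B -> N -> N) :
  kaction la -> kaction (fun b => tmap (la b) id : N ⊗ P -> N ⊗ P).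
Proof.
move=> [[l1 lM lD lDl] ll lK].
have tl b : linear (tmap (la b) id : N ⊗ P -> N ⊗ P) by apply: tmap_linear.
have tE b n p : tmap (la b) id (n ⊗ p) = la b n ⊗ p by rewrite tmapE.
have tD b := lin_add (tl b).
split=> // [|k t]; first split=> [t|b c t|//|t b c].
- move: t; apply: (tensor_ext_add (g := id)) => // n p; by rewrite tE l1.
- move: t; apply: (tensor_ext_add (f := fun t => tmap (la b) id (tmap (la c) id t))) => // [x y|n p].
    by rewrite !tD.
  by rewrite !tE lM.
- move: t; apply: tensor_ext_add => // [x y|n p]; first by rewrite !tD addrACA.
  by rewrite !tE lDl tpureDl.
- move: t; apply: tensor_ext_add => // [x y|n p]; first by rewrite scalerDr.
  by rewrite tE lK tpureZl.
Qed.

Lemma env_actlE b Z : env_actl b Z = tmap (actl b) id Z.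
Proof.
move: Z; apply: tensor_ext.
- exact: (env_mul_bilin A).2.
- by apply: tmap_linear; [apply: actl_linear|apply: lin_id].
- move=> x x'; rewrite /Defs.env_actl env_mulE mulr1 tmapE //; exact: actl_linear.
Qed.

Lemma env_actl_pure b x x' : env_actl b (x ⊗ x') = (val b * x) ⊗ x'.
Proof. by rewrite /Defs.env_actl env_mulE mulr1. Qed.

Lemma env_actl_kaction : kaction env_actl.
Proof.
have -> : env_actl = fun b => tmap (actl b) id.
  by apply/funext=> b; apply/funext=> Z; apply: env_actlE.
exact/tmap_kaction/actl_kaction.
Qed.

Lemma es_actl_kaction : kaction es_actl.
Proof.
have [[l1 lM lD lDl] ll lK] := env_actl_kaction.
split; first split.
- by move=> X; apply: val_inj; apply: l1.
- by move=> b c X; apply: val_inj; apply: lM.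
- by move=> b X Y; apply: val_inj; rewrite valesD -[RHS](lD b).
- by move=> X b c; apply: val_inj; rewrite valesD; apply: lDl.
- by move=> b k X Y; apply: val_inj; rewrite /= ; apply: ll.
- by move=> k X; apply: val_inj; apply: lK.
Qed.

Definition cod_outer (b : B) : T -> T := tmap (env_actl b) id.

Lemma cod_outer_kaction : kaction cod_outer.
Proof. exact/tmap_kaction/env_actl_kaction. Qed.

Lemma env_actl_linear b : linear (env_actl b).
Proof. by have [_ + _] := env_actl_kaction; apply. Qed.

Lemma cod_outerE b Z h : cod_outer b (Z ⊗ h) = env_actl b Z ⊗ h.
Proof. by rewrite /cod_outer tmapE //; apply: env_actl_linear. Qed.

Lemma cod_outer_linear b : linear (cod_outer b).
Proof. by have [_ + _] := cod_outer_kaction; apply. Qed.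

Lemma codiag_env_actl b Z : codiag dA (env_actl b Z) = cod_outer b (codiag dA Z).
Proof.
rewrite /Defs.env_actl codiag_mul (elimT (coinv_predP _ _) (valP b)) /=.
have [_ -> _] := coact_alg dA; rewrite sandwichE.
congr (tmap _ _ _); apply/funext=> h; by rewrite mul1r mulr1.
Qed.

Lemma codiag_outer_lhom : lhom env_actl cod_outer (codiag dA).
Proof. by split=> [|b Z]; [apply/lin_add/codiag_linear|apply: codiag_env_actl]. Qed.

Lemma es_defect_linear : linear (@es_defect _ _ _ _ dA).
Proof.
apply: linearI; first exact: es_defectD.
by move=> k Z; rewrite /es_defect (linZ (codiag_linear _)) tpureZl -scalerBr.
Qed.

Lemma tpure_outer_lhom (h : H) : lhom env_actl cod_outer (fun Z : A ⊗ A => Z ⊗ h).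
Proof. by split=> [|b Z]; [apply: tpureDl|rewrite cod_outerE]. Qed.

Lemma es_defect_outer_lhom : lhom env_actl cod_outer (@es_defect _ _ _ _ dA).
Proof.
split=> [|b Z]; first exact: es_defectD.
by rewrite /es_defect codiag_env_actl -cod_outerE -(maddB (lin_add (cod_outer_linear b))).
Qed.

Lemma val_outer_lhom : lhom es_actl env_actl (val : C -> A ⊗ A).
Proof. by split=> // ; apply: valesD. Qed.

Lemma val_linear : linear (val : C -> A ⊗ A).
Proof. by move=> k X Y; rewrite linearP. Qed.

Lemma tpure_actl_lhom (a' : A) : lhom actl env_actl (fun c => c ⊗ a').
Proof. by split=> [|b c]; [apply: tpureDl|rewrite env_actl_pure]. Qed.

Section Bmap.
Variables (N N' : zmodType) (la : B -> N -> N) (la' : B -> N' -> N').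

Lemma bmapCE (f : N -> N') (fH : lhom la la' f) X n :
  bmap id f (bpure es_actr la X n) = bpure es_actr la' X (f n).
Proof. exact: (bmapE (rhom_id _) fH). Qed.

Lemma bmapCD (f : N -> N') (fH : lhom la la' f) :
  madd (bmap id f : CB la -> CB la').
Proof. exact: (bmapD (rhom_id _) fH). Qed.

Lemma bmap_addf (f f1 f2 : N -> N') :
  lhom la la' f -> lhom la la' f1 -> lhom la la' f2 -> (forall n, f n = f1 n + f2 n) ->
  forall m : CB la, bmap id f m = bmap id f1 m + bmap id f2 m :> CB la'.
Proof.
move=> fH f1H f2H E; apply: btens_ext => [|x y|X n].
- exact: (bmapCD fH).
- by rewrite (bmapCD f1H) (bmapCD f2H) addrACA.
- by rewrite (bmapCE fH) (bmapCE f1H) (bmapCE f2H) E bpure_addr.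
Qed.
End Bmap.

Variable cani : A ⊗ H -> AtensBA dA.
Hypothesis canK : cancel (@canonical_map _ _ _ _ dA) cani.
Hypothesis caniK : cancel cani (@canonical_map _ _ _ _ dA).
Variable es_spani : A ⊗ A -> CB actl.
Hypothesis es_spanK : cancel es_span es_spani.
Hypothesis es_spaniK : cancel es_spani es_span.

Lemma es_spaniD : madd es_spani.
Proof. by move=> x y; apply: (can_inj es_spanK); rewrite es_spanD !es_spaniK. Qed.

Lemma es_spani_mulr_leg (X : C) c : es_spani (mulr_leg c (val X)) = bpure es_actr actl X c.
Proof. by rewrite -es_spanE es_spanK. Qed.

Lemma es_span_ext (G : zmodType) (f g : A ⊗ A -> G) : madd f -> madd g ->
  (forall X c, f (mulr_leg c (val X : A ⊗ A)) = g (mulr_leg c (val (X : C)))) -> f =1 g.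
Proof.
move=> fD gD fg z; rewrite -[z]es_spaniK; move: (es_spani z).
apply: (btens_ext (f := f \o es_span) (g := g \o es_span)).
- exact: madd_comp fD (@es_spanD _ _ _ _ _).
- exact: madd_comp gD (@es_spanD _ _ _ _ _).
- by move=> X c; rewrite /= es_spanE.
Qed.

Let tl a' := tpure_actl_lhom a'.

(* a ⊗ a' |-> a_(0) ⊗ τ(a_(1)) ⊗ a' with the first two legs taken in C. *)
Definition coproduct_lift : A ⊗ A -> CB env_actl :=
  tlift (fun a a' => bmap id (fun c : A => c ⊗ a') (es_spani (a ⊗ 1))).

Lemma bmap_es_spaniZ k a' z :
  bmap id (fun c : A => c ⊗ (k *: a')) (es_spani z)
  = bmap id (fun c : A => c ⊗ a') (es_spani (k *: z)) :> CB env_actl.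
Proof.
move: z; apply: (es_span_ext (f := fun z => bmap id (fun c : A => c ⊗ (k *: a')) (es_spani z))
  (g := fun z => bmap id (fun c : A => c ⊗ a') (es_spani (k *: z)))).
- exact: madd_comp (bmapCD (tl _)) es_spaniD.
- by move=> x y; rewrite scalerDr es_spaniD (bmapCD (tl _)).
move=> X c; rewrite -(linZ (mulr_leg_linearl _)) !es_spani_mulr_leg (bmapCE (tl _)) (bmapCE (tl a')).
by rewrite tpureZl tpureZr.
Qed.

Lemma coproduct_lift_bal : balanced (fun (a : A) (k : K) => k *: a) (fun k (a' : A) => k *: a')
  (fun a a' => bmap id (fun c : A => c ⊗ a') (es_spani (a ⊗ 1)) : CB env_actl).
Proof.
apply: balancedI => [a' x y|a x y|a k a'].
- by rewrite tpureDl es_spaniD (bmapCD (tl a')).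
- by apply: (bmap_addf (tl _) (tl _) (tl _)) => n; apply: tpureDr.
- by rewrite bmap_es_spaniZ tpureZl.
Qed.

Lemma coproduct_liftD : madd coproduct_lift. Proof. exact: (bliftD coproduct_lift_bal). Qed.
Lemma coproduct_liftE a a' : coproduct_lift (a ⊗ a') = bmap id (fun c : A => c ⊗ a') (es_spani (a ⊗ 1)).
Proof. exact: (bliftE coproduct_lift_bal). Qed.

Let pl h := tpure_outer_lhom h.

Lemma coproduct_liftZ k (h : H) Z : bmap id (fun Z' : A ⊗ A => Z' ⊗ (k *: h)) (coproduct_lift Z)
  = bmap id (fun Z' : A ⊗ A => Z' ⊗ h) (coproduct_lift (k *: Z)) :> CB cod_outer.
Proof.
move: Z; apply: (tensor_ext_add
  (f := fun Z => bmap id (fun Z' : A ⊗ A => Z' ⊗ (k *: h)) (coproduct_lift Z) : CB cod_outer)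
  (g := fun Z => bmap id (fun Z' : A ⊗ A => Z' ⊗ h) (coproduct_lift (k *: Z)))).
- exact: madd_comp (bmapCD (pl _)) coproduct_liftD.
- by move=> x y; rewrite scalerDr coproduct_liftD (bmapCD (pl _)).
move=> a a'; rewrite -tpureZr !coproduct_liftE; move: (es_spani _).
apply: (btens_ext
  (f := fun y => bmap id (fun Z' : A ⊗ A => Z' ⊗ (k *: h)) (bmap id (fun c : A => c ⊗ a') y : CB env_actl))
  (g := fun y => bmap id (fun Z' : A ⊗ A => Z' ⊗ h) (bmap id (fun c : A => c ⊗ (k *: a')) y : CB env_actl))).
- exact: madd_comp (bmapCD (pl _)) (bmapCD (tl _)).
- exact: madd_comp (bmapCD (pl _)) (bmapCD (tl _)).
move=> X c; rewrite (bmapCE (tl a')) (bmapCE (tl _)) (bmapCE (pl h)) (bmapCE (pl _)).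
by rewrite !tpureZr tpureZl.
Qed.

(** [coproduct_lift] tensored with H, with the H-leg pulled inside C ⊗_B -. *)
Definition coproduct_liftH : T -> CB cod_outer :=
  tlift (fun Z h => bmap id (fun Z' : A ⊗ A => Z' ⊗ h) (coproduct_lift Z)).

Lemma coproduct_liftH_bal : balanced (fun (Z : A ⊗ A) (k : K) => k *: Z) (fun k (h : H) => k *: h)
  (fun Z h => bmap id (fun Z' : A ⊗ A => Z' ⊗ h) (coproduct_lift Z) : CB cod_outer).
Proof.
apply: balancedI => [h x y|Z x y|Z k h].
- by rewrite coproduct_liftD (bmapCD (pl h)).
- by apply: (bmap_addf (pl _) (pl _) (pl _)) => n; apply: tpureDr.
- by rewrite coproduct_liftZ.
Qed.

Lemma coproduct_liftHD : madd coproduct_liftH. Proof. exact: (bliftD coproduct_liftH_bal). Qed.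
Lemma coproduct_liftHE Z h : coproduct_liftH (Z ⊗ h) = bmap id (fun Z' : A ⊗ A => Z' ⊗ h) (coproduct_lift Z).
Proof. exact: (bliftE coproduct_liftH_bal). Qed.

(** c |-> (c ⊗ v_(0)) ⊗ k v_(1). With [liftJ] it describes the coaction on c ⊗ a' while c is still
    hidden in a decomposition of z into terms X·c: the value of [liftJ] at X·c ⊗ k is X ⊗ [jmap] v k
    c. *)
Let jmap (v : A ⊗ H) (k : H) (c : A) : T := codiag_pair (c ⊗ k) v.

Let jH v k : lhom actl cod_outer (jmap v k).
Proof.
split=> [x y|b c]; first by rewrite /jmap tpureDl (lin_add ((codiag_pair_bilin _ _).1 v)).
rewrite /jmap; move: v; apply: (tensor_ext_add (f := codiag_pair _)
   (g := fun v => cod_outer b (codiag_pair _ v))).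
- exact: lin_add ((codiag_pair_bilin _ _).2 _).
- exact: lin_add (linear_comp (cod_outer_linear b) ((codiag_pair_bilin _ _).2 _)).
- by move=> y h; rewrite !codiag_pairE cod_outerE env_actl_pure.
Qed.

Let liftJ (v : A ⊗ H) : T -> CB cod_outer :=
  tlift (fun Z k => bmap id (jmap v k) (es_spani Z)).

Let liftJ_bal v : balanced (fun (Z : A ⊗ A) (k : K) => k *: Z) (fun k (h : H) => k *: h)
  (fun Z k => bmap id (jmap v k) (es_spani Z) : CB cod_outer).
Proof.
have vD := lin_add ((codiag_pair_bilin H A).1 v).
apply: balancedI => [h x y|Z x y|Z k h].
- by rewrite es_spaniD (bmapCD (jH _ _)).
- by apply: (bmap_addf (jH _ _) (jH _ _) (jH _ _)) => n; rewrite /jmap tpureDr vD.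
- move: Z; apply: (es_span_ext (f := fun Z => bmap id (jmap v h) (es_spani (k *: Z)) : CB cod_outer)
    (g := fun Z => bmap id (jmap v (k *: h)) (es_spani Z))).
  + by move=> x y; rewrite scalerDr es_spaniD (bmapCD (jH _ _)).
  + exact: madd_comp (bmapCD (jH _ _)) es_spaniD.
  move=> X c; rewrite -(linZ (mulr_leg_linearl _)) !es_spani_mulr_leg !bmapCE //.
  by rewrite /jmap tpureZl tpureZr.
Qed.

Let liftJD v : madd (liftJ v). Proof. exact: (bliftD (liftJ_bal v)). Qed.
Let liftJE v Z k : liftJ v (Z ⊗ k) = bmap id (jmap v k) (es_spani Z).
Proof. exact: (bliftE (liftJ_bal v)). Qed.

(** Colinearity: coacting on the right factor of C ⊗_B (A ⊗ A) amounts to coacting first on a ⊗ a'.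
    Coinvariant elements are therefore sent to the kernel of the defect in the right factor. *)
Lemma codiag_coproduct_lift Z : bmap id (codiag dA) (coproduct_lift Z) = coproduct_liftH (codiag dA Z).
Proof.
have cH := codiag_outer_lhom; have cB := codiag_pair_bilin H A.
have cD := lin_add (codiag_linear dA).
move: Z; apply: (tensor_ext_add (f := bmap id (codiag dA) \o coproduct_lift) (g := coproduct_liftH \o codiag dA)).
- exact: madd_comp (bmapCD cH) coproduct_liftD.
- exact: madd_comp coproduct_liftHD cD.
move=> a a' /=; rewrite coproduct_liftE.
have gH : lhom actl cod_outer (fun c => codiag dA (c ⊗ a')).
  split=> [x y|b c]; first by rewrite tpureDl cD.
  by rewrite -codiag_env_actl env_actl_pure.
have -> (y : CB actl) : bmap id (codiag dA) (bmap id (fun c : A => c ⊗ a') y : CB env_actl)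
    = bmap id (fun c : A => codiag dA (c ⊗ a')) y :> CB cod_outer.
  move: y; apply: (btens_ext (f := fun y => bmap id (codiag dA)
    (bmap id (fun c : A => c ⊗ a') y : CB env_actl))).
  - exact: madd_comp (bmapCD cH) (bmapCD (tl _)).
  - exact: bmapCD.
  - by move=> X c; rewrite (bmapCE (tl a')) (bmapCE cH) (bmapCE gH).
(* Stated for every z although only z = a ⊗ 1 is wanted: on the generators z = X·c both sides are X
   ⊗ codiag(c ⊗ a'). *)
have -> z : bmap id (fun c : A => codiag dA (c ⊗ a')) (es_spani z) = liftJ (delta a') (codiag dA z).
  move: z; apply: (es_span_ext (g := fun z => liftJ (delta a') (codiag dA z))).
  - exact: madd_comp (bmapCD gH) es_spaniD.
  - exact: madd_comp (liftJD _) cD.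
  move=> X c; rewrite es_spani_mulr_leg (bmapCE gH) codiag_mulr_leg codiagE /mulr_coact; move: (delta c).
  have rl := mulr_leg_linearl (val X).
  apply: (tensor_ext_add (f := fun u => bpure es_actr cod_outer X (codiag_pair u (delta a')))
    (g := fun u => liftJ (delta a') (tmap (fun c0 => mulr_leg c0 (val X)) id u))).
  - exact: madd_comp (bpure_addr _ _ _) (lin_add (cB.1 _)).
  - exact: madd_comp (liftJD _) (tmapD rl (@lin_id _ _)).
  - by move=> y h; rewrite tmapE // liftJE es_spani_mulr_leg (bmapCE (jH _ _)).
rewrite !codiagE; have [_ -> _] := coact_alg dA.
move: (delta a) (delta a') => u v.
move: u; apply: (tensor_ext_add (f := fun u => liftJ v (codiag_pair u (1 ⊗ 1)))
  (g := fun u => coproduct_liftH (codiag_pair u v))).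
- exact: madd_comp (liftJD _) (lin_add (cB.1 _)).
- exact: madd_comp coproduct_liftHD (lin_add (cB.1 _)).
move=> x h; rewrite codiag_pairE mulr1 liftJE.
move: v; apply: (tensor_ext_add (f := fun v => bmap id (jmap v h) (es_spani (x ⊗ 1)) : CB cod_outer)
  (g := fun v => coproduct_liftH (codiag_pair _ v))).
- move=> v v'; apply: (bmap_addf (jH _ _) (jH _ _) (jH _ _)) => n.
  exact: (lin_add (cB.2 _)).
- exact: madd_comp coproduct_liftHD (lin_add (cB.2 _)).
move=> y k; rewrite codiag_pairE coproduct_liftHE coproduct_liftE; move: (es_spani _).
apply: (btens_ext (g := fun m => bmap id (fun Z' : A ⊗ A => Z' ⊗ (h * k))
   (bmap id (fun c : A => c ⊗ y) m : CB env_actl))).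
- exact: (bmapCD (jH _ _)).
- exact: madd_comp (bmapCD (pl _)) (bmapCD (tl _)).
by move=> X c; rewrite (bmapCE (jH _ _)) (bmapCE (tl y)) (bmapCE (pl _)) /jmap codiag_pairE.
Qed.

Lemma es_defect_coproduct_lift (X : C) : bmap id (@es_defect _ _ _ _ dA) (coproduct_lift (val X)) = 0 :> CB cod_outer.
Proof.
have -> (w : CB env_actl) : bmap id (@es_defect _ _ _ _ dA) w =
    bmap id (codiag dA) w - bmap id (fun Z : A ⊗ A => Z ⊗ (1 : H)) w :> CB cod_outer.
  move: w; apply: btens_ext => [|t u|Y Z].
  - exact: bmapCD es_defect_outer_lhom.
  - by rewrite (bmapCD codiag_outer_lhom) (bmapCD (pl _)) opprD addrACA.
  rewrite (bmapCE es_defect_outer_lhom) (bmapCE codiag_outer_lhom) (bmapCE (pl _)).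
  by rewrite -(maddB (bpure_addr _ _ _)).
by rewrite codiag_coproduct_lift (elimT (es_predP _ _) (valP X)) coproduct_liftHE subrr.
Qed.

Lemma val_rhom : rhom es_actr env_actr (val : C -> A ⊗ A).
Proof. by split=> // ; apply: valesD. Qed.

Lemma env_actr_pure (x x' : A) b : env_actr (x ⊗ x') b = x ⊗ (x' * val b).
Proof. by rewrite /Defs.env_actr env_mul_targetl mulr_legE. Qed.

Lemma coproduct_tri (a' : A) :
  galois_tri dA (fun x u v => bpure env_actr env_actl (x ⊗ u) (v ⊗ a')).
Proof.
split=> [u c x y|x|k x u c].
- by rewrite tpureDl bpure_addl.
- apply: balancedI => [c u u'|u c c'|u b c].
  + by rewrite tpureDr bpure_addl.
  + by rewrite tpureDl bpure_addr.
  + by rewrite -env_actr_pure -env_actl_pure bpure_bal.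
- by rewrite tpureZl tpureZr.
Qed.

Lemma translationE h : translation dA h = cani (1 ⊗ h).
Proof.
rewrite /translation; case: xgetP => [t _ /= <-|/(_ (cani (1 ⊗ h))) []]; first by rewrite canK.
by rewrite /= caniK.
Qed.

(** The inverse of X ⊗ c |-> X·c at a ⊗ 1 is a_(0) ⊗ τ(a_(1)). To see it, let L send x ⊗ can(u ⊗ c)
    to (x ⊗ u) ⊗_B (c ⊗ a'). Composed with the codiagonal coaction, L sends X·c to X ⊗_B (c ⊗ a'),
    and a ⊗ 1 to the formula with the translation map. *)
Lemma incl_coproduct_lift Z : bmap (val : C -> A ⊗ A) id (coproduct_lift Z) = env_coproduct dA Z.
Proof.
have vD := bmapD val_rhom (lhom_id env_actl); have vE := bmapE val_rhom (lhom_id env_actl).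
suff E a a' : tlift (fun x h =>
    blift (fun u v => bpure env_actr env_actl (x ⊗ u) (v ⊗ a')) (translation dA h)) (delta a)
  = bmap (val : C -> A ⊗ A) id (coproduct_lift (a ⊗ a')) :> btens env_actr env_actl.
  rewrite /env_coproduct (eq_tlift _ E).
  have fB : balanced (fun (a : A) (k : K) => k *: a) (fun k (a' : A) => k *: a')
     (fun a a' => bmap (val : C -> A ⊗ A) id (coproduct_lift (a ⊗ a')) : btens env_actr env_actl).
    apply: balancedI => [n x y|m x y|m x n].
    - by rewrite tpureDl coproduct_liftD vD.
    - by rewrite tpureDr coproduct_liftD vD.
    - by rewrite tpureZl tpureZr.
  move: Z; apply: tensor_ext_add => [||x y].
  - exact: madd_comp vD coproduct_liftD.
  - exact: (bliftD fB).
  - exact: esym (bliftE fB x y).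
have fT := coproduct_tri a'; rewrite coproduct_liftE.
pose L := galois_lift cani (fun x u v => bpure env_actr env_actl (x ⊗ u) (v ⊗ a')).
have lD : madd L := galois_liftD canK caniK fT.
have -> z : bmap (val : C -> A ⊗ A) id (bmap id (fun c : A => c ⊗ a') (es_spani z) : CB env_actl)
    = L (tassoc (codiag dA z)).
  move: z; apply: (es_span_ext (f := fun z => bmap _ id (bmap id _ (es_spani z) : CB env_actl))
    (g := fun z => L (tassoc (codiag dA z)))).
  - exact: madd_comp vD (madd_comp (bmapCD (tl _)) es_spaniD).
  - exact: madd_comp lD (lin_add (linear_comp (@tassoc_linear _ _ _ _) (codiag_linear dA))).
  move=> X c; rewrite es_spani_mulr_leg (bmapCE (tl a')) vE codiag_mulr_leg; move: (val X).
  apply: (tensor_ext_add (f := fun Z => bpure env_actr env_actl Z (c ⊗ a'))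
    (g := fun Z => L (tassoc (mulr_coact dA Z c)))).
  - exact: bpure_addl.
  - exact: madd_comp lD (lin_add (linear_comp (@tassoc_linear _ _ _ _) ((mulr_coact_bilin dA).1 c))).
  - by move=> x u; rewrite tassoc_mulr_coact /L galois_liftE.
rewrite codiagE; have [_ -> _] := coact_alg dA.
have E x h : blift (fun u v => bpure env_actr env_actl (x ⊗ u) (v ⊗ a')) (translation dA h)
    = L (x ⊗ (1 ⊗ h)) by rewrite translationE /L galois_lift_pure.
rewrite (eq_tlift _ E).
have fB : balanced (fun (a : A) (k : K) => k *: a) (fun k (h : H) => k *: h)
   (fun x h => L (x ⊗ (1 ⊗ h))).
  apply: balancedI => [n x y|m x y|m x n].
  - by rewrite tpureDl lD.
  - by rewrite !tpureDr lD.
  - by rewrite tpureZl !tpureZr.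
move: (delta a); apply: (tensor_ext_add (g := fun u => L (tassoc (codiag_pair u (1 ⊗ 1))))).
- exact: (bliftD fB).
- exact: madd_comp lD (lin_add (linear_comp (@tassoc_linear _ _ _ _) ((codiag_pair_bilin H A).1 _))).
- by move=> x h; rewrite codiag_pairE mulr1 tassocE; apply: (bliftE fB).
Qed.

Variable inner_evali : A ⊗ A -> AB es_inner.
Hypothesis inner_evalK : cancel inner_eval inner_evali.
Hypothesis inner_evaliK : cancel inner_evali inner_eval.
Hypothesis ff : faithfully_flat dA.

(** The left factor is in C by construction of [coproduct_lift]. For the right factor, flatness of C
    on the right keeps C -> A ⊗ A -> (A ⊗ A) ⊗ H exact after C ⊗_B -, and the defect vanishes. In
    particular [es_coproduct] never takes its default value. *)
Lemma es_coproduct_exists (X : C) :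
  exists Z : CtensBC dA, CtensBC_incl Z = env_coproduct dA (val X).
Proof.
have E := es_flat inner_evalK inner_evaliK ff es_actl_kaction env_actl_kaction cod_outer_kaction
  val_linear es_defect_linear val_outer_lhom es_defect_outer_lhom (@es_exact _ _ _ _ dA).
have [Z ZE] := (E (coproduct_lift (val X))).1 (es_defect_coproduct_lift X).
exists Z; rewrite -incl_coproduct_lift -ZE.
move: Z {ZE}; apply: (btens_ext (f := @CtensBC_incl _ _ _ _ dA)
  (g := fun Z => bmap (val : C -> A ⊗ A) id (bmap id (val : C -> A ⊗ A) Z : CB env_actl))).
- exact: (bmapD val_rhom val_outer_lhom).
- exact: madd_comp (bmapD val_rhom (lhom_id env_actl)) (bmapCD val_outer_lhom).
move=> Y Y'; rewrite (bmapCE val_outer_lhom) (bmapE val_rhom (lhom_id env_actl)).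
exact: (bmapE val_rhom val_outer_lhom).
Qed.

End Coproduct.

(** * Gauge transformations and bisections *)

Section Bisections.
Variables (K : fieldType) (H : algType K) (hH : hopf_algebra H) (A : algType K).
Variable dA : comodule_algebra hH A.
Local Notation B := (coinv dA).
Local Notation C := (es dA).
Local Notation delta := (coact dA).
Local Notation T := ((A ⊗ A) ⊗ H)%type.
Local Notation CB la := (btens (@es_actr _ _ _ _ dA) la).
Local Notation actl := (@actl _ _ _ _ dA).
Local Notation es_actr := (@es_actr _ _ _ _ dA).
Local Notation es_actl := (@es_actl _ _ _ _ dA).
Local Notation env_actr := (@env_actr _ _ _ _ dA).
Local Notation env_actl := (@env_actl _ _ _ _ dA).
Local Notation es_span := (@es_span _ _ _ _ dA).
Local Notation gauge := (gauge dA).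
Local Notation bisection := (bisection dA).

Definition pair_eval (F G : A -> A) (Z : A ⊗ A) : A := env_prod (tmap F G Z).

Section PairEval.
Variables F G : A -> A.
Hypotheses (Fl : linear F) (Gl : linear G).

Lemma pair_eval_linear : linear (pair_eval F G).
Proof. exact: (linear_comp (tlift_linear (mul_bilin A)) (tmap_linear Fl Gl)). Qed.

Lemma pair_evalE x x' : pair_eval F G (x ⊗ x') = F x * G x'.
Proof. by rewrite /pair_eval tmapE // /env_prod (tliftE (mul_bilin A)). Qed.
End PairEval.

(* The junk value 0 is never taken when F and G are gauge transformations. *)
Definition pair_bis (F G : A -> A) (X : C) : B := insubd (0 : B) (pair_eval F G (val X)).

Lemma val_coinvD : madd (val : B -> A). Proof. exact: raddfD. Qed.

Lemma val_coinvM : {morph (val : B -> A) : x y / x * y}. Proof. exact: rmorphM. Qed.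

Lemma val_coinvZ k (b : B) : val (k *: b) = k *: (val b : A). Proof. exact: linearZ. Qed.

Lemma val_es_mul (X Y : C) : val (es_mul X Y) = env_mul (val X) (val Y).
Proof. by []. Qed.

Lemma val_es_source (b : B) : val (es_source b) = val b ⊗ 1.
Proof. by []. Qed.

Lemma val_es_target (b : B) : val (es_target b) = 1 ⊗ val b.
Proof. by []. Qed.

Lemma gauge_linear F : gauge F -> linear F. Proof. by case. Qed.
Lemma gaugeM F : gauge F -> {morph F : x y / x * y}. Proof. by case=> _ []. Qed.
Lemma gauge1 F : gauge F -> F 1 = 1. Proof. by case=> _ []. Qed.
Lemma gauge_coinv F (b : B) : gauge F -> F (val b) = val b. Proof. by case. Qed.

Lemma gauge_id : gauge id.
Proof. by split=> // a; rewrite tmap_id. Qed.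

Lemma gauge_comp F G : gauge F -> gauge G -> gauge (F \o G).
Proof.
move=> [Fl [F1 FM] Fd Fb] [Gl [G1 GM] Gd Gb]; split.
- exact: linear_comp.
- by split=> [|x y] /=; [rewrite G1 F1|rewrite GM FM].
- by move=> a; rewrite /= Fd Gd tmap_comp.
- by move=> b; rewrite /= Gb Fb.
Qed.

Section SigGauge.
Variables F G : A -> A.
Hypotheses (gF : gauge F) (gG : gauge G).

Let Fl := gauge_linear gF.
Let Gl := gauge_linear gG.

Lemma codiag_gauge Z : codiag dA (tmap F G Z) = tmap (tmap F G) id (codiag dA Z).
Proof.
have FGl : linear (tmap F G : A ⊗ A -> A ⊗ A) by apply: tmap_linear.
have tl : linear (tmap (tmap F G) id : T -> T) by apply: tmap_linear.
have pB := codiag_pair_bilin H A.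
have [_ _ Fd _] := gF; have [_ _ Gd _] := gG.
have F1l : linear (tmap F id : A ⊗ H -> A ⊗ H) by apply: tmap_linear.
have G1l : linear (tmap G id : A ⊗ H -> A ⊗ H) by apply: tmap_linear.
move: Z; apply: (@tensor_ext K A A _ (codiag dA \o tmap F G) (tmap (tmap F G) id \o codiag dA)).
- exact: linear_comp (codiag_linear dA) FGl.
- exact: linear_comp tl (codiag_linear dA).
move=> x x' /=; rewrite tmapE // !codiagE Fd Gd.
move: (delta x) (delta x') => u v.
move: u; apply: (@tensor_ext K A H _ (fun u => codiag_pair (tmap F id u) (tmap G id v))
  (fun u => tmap (tmap F G) id (codiag_pair u v))).
- exact: (linear_comp (pB.1 _) F1l).
- exact: (linear_comp tl (pB.1 _)).
move=> y h; move: v; apply: (@tensor_ext K A H _ (fun v => codiag_pair _ (tmap G id v))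
  (fun v => tmap (tmap F G) id (codiag_pair _ v))).
- exact: (linear_comp (pB.2 _) G1l).
- exact: (linear_comp tl (pB.2 _)).
by move=> y' h'; rewrite codiag_pairE !tmapE // codiag_pairE.
Qed.

(** F ⊗ G commutes with the codiagonal coaction, so it preserves C, and the product of the legs of
    an element of C lies in B. *)
Lemma val_pair_bis X : val (pair_bis F G X) = pair_eval F G (val X).
Proof.
rewrite /pair_bis insubdK //.
have XC : tmap F G (val X) \in es_pred dA.
  apply/es_predP; rewrite codiag_gauge (elimT (es_predP _ _) (valP X)) tmapE //.
  exact: tmap_linear.
exact: (es_counit_subproof (ES XC)).
Qed.

Lemma pair_bis_bisection : bisection (pair_bis F G).
Proof.
have el := pair_eval_linear Fl Gl; have eE := pair_evalE Fl Gl.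
split.
- move=> k X Y; apply: val_inj; rewrite val_coinvD val_coinvZ !val_pair_bis val_linear.
  exact: el.
- by apply: val_inj; rewrite val_pair_bis [LHS]eE (gauge_coinv 1 gF) (gauge_coinv 1 gG) -val_coinvM mulr1.
- move=> b b' X; apply: val_inj; rewrite !val_coinvM !val_pair_bis !val_es_mul val_es_source.
  rewrite val_es_target env_mulE !mulr1; move: (val X).
  apply: (@tensor_ext K A A _ (fun Z => pair_eval F G (env_mul _ Z))
    (fun Z => val b * pair_eval F G Z * val b')).
  + exact: (linear_comp el ((env_mul_bilin A).2 _)).
  + by apply: mulr_comp; apply: mull_comp.
  + move=> x x'; rewrite env_mulE !eE (gaugeM gF) (gaugeM gG) (gauge_coinv b gF) (gauge_coinv b' gG).
    by rewrite !mulrA.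
- move=> X Y; apply: val_inj; rewrite !val_pair_bis !val_es_mul val_es_source.
  move: (val X) => Z; move: Z; apply: (@tensor_ext K A A _
    (fun Z => pair_eval F G (env_mul Z _)) (fun Z => pair_eval F G (env_mul Z (val Y)))).
  + exact: (linear_comp el ((env_mul_bilin A).1 _)).
  + exact: (linear_comp el ((env_mul_bilin A).1 _)).
  (* The third axiom rests on F fixing the value of the bisection at Y, an element of B: both sides
     become F(x)F(y)G(y')G(x'). *)
  move=> x x'; rewrite env_mulE eE mul1r (gaugeM gF) (gauge_coinv _ gF) val_pair_bis.
  move: (val Y); apply: (@tensor_ext K A A _ (fun W => F x * pair_eval F G W * G x')
    (fun W => pair_eval F G (env_mul (x ⊗ x') W))).
  + by apply: mulr_comp; apply: mull_comp.
  + exact: (linear_comp el ((env_mul_bilin A).2 (x ⊗ x'))).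
  by move=> y y'; rewrite env_mulE !eE (gaugeM gF) (gaugeM gG) !mulrA.
Qed.
End SigGauge.

Lemma mulr_leg_env_mul (c : A) (X Y : A ⊗ A) : mulr_leg c (env_mul X Y) = env_mul (mulr_leg c X) Y.
Proof.
have rl := mulr_leg_linear c; have [el er] := env_mul_bilin A.
move: X; apply: (@tensor_ext K A A _ (fun X => mulr_leg c (env_mul X Y)) (fun X => env_mul (mulr_leg c X) Y)).
- exact: (linear_comp rl (el _)).
- exact: (linear_comp (el _) rl).
move=> x x'; move: Y; apply: (@tensor_ext K A A _ (fun Y => mulr_leg c (env_mul _ Y))).
- exact: (linear_comp rl (er _)).
- exact: er.
by move=> y y'; rewrite mulr_legE !env_mulE mulr_legE mulrA.
Qed.

Lemma mulr_leg_lmul (c a : A) (Y : A ⊗ A) : mulr_leg c (env_mul (a ⊗ 1) Y) = env_mul (a ⊗ 1) (mulr_leg c Y).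
Proof.
have rl := mulr_leg_linear c; have [el er] := env_mul_bilin A.
move: Y; apply: (@tensor_ext K A A _ (fun Y => mulr_leg c (env_mul _ Y)) (fun Y => env_mul _ (mulr_leg c Y))).
- exact: (linear_comp rl (er _)).
- exact: (linear_comp (er _) rl).
by move=> y y'; rewrite mulr_legE !env_mulE mulr_legE !mulr1.
Qed.

Lemma pair_eval_mulr_leg (F G : A -> A) (c : A) (Z : A ⊗ A) : gauge F -> gauge G -> pair_eval F G (mulr_leg c Z) = pair_eval F G Z * G c.
Proof.
move=> gF gG; have Fl := gauge_linear gF; have Gl := gauge_linear gG.
have el := pair_eval_linear Fl Gl.
move: Z; apply: (@tensor_ext K A A _ (fun Z => pair_eval F G (mulr_leg c Z)) (fun Z => pair_eval F G Z * G c)).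
- exact: (linear_comp el (mulr_leg_linear c)).
- exact: mulr_comp.
by move=> x x'; rewrite mulr_legE !pair_evalE // (gaugeM gG) mulrA.
Qed.

Lemma bisection_linear s : bisection s -> linear s. Proof. by case. Qed.

Lemma es_mul1 (X : C) : es_mul (es_one dA) X = X.
Proof.
apply: val_inj; rewrite val_es_mul; move: (val X).
apply: (@tensor_ext K A A _ (env_mul _) id) => //; first exact: (env_mul_bilin A).2.
by move=> x x'; rewrite /= env_mulE mul1r mulr1.
Qed.

Lemma es_mulr1 (X : C) : es_mul X (es_one dA) = X.
Proof.
apply: val_inj; rewrite val_es_mul; move: (val X).
apply: (@tensor_ext K A A _ (fun Z => env_mul Z (val (es_one dA))) id) => //; first exact: (env_mul_bilin A).1.
by move=> x x'; rewrite /= env_mulE mul1r mulr1.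
Qed.

Section OneBisection.
Variable s : C -> B.
Hypothesis bs : bisection s.

Lemma bisection_source b : s (es_source b) = b.
Proof.
have [_ s1 s2 _] := bs; have := s2 b 1 (es_one dA).
by rewrite -[es_target 1]/(es_one dA) !es_mulr1 s1 !mulr1.
Qed.

Lemma bisection_target b : s (es_target b) = b.
Proof.
have [_ s1 s2 _] := bs; have := s2 1 b (es_one dA).
by rewrite -[es_source 1]/(es_one dA) es_mul1 !es_mulr1 s1 !mul1r.
Qed.

Lemma bisection_actr X b : s (es_actr X b) = s X * b.
Proof.
have [_ s1 s2 _] := bs; have := s2 1 b X.
by rewrite -[es_source 1]/(es_one dA) es_mul1 mul1r.
Qed.

Lemma bisection_actl X b : s (es_actl b X) = b * s X.
Proof.
have [_ s1 s2 _] := bs; have := s2 b 1 X.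
by rewrite -[es_target 1]/(es_one dA) es_mulr1 mulr1.
Qed.

Definition bis_lift : CB actl -> A := blift (fun X c => val (s X) * c).

Lemma bis_lift_bal : balanced es_actr actl (fun X c => val (s X) * c).
Proof.
have sD := lin_add (bisection_linear bs).
apply: balancedI => [c X Y|X x y|X b c].
- by rewrite sD val_coinvD mulrDl.
- by rewrite mulrDr.
- by rewrite bisection_actr val_coinvM mulrA.
Qed.

Variable es_spani : A ⊗ A -> CB actl.
Hypothesis es_spanK : cancel es_span es_spani.
Hypothesis es_spaniK : cancel es_spani es_span.

Definition bis_ext (Z : A ⊗ A) : A := bis_lift (es_spani Z).

Lemma bis_extD : madd bis_ext.
Proof. exact: madd_comp (bliftD bis_lift_bal) (es_spaniD es_spanK es_spaniK). Qed.

Lemma bis_extE (X : C) c : bis_ext (mulr_leg c (val X)) = val (s X) * c.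
Proof. by rewrite /bis_ext (es_spani_mulr_leg es_spanK) /bis_lift (bliftE bis_lift_bal). Qed.

Let text := es_span_ext es_spaniK.

Lemma bis_ext_linear : linear bis_ext.
Proof.
apply: linearI => [|k]; first exact: bis_extD.
apply: (text (f := fun Z => bis_ext (k *: Z)) (g := fun Z => k *: bis_ext Z)).
- by move=> x y; rewrite scalerDr bis_extD.
- by move=> x y; rewrite bis_extD scalerDr.
- by move=> X c; rewrite -(linZ (mulr_leg_linearl _)) !bis_extE scalerAr.
Qed.

Lemma bis_ext_mulr_leg c Z : bis_ext (mulr_leg c Z) = bis_ext Z * c.
Proof.
move: Z; apply: (text (f := fun Z => bis_ext (mulr_leg c Z)) (g := fun Z => bis_ext Z * c)).
- exact: madd_comp bis_extD (lin_add (mulr_leg_linear c)).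
- by move=> x y; rewrite bis_extD mulrDl.
- by move=> X c'; rewrite mulr_legM !bis_extE mulrA.
Qed.

(** The third axiom at Y = t(b), where the bisection takes the value b. On a ⊗ 1 it says that
    [bis_gauge] is right B-linear. *)
Lemma bis_ext_source_target (b : B) (Z : A ⊗ A) :
  bis_ext (env_mul Z (val b ⊗ 1)) = bis_ext (env_mul Z (1 ⊗ val b)).
Proof.
have [_ _ _ s3] := bs; have [el _] := env_mul_bilin A.
move: Z; apply: (text (f := fun Z : A ⊗ A => bis_ext (env_mul Z (val b ⊗ 1)))
  (g := fun Z : A ⊗ A => bis_ext (env_mul Z (1 ⊗ val b)))).
- exact: madd_comp bis_extD (lin_add (el _)).
- exact: madd_comp bis_extD (lin_add (el _)).
move=> X c; rewrite -!mulr_leg_env_mul -val_es_source -val_es_target -!val_es_mul !bis_extE.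
by rewrite -(s3 X (es_target b)) bisection_target.
Qed.

Lemma bis_ext_mul (Y : C) Z :
  bis_ext (env_mul Z (val Y)) = bis_ext (env_mul Z (val (s Y) ⊗ 1)).
Proof.
have [_ _ _ s3] := bs; have [el _] := env_mul_bilin A.
move: Z; apply: (text (f := fun Z : A ⊗ A => bis_ext (env_mul Z (val Y)))
  (g := fun Z : A ⊗ A => bis_ext (env_mul Z (val (s Y) ⊗ 1)))).
- exact: madd_comp bis_extD (lin_add (el _)).
- exact: madd_comp bis_extD (lin_add (el _)).
by move=> X c; rewrite -!mulr_leg_env_mul -val_es_source -!val_es_mul !bis_extE s3.
Qed.

Definition bis_gauge (a : A) : A := bis_ext (a ⊗ 1).

Lemma bis_ext_pure a c : bis_ext (a ⊗ c) = bis_gauge a * c.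
Proof. by rewrite /bis_gauge -bis_ext_mulr_leg mulr_legE mul1r. Qed.

Lemma bis_gauge_mulr a (b : B) : bis_gauge (a * val b) = bis_gauge a * val b.
Proof.
have := bis_ext_source_target b (a ⊗ 1); rewrite !env_mulE !mulr1 => E.
by rewrite /bis_gauge E bis_ext_pure.
Qed.

(** Source of multiplicativity. For Z = Y·c the third axiom replaces Y by s(Y) ⊗ 1, which turns a
    into a s(Y), and right B-linearity extracts s(Y) again. *)
Lemma bis_ext_lmul a Z : bis_ext (env_mul (a ⊗ 1) Z) = bis_gauge a * bis_ext Z.
Proof.
have [_ er] := env_mul_bilin A.
move: Z; apply: (text (f := fun Z : A ⊗ A => bis_ext (env_mul (a ⊗ 1) Z)) (g := fun Z => bis_gauge a * bis_ext Z)).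
- exact: madd_comp bis_extD (lin_add (er _)).
- by move=> x y; rewrite bis_extD mulrDr.
move=> Y c; rewrite -mulr_leg_lmul bis_ext_mulr_leg bis_ext_mul env_mulE !mulr1 bis_extE mulrA.
by rewrite -bis_gauge_mulr.
Qed.

(** On X·c both sides are s(X)c_(0) ⊗ c_(1), because s(X) and X are coinvariant. *)
Lemma bis_ext_coact Z : delta (bis_ext Z) = tmap bis_ext id (codiag dA Z).
Proof.
have tl : linear (tmap bis_ext id : T -> A ⊗ H) by apply: tmap_linear => //; apply: bis_ext_linear.
have dl := delta_linear dA.
move: Z; apply: (text (f := fun Z => delta (bis_ext Z)) (g := fun Z => tmap bis_ext id (codiag dA Z))).
- exact: madd_comp (lin_add dl) bis_extD.
- exact: lin_add (linear_comp tl (codiag_linear dA)).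
move=> X c; rewrite bis_extE codiag_mulr_leg /mulr_coact coactE (elimT (coinv_predP _ _) (valP (s X))).
move: (delta c); apply: (@tensor_ext K A H _ (talg_mul (val (s X) ⊗ 1))
  (fun u => tmap bis_ext id (tmap (fun c0 => mulr_leg c0 (val X)) id u))).
- exact: (tmul2_bilin (mul_bilin A) (mul_bilin H)).2.
- apply: (linear_comp tl); apply: tmap_linear => //; exact: mulr_leg_linearl.
move=> a h; rewrite /talg_mul (tmul2E (mul_bilin A) (mul_bilin H)) mul1r.
rewrite (tmapE (mulr_leg_linearl _)) // (tmapE bis_ext_linear) // bis_extE //.
Qed.

Lemma bis_gauge_gauge : gauge bis_gauge.
Proof.
have fb (b : B) : bis_gauge (val b) = val b.
  by rewrite /bis_gauge -val_es_source -[val _]mulr_leg1 bis_extE bisection_source mulr1.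
split=> //.
- exact: (linear_comp bis_ext_linear (tpurel _)).
- split; first exact: (fb 1).
  move=> a a'; rewrite {1}/bis_gauge -[_ ⊗ 1](_ : env_mul (a ⊗ 1) (a' ⊗ 1) = _).
    by rewrite bis_ext_lmul.
  by rewrite env_mulE mulr1.
- move=> a; rewrite {1}/bis_gauge bis_ext_coact codiagE.
  have [_ -> _] := coact_alg dA.
  have tl : linear (tmap bis_ext id : T -> A ⊗ H) by apply: tmap_linear => //; apply: bis_ext_linear.
  have gl : linear bis_gauge := linear_comp bis_ext_linear (tpurel _).
  move: (delta a); apply: (@tensor_ext K A H _ (fun u => tmap bis_ext id (codiag_pair u (1 ⊗ 1)))).
  + exact: (linear_comp tl ((codiag_pair_bilin H A).1 _)).
  + exact: tmap_linear.
  + by move=> x h; rewrite codiag_pairE mulr1 (tmapE bis_ext_linear) // (tmapE gl).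
Qed.

Lemma pair_bis_bis_gauge : pair_bis bis_gauge id = s.
Proof.
apply/funext=> X; apply: val_inj; rewrite (val_pair_bis bis_gauge_gauge gauge_id).
have bl := gauge_linear bis_gauge_gauge; have il : linear (id : A -> A) by [].
have -> Z : pair_eval bis_gauge id Z = bis_ext Z.
  move: Z; apply: (@tensor_ext K A A _ (pair_eval bis_gauge id) bis_ext).
  - exact: pair_eval_linear.
  - exact: bis_ext_linear.
  - by move=> a c; rewrite pair_evalE // bis_ext_pure.
by rewrite -[val X]mulr_leg1 bis_extE mulr1.
Qed.
End OneBisection.

Variable es_spani : A ⊗ A -> CB actl.
Hypothesis es_spanK : cancel es_span es_spani.
Hypothesis es_spaniK : cancel es_spani es_span.

Let text := es_span_ext es_spaniK.

Lemma bisection_pair_bis s : bisection s -> exists2 F, gauge F & pair_bis F id = s.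
Proof.
move=> bs; exists (bis_gauge s es_spani); first exact: bis_gauge_gauge.
exact: pair_bis_bis_gauge.
Qed.

(** Agreement on C spreads to A ⊗ A, since F(x)x' is right A-linear in x' and the X·c generate;
    evaluation at a ⊗ 1 then recovers F(a). *)
Lemma pair_bis_inj F F' : gauge F -> gauge F' -> pair_bis F id = pair_bis F' id -> F = F'.
Proof.
move=> gF gF' E; have gi := gauge_id; apply/funext=> a.
have Fl := gauge_linear gF; have Fl' := gauge_linear gF'; have il := gauge_linear gi.
have eq Z : pair_eval F id Z = pair_eval F' id Z.
  move: Z; apply: text; [exact/lin_add/pair_eval_linear|exact/lin_add/pair_eval_linear|].
  by move=> X c; rewrite !pair_eval_mulr_leg // -(val_pair_bis gF gi) -(val_pair_bis gF' gi) E.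
by have := eq (a ⊗ 1); rewrite !pair_evalE // !mulr1.
Qed.

(** F'(x)x' lies in B, so F fixes it; but F sends it to F(F'(x))F(x') = xF(x'). *)
Lemma pair_bis_inv F F' : gauge F -> gauge F' -> (forall a, F (F' a) = a) ->
  pair_bis id F = pair_bis F' id.
Proof.
move=> gF gF' FF'; have gi := gauge_id; apply/funext=> X; apply: val_inj.
have Fl := gauge_linear gF; have Fl' := gauge_linear gF'; have il := gauge_linear gi.
rewrite (val_pair_bis gi gF) -(gauge_coinv (pair_bis F' id X) gF) (val_pair_bis gF' gi).
move: (val X); apply: (@tensor_ext K A A _ (pair_eval id F) (fun Z => F (pair_eval F' id Z))).
- exact: pair_eval_linear.
- exact: (linear_comp Fl (pair_eval_linear Fl' il)).
by move=> x x'; rewrite !pair_evalE // (gaugeM gF) FF'.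
Qed.

(** Surjectivity of F |-> F(x)x' onto the bisections, applied to xF(x'), provides F' with F'(x)x' =
    xF(x') on C. *)
Lemma gauge_rinv F : gauge F -> exists2 F', gauge F' & forall a, F (F' a) = a.
Proof.
move=> gF; have gi := gauge_id.
have [F' gF' E] := bisection_pair_bis (pair_bis_bisection gi gF); exists F' => // a.
have Fl := gauge_linear gF; have Fl' := gauge_linear gF'; have il := gauge_linear gi.
have gFF := gauge_comp gF gF'; have FFl := gauge_linear gFF.
(* Applying F to F'(x)x', which lies in B, gives F(F'(x))F(x') = xF(x') on C. Multiplying the second
   leg by c multiplies both sides by F(c), so the equation spreads to A ⊗ A, where a ⊗ 1 is
   available. *)
have eq Z : pair_eval (F \o F') F Z = pair_eval id F Z.
  move: Z; apply: text; [exact/lin_add/pair_eval_linear|exact/lin_add/pair_eval_linear|].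
  move=> X c; rewrite !pair_eval_mulr_leg //; congr (_ * _).
  rewrite -(val_pair_bis gi gF) -E -[in RHS](gauge_coinv (pair_bis F' id X) gF) (val_pair_bis gF' gi).
  move: (val X); apply: (@tensor_ext K A A _ (pair_eval _ F) (fun Z => F (pair_eval F' id Z))).
  - exact: pair_eval_linear.
  - exact: (linear_comp Fl (pair_eval_linear Fl' il)).
  by move=> x x'; rewrite !pair_evalE //= (gaugeM gF).
by have := eq (a ⊗ 1); rewrite !pair_evalE //= (gauge1 gF) !mulr1.
Qed.

(** In a monoid where every element has a right inverse, these inverses are two-sided. *)
Lemma gauge_inv F : gauge F ->
  exists F', [/\ gauge F', forall a, F (F' a) = a & forall a, F' (F a) = a].
Proof.
move=> gF; have [F' gF' FF'] := gauge_rinv gF; have [F'' gF'' FF''] := gauge_rinv gF'.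
exists F'; split=> // a; suff -> : F a = F'' a by [].
by rewrite -[in LHS](FF'' a) FF'.
Qed.

Variable cani : A ⊗ H -> AtensBA dA.
Hypothesis canK : cancel (@canonical_map _ _ _ _ dA) cani.
Hypothesis caniK : cancel cani (@canonical_map _ _ _ _ dA).
Hypothesis coproduct_exists : forall X : C,
  exists Z : CtensBC dA, CtensBC_incl Z = env_coproduct dA (val X).

(** The order is reversed because G, applied second, acts on the outcome of F: the bisection of F
    takes values in B, which G fixes and can absorb. *)
Lemma convolution_pair_bis F G : gauge F -> gauge G ->
  convolution dA (pair_bis F id) (pair_bis G id) = pair_bis (G \o F) id.
Proof.
move=> gF gG; have gi := gauge_id; have gGF := gauge_comp gG gF.
have Fl := gauge_linear gF; have Gl := gauge_linear gG; have il := gauge_linear gi.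
have GFl := gauge_linear gGF.
have eF := lin_add (pair_eval_linear Fl il); have eG := lin_add (pair_eval_linear Gl il).
(* The convolution integrand extended from C ⊗_B C to A ⊗ A ⊗_B A ⊗ A. Through it the value depends
   only on the image of [es_coproduct] X under the inclusion, which is given by the explicit
   formula. *)
pose P := blift (fun Y Z => pair_eval F id Y * pair_eval G id Z) : AAtensBAA dA -> A.
have PB : balanced env_actr env_actl (fun Y Z => pair_eval F id Y * pair_eval G id Z).
  apply: balancedI => [Z Y Y'|Y Z Z'|Y b Z].
  - by rewrite eF mulrDl.
  - by rewrite eG mulrDr.
  - rewrite /Defs.env_actr env_mul_targetl pair_eval_mulr_leg // -mulrA; congr (_ * _).
    move: Z; apply: (@tensor_ext K A A _ (fun Z => val b * pair_eval G id Z)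
      (fun Z => pair_eval G id (env_actl b Z))).
    + by apply: mull_comp; apply: pair_eval_linear.
    + exact: (linear_comp (pair_eval_linear Gl il) (env_actl_linear b)).
    + by move=> x x'; rewrite env_actl_pure !pair_evalE // (gaugeM gG) (gauge_coinv b gG) mulrA.
have PD : madd P := bliftD PB.
have PE Y Z : P (bpure env_actr env_actl Y Z) = pair_eval F id Y * pair_eval G id Z := bliftE PB Y Z.
have bF := pair_bis_bisection gF gi; have bG := pair_bis_bisection gG gi.
have sB : balanced es_actr es_actl (fun Y Z => pair_bis F id Y * pair_bis G id Z).
  have sF := lin_add (bisection_linear bF); have sG := lin_add (bisection_linear bG).
  apply: balancedI => [Z Y Y'|Y Z Z'|Y b Z].
  - by rewrite sF mulrDl.
  - by rewrite sG mulrDr.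
  - by rewrite (bisection_actr bF) (bisection_actl bG) mulrA.
apply/funext=> X; apply: val_inj; rewrite (val_pair_bis gGF gi).
have [Z0 Z0E] : exists Z0, es_coproduct X = Z0 /\ CtensBC_incl Z0 = env_coproduct dA (val X).
  exists (es_coproduct X); split=> //; rewrite /es_coproduct.
  by case: xgetP => [Z _ //|N]; have [Z ZE] := coproduct_exists X; case: (N Z).
rewrite /convolution Z0E.1.
have -> : val (blift (fun Y Z => pair_bis F id Y * pair_bis G id Z) Z0) = P (CtensBC_incl Z0).
  move: Z0 {Z0E}; apply: (btens_ext
    (f := fun Z0 => val (blift (fun Y Z => pair_bis F id Y * pair_bis G id Z) Z0))
    (g := fun Z0 => P (CtensBC_incl Z0))).
  - exact: madd_comp val_coinvD (bliftD sB).
  - exact: madd_comp PD (bmapD (@val_rhom _ _ _ _ dA) (@val_outer_lhom _ _ _ _ dA)).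
  move=> Y Z; rewrite (bliftE sB) val_coinvM (val_pair_bis gF gi) (val_pair_bis gG gi).
  rewrite -PE; congr P; apply: esym.
  exact: (bmapE (@val_rhom _ _ _ _ dA) (@val_outer_lhom _ _ _ _ dA)).
rewrite Z0E.2 -(incl_coproduct_lift canK caniK es_spanK es_spaniK).
have vH := @val_rhom _ _ _ _ dA; have vD := bmapD vH (lhom_id env_actl).
have vE := bmapE vH (lhom_id env_actl).
have wD := coproduct_liftD es_spanK es_spaniK.
move: (val X); apply: (tensor_ext_add
  (f := fun Z => P (bmap (val : C -> A ⊗ A) id (coproduct_lift es_spani Z))) (g := pair_eval (G \o F) id)).
- exact: madd_comp PD (madd_comp vD wD).
- exact/lin_add/pair_eval_linear.
move=> a a'; rewrite (coproduct_liftE es_spanK es_spaniK) pair_evalE //=.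
have tl := @tpure_actl_lhom _ _ _ _ dA a'.
(* For z = Y·c the left side is s(Y)G(c)a' with s the bisection of F, and s(Y) = G(s(Y)) gives
   G(s(Y)c)a'. At z = a ⊗ 1 this is G(F(a))a'. *)
have -> z : P (bmap (val : C -> A ⊗ A) id (bmap id (fun c : A => c ⊗ a') (es_spani z) : CB env_actl))
    = G (pair_eval F id z) * a'.
  move: z; apply: (text (f := fun z => P (bmap (val : C -> A ⊗ A) id
      (bmap id (fun c : A => c ⊗ a') (es_spani z) : CB env_actl)))
    (g := fun z => G (pair_eval F id z) * a')).
  - exact: madd_comp PD (madd_comp vD (madd_comp (bmapCD tl) (es_spaniD es_spanK es_spaniK))).
  - by move=> x y; rewrite eF (lin_add Gl) mulrDl.
  move=> Y c; rewrite (es_spani_mulr_leg es_spanK) (bmapCE tl) vE PE pair_eval_mulr_leg // pair_evalE //.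
  by rewrite (gaugeM gG) -(val_pair_bis gF gi) (gauge_coinv _ gG) mulrA.
by rewrite pair_evalE // mulr1.
Qed.

Lemma counit_pair_bis : es_counit dA = pair_bis id id.
Proof.
apply/funext=> X; apply: val_inj; rewrite (val_pair_bis gauge_id gauge_id) /pair_eval tmap_id.
by [].
Qed.

End Bisections.

(** * The isomorphism of groups *)

Arguments pair_bis {K H hH A} dA F G X.

(** The construction uses only that the ground ring is a field, so it is carried out over an
    arbitrary one. *)
Theorem gauge_bisection (K : fieldType) (H : algType K) (hH : hopf_algebra H)
    (A : algType K) (dA : comodule_algebra hH A) :
  hopf_galois dA -> faithfully_flat dA ->
  [/\ is_group (gauge dA) (fun F G => F \o G) id,
      is_group (bisection dA) (convolution dA) (es_counit dA)
    & exists alpha : (A -> A) -> (es dA -> coinv dA),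
        group_isomorphism (gauge dA) (fun F G => F \o G)
                          (bisection dA) (convolution dA) alpha].
Proof.
move=> [cani canK caniK] ff.
have /choice[inner_evali inner_evaliK] := inner_eval_surj canK caniK ff.
have inner_evalK : cancel (@inner_eval _ _ _ _ dA) inner_evali.
  by move=> y; apply: (inner_eval_inj canK caniK ff); rewrite inner_evaliK.
have [es_spani es_spanK es_spaniK] := es_span_bij canK caniK inner_evalK inner_evaliK ff.
have cop := es_coproduct_exists canK caniK es_spanK es_spaniK inner_evalK inner_evaliK ff.
have gid := gauge_id dA.
have gcomp := @gauge_comp _ _ _ _ dA.
have ginv := gauge_inv es_spanK es_spaniK.
have bsig := bisection_pair_bis es_spanK es_spaniK.
have conv F G : gauge dA F -> gauge dA G -> convolution dA (pair_bis dA F id) (pair_bis dA G id)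
    = pair_bis dA (G \o F) id.
  exact: (convolution_pair_bis es_spanK es_spaniK canK caniK cop).
split.
- split=> // F gF; have [F' [gF' E E']] := ginv F gF; exists F' => //.
  by split; apply/funext.
(* Every bisection is F(x)x' for a gauge transformation F, and convolution becomes composition in
   reverse order; the group axioms are transported along this correspondence. *)
- rewrite counit_pair_bis; split.
  + exact: pair_bis_bisection.
  + move=> _ _ /bsig[F gF <-] /bsig[G gG <-]; rewrite conv //.
    by apply: pair_bis_bisection => //; apply: gcomp.
  + move=> _ _ _ /bsig[F gF <-] /bsig[G gG <-] /bsig[L gL <-].
    by rewrite !conv //; apply: gcomp.
  + by move=> _ /bsig[F gF <-]; rewrite !conv.
  + move=> _ /bsig[F gF <-]; have [F' [gF' E E']] := ginv F gF.
    exists (pair_bis dA F' id); first exact: pair_bis_bisection.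
    by rewrite !conv //; split; congr (pair_bis dA _ id); apply/funext.
(* xF(x') is the bisection F^-1(x)x'. Inversion undoes the reversal of products, and each property
   is reduced to the corresponding one of F |-> F(x)x' by passing to inverses. *)
- exists (pair_bis dA id); split; first split.
  + by move=> F gF; apply: pair_bis_bisection.
  + move=> F G; rewrite !inE => gF gG.
    have [F' [gF' E1 E2]] := ginv F gF; have [G' [gG' E3 E4]] := ginv G gG.
    rewrite (pair_bis_inv gF gF' E1) (pair_bis_inv gG gG' E3).
    move/(pair_bis_inj es_spaniK gF' gG') => E; apply/funext=> a.
    by rewrite -[a in LHS]E4 -E E1.
  + move=> _ /bsig[F gF <-]; have [F' [gF' E1 E2]] := ginv F gF.
    by exists F' => //; rewrite (pair_bis_inv gF' gF E2).
  + move=> F G gF gG.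
    have [F' [gF' E1 E2]] := ginv F gF; have [G' [gG' E3 E4]] := ginv G gG.
    rewrite (pair_bis_inv gF gF' E1) (pair_bis_inv gG gG' E3) conv //.
    apply: pair_bis_inv; try exact: gcomp.
    by move=> a /=; rewrite E3 E1.
Qed.

(** The complex numbers are [R[i]] for any model [R] of the real numbers. *)
Theorem proposition4p6 (R : realType) (H : algType R[i]) (hH : hopf_algebra H)
    (A : algType R[i]) (dA : comodule_algebra hH A) :
  hopf_galois dA -> faithfully_flat dA ->
  [/\ is_group (gauge dA) (fun F G => F \o G) id,
      is_group (bisection dA) (convolution dA) (es_counit dA)
    & exists alpha : (A -> A) -> (es dA -> coinv dA),
        group_isomorphism (gauge dA) (fun F G => F \o G)
                          (bisection dA) (convolution dA) alpha].
Proof. exact: gauge_bisection. Qed.
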